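(* Let $d=4$ (so $W$ is a Weyl group of type $B_2$ and $\mathbb{C}[\mathcal{C}]=\mathbb{C}[A,B]$). The $\mathbb{C}[A,B]$-algebra $Z$ admits the following presentation: generators $q,r,Q,R,\mathbf{eu},\mathbf{a}_1,\mathbf{a}_2,\mathbf{a}_3$; relations $$\begin{aligned} \mathbf{eu}\,\mathbf{a}_1&=q\,\mathbf{a}_2+rQ-2(A^2-B^2)q,\\ \mathbf{eu}\,\mathbf{a}_2&=q\,\mathbf{a}_3+Q\,\mathbf{a}_1-2(A^2-B^2)\mathbf{eu},\\ \mathbf{eu}\,\mathbf{a}_3&=qR+Q\,\mathbf{a}_2-2(A^2-B^2)Q,\\ \mathbf{a}_1^2&=r\,\mathbf{a}_2-q^2\mathbf{eu}^2+4q^3Q+2(A^2-B^2)r+8(A^2+B^2)q^2,\\ \mathbf{a}_1\mathbf{a}_2&=r\,\mathbf{a}_3-q\,\mathbf{eu}^3+4q^2Q\,\mathbf{eu}+2(A^2-B^2)\mathbf{a}_1+8(A^2+B^2)q\,\mathbf{eu},\\ \mathbf{a}_1\mathbf{a}_3&=rR-\mathbf{eu}^4+5qQ\,\mathbf{eu}^2-4q^2Q^2+4(A^2-B^2)\mathbf{a}_2+8(A^2+B^2)\mathbf{eu}^2-8(A^2+B^2)qQ-8(A^2-B^2)^2,\\ \mathbf{a}_2^2&=rR-\mathbf{eu}^4+4qQ\,\mathbf{eu}^2+4(A^2-B^2)\mathbf{a}_2+8(A^2+B^2)\mathbf{eu}^2-4(A^2-B^2)^2,\\ \mathbf{a}_2\mathbf{a}_3&=R\,\mathbf{a}_1-Q\,\mathbf{eu}^3+4qQ^2\mathbf{eu}+2(A^2-B^2)\mathbf{a}_3+8(A^2+B^2)Q\,\mathbf{eu},\\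 \mathbf{a}_3^2&=R\,\mathbf{a}_2-Q^2\mathbf{eu}^2+4qQ^3+2(A^2-B^2)R+8(A^2+B^2)Q^2. \end{aligned}$$
   Context: Let $d=4$ and let $\zeta$ be a primitive $d$-th root of unity. $V=\mathbb{C}^2$ has canonical basis $(x,y)$, $V^*$ dual basis $(X,Y)$; $\mathbb{C}[V]=\mathbb{C}[X,Y]$, $\mathbb{C}[V^*]=\mathbb{C}[x,y]$. For $i\in\mathbb{Z}/d\mathbb{Z}$, $s_i=\begin{pmatrix}0&\zeta^i\\ \zeta^{-i}&0\end{pmatrix}$, $\alpha_i^\vee=\zeta^ix-y$, $\alpha_i=X-\zeta^iY$; $W=\langle s_0,s_1\rangle$ is dihedral of order $2d$, $\mathrm{Ref}(W)=\{s_i\}$. $\mathcal{C}$ is the space of functions $\mathrm{Ref}(W)\to\mathbb{C}$ constant on conjugacy classes, $C_i\in\mathcal{C}^*$ is evaluation at $s_i$; $C_i=C_{i+2}$, $A=C_0$, $B=C_1$. $\mathbf{H}$ (generic rational Cherednik algebra at $t=0$) is the quotient of $\mathbb{C}[\mathcal{C}]\otimes(T(V\oplus V^* )\rtimes W)$ by $[u,u']=[U,U']=0$, $[u,U]=-2\sum_iC_i\frac{\langle u,\alpha_i\rangle\langle\alpha_i^\vee,U\rangle}{\langle\alpha_i^\vee,\alpha_i\rangle}s_i$ ($u,u'\in V$, $U,U'\in V^*$); $Z$ is its centre. Multiplication gives $\mathbb{C}[\mathcal{C}]\otimes\mathbb{C}[V]\otimes\mathbb{C}W\otimes\mathbb{C}[V^*]\cong\mathbf{H}$;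 $\mathrm{Trunc}:\mathbf{H}\to\mathbb{C}[\mathcal{C}]\otimes\mathbb{C}[V]\otimes\mathbb{C}[V^*]$ takes the coefficient of $1\in W$ and restricts to a bijection $Z\cong\mathbb{C}[\mathcal{C}\times V\times V^*]^W$. $q=xy$, $r=x^d+y^d$, $Q=XY$, $R=X^d+Y^d$ lie in $Z$; $\mathbf{eu}=\mathrm{Trunc}^{-1}(xX+yY)$ and $\mathbf{a}_i=\mathrm{Trunc}^{-1}(x^{d-i}Y^i+y^{d-i}X^i)$. *)

(* Defs.v *)
From HB Require Import structures.
From mathcomp Require Import all_boot all_order all_fingroup all_algebra.
From mathcomp Require Import generic_quotient ring_quotient.
From mathcomp Require Import boolp classical_sets reals complex.
From mathcomp Require Import finmap monalg.
From mathcomp Require Import mpoly.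

Set Implicit Arguments.
Unset Strict Implicit.
Unset Printing Implicit Defensive.

Import GRing.Theory.
Local Open Scope ring_scope.

Inductive gen_ideal (S : nzRingType) (rel : S -> Prop) : S -> Prop :=
| GenIdeal_gen h of rel h : gen_ideal rel h
| GenIdeal_zero : gen_ideal rel 0
| GenIdeal_add h h' of gen_ideal rel h & gen_ideal rel h' :
    gen_ideal rel (h + h')
| GenIdeal_mull a h of gen_ideal rel h : gen_ideal rel (a * h)
| GenIdeal_mulr h a of gen_ideal rel h : gen_ideal rel (h * a).

Definition ideal_pred (S : nzRingType) (rel : S -> Prop) (h : S) : bool :=
  `[< gen_ideal rel h >].

Lemma ideal_pred_zmod_closed (S : nzRingType) (rel : S -> Prop) :
  zmod_closed (ideal_pred rel).
Proof.
split=> [|x y /asboolP hx /asboolP hy]; apply/asboolP.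
  exact: GenIdeal_zero.
by rewrite -mulN1r; apply: GenIdeal_add => //; apply: GenIdeal_mull.
Qed.

HB.instance Definition _ (S : nzRingType) (rel : S -> Prop) :=
  GRing.isZmodClosed.Build S (ideal_pred rel) (ideal_pred_zmod_closed rel).

Definition alg_quot (k : comNzRingType) (S : algType k) (rel : S -> Prop)
    of ~ gen_ideal rel 1 : Type :=
  {ideal_quot GRing.ZmodClosed.clone S (ideal_pred rel) _}.

HB.instance Definition _ (k : comNzRingType) (S : algType k) (rel : S -> Prop)
    (proper : ~ gen_ideal rel 1) :=
  GRing.Zmodule.copy (alg_quot proper)
    {ideal_quot GRing.ZmodClosed.clone S (ideal_pred rel) _}.

HB.lock Definition aq_pi (k : comNzRingType) (S : algType k) (rel : S -> Prop)
    (proper : ~ gen_ideal rel 1) (h : S) : alg_quot proper :=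
  \pi_({ideal_quot GRing.ZmodClosed.clone S (ideal_pred rel) _})%qT h.
HB.lock Definition aq_repr (k : comNzRingType) (S : algType k)
    (rel : S -> Prop) (proper : ~ gen_ideal rel 1) (x : alg_quot proper) : S :=
  repr (x : {ideal_quot GRing.ZmodClosed.clone S (ideal_pred rel) _}).

Section AlgQuot.
Variables (k : comNzRingType) (S : algType k) (rel : S -> Prop).
Hypothesis proper : ~ gen_ideal rel 1.
Local Notation Q := (alg_quot proper).
Local Notation aq_pi := (aq_pi proper).
Local Notation aq_repr := (@aq_repr _ _ _ proper).

Lemma aq_reprK : cancel aq_repr aq_pi.
Proof. by move=> x; rewrite aq_pi.unlock aq_repr.unlock reprK. Qed.

Lemma aq_piP (h h' : S) : aq_pi h = aq_pi h' <-> gen_ideal rel (h - h').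
Proof.
rewrite aq_pi.unlock; split=> [/eqP|hh].
  by rewrite -Quotient.idealrBE => /asboolP.
by apply/eqP; rewrite -Quotient.idealrBE; apply/asboolP.
Qed.

Lemma aq_pi0 : aq_pi 0 = 0.
Proof. by rewrite aq_pi.unlock raddf0. Qed.

Lemma aq_piD : {morph aq_pi : x y / x + y}.
Proof. by move=> x y; rewrite aq_pi.unlock raddfD. Qed.

Definition aq_one : Q := aq_pi 1.
Definition aq_mul (x y : Q) : Q := aq_pi (aq_repr x * aq_repr y).

Lemma aq_piM (x y : S) : aq_mul (aq_pi x) (aq_pi y) = aq_pi (x * y).
Proof.
apply/aq_piP.
have hx : gen_ideal rel (aq_repr (aq_pi x) - x) by apply/aq_piP/aq_reprK.
have hy : gen_ideal rel (aq_repr (aq_pi y) - y) by apply/aq_piP/aq_reprK.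
set x' := aq_repr _; set y' := aq_repr _.
have -> : x' * y' - x * y = (x' - x) * y' + x * (y' - y).
  by rewrite mulrBl mulrBr addrA subrK.
by apply: GenIdeal_add; [apply: GenIdeal_mulr | apply: GenIdeal_mull].
Qed.

Lemma aq_mulA : associative aq_mul.
Proof.
by move=> x y z; rewrite -[x]aq_reprK -[y]aq_reprK -[z]aq_reprK !aq_piM mulrA.
Qed.
Lemma aq_mul1r : left_id aq_one aq_mul.
Proof. by move=> x; rewrite -[x]aq_reprK !aq_piM mul1r. Qed.
Lemma aq_mulr1 : right_id aq_one aq_mul.
Proof. by move=> x; rewrite -[x]aq_reprK !aq_piM mulr1. Qed.
Lemma aq_mulDl : left_distributive aq_mul +%R.
Proof.
move=> x y z; rewrite -[x]aq_reprK -[y]aq_reprK -[z]aq_reprK.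
by rewrite -aq_piD !aq_piM -aq_piD mulrDl.
Qed.
Lemma aq_mulDr : right_distributive aq_mul +%R.
Proof.
move=> x y z; rewrite -[x]aq_reprK -[y]aq_reprK -[z]aq_reprK.
by rewrite -aq_piD !aq_piM -aq_piD mulrDr.
Qed.
Lemma aq_oner_neq0 : aq_one != 0.
Proof.
by apply/eqP; rewrite -aq_pi0 => /aq_piP; rewrite subr0; apply: proper.
Qed.

HB.instance Definition _ := GRing.Zmodule_isNzRing.Build Q
  aq_mulA aq_mul1r aq_mulr1 aq_mulDl aq_mulDr aq_oner_neq0.

Definition aq_scale (c : k) (x : Q) : Q := aq_pi c%:A * x.

Lemma aq_piZ c (x : S) : aq_scale c (aq_pi x) = aq_pi (c *: x).
Proof. by rewrite /aq_scale /GRing.mul /= aq_piM -scalerAl mul1r. Qed.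

Lemma aq_scaleA a b x : aq_scale a (aq_scale b x) = aq_scale (a * b) x.
Proof. by rewrite -[x]aq_reprK !aq_piZ scalerA. Qed.
Lemma aq_scale1 : left_id 1 aq_scale.
Proof. by move=> x; rewrite -[x]aq_reprK aq_piZ scale1r. Qed.
Lemma aq_scaleDr : right_distributive aq_scale +%R.
Proof. by move=> c x y; rewrite /aq_scale mulrDr. Qed.
Lemma aq_scaleDl x : {morph aq_scale^~ x : a b / a + b}.
Proof. by move=> a b; rewrite /aq_scale scalerDl aq_piD mulrDl. Qed.

HB.instance Definition _ := GRing.Zmodule_isLmodule.Build k Q
  aq_scaleA aq_scale1 aq_scaleDr aq_scaleDl.

Lemma aq_scaleAl (c : k) (x y : Q) : c *: (x * y) = c *: x * y.
Proof. by rewrite /GRing.scale /= /aq_scale mulrA. Qed.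

HB.instance Definition _ := GRing.Lmodule_isLalgebra.Build k Q aq_scaleAl.

Lemma aq_scaleAr (c : k) (x y : Q) : c *: (x * y) = x * (c *: y).
Proof.
rewrite -[x]aq_reprK -[y]aq_reprK.
by rewrite /GRing.scale /GRing.mul /= aq_piM !aq_piZ aq_piM scalerAr.
Qed.

HB.instance Definition _ := GRing.Lalgebra_isAlgebra.Build k Q aq_scaleAr.

End AlgQuot.

Record alg_action (k : comNzRingType) (T : algType k) (W : finGroupType) :=
  AlgAction {
    act_fun :> W -> T -> T;
    act_linear : forall w, linear (act_fun w);
    act_monoid : forall w, monoid_morphism (act_fun w);
    act_one : forall t, act_fun 1%g t = t;
    act_mul : forall u v t, act_fun (u * v)%g t = act_fun u (act_fun v t)
  }.

(* f stands for \sum_w (f w) w *)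
Definition skew (k : comNzRingType) (T : algType k) (W : finGroupType)
    of alg_action T W : Type := {ffun W -> T}.

HB.instance Definition _ (k : comNzRingType) (T : algType k)
    (W : finGroupType) (a : alg_action T W) :=
  GRing.Lmodule.copy (skew a) {ffun W -> T}.

(* the product determined by (t u) (t' v) = t (u t') (u v) *)
HB.lock Definition skew_mul (k : comNzRingType) (T : algType k)
    (W : finGroupType) (a : alg_action T W) (f g : skew a) : skew a :=
  [ffun w => \sum_(u : W) f u * a u (g (u^-1 * w)%g)].

HB.lock Definition skew_T (k : comNzRingType) (T : algType k)
    (W : finGroupType) (a : alg_action T W) (t : T) : skew a :=
  [ffun w => if w == 1%g then t else 0].
HB.lock Definition skew_W (k : comNzRingType) (T : algType k)
    (W : finGroupType) (a : alg_action T W) (w : W) : skew a :=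
  [ffun u => (u == w)%:R].

Section Skew.
Variables (k : comNzRingType) (T : algType k) (W : finGroupType).
Variable a : alg_action T W.
Local Notation S := (skew a).
Local Notation skew_T := (skew_T a).
Local Notation skew_W := (skew_W a).
Local Notation skew_mul := (@skew_mul _ _ _ a).

Lemma act0 w : a w 0 = 0.
Proof.
have := act_linear a w (-1) 0 0; rewrite scaler0 addr0 => e.
by rewrite e scaleN1r addNr.
Qed.
Lemma actD w x y : a w (x + y) = a w x + a w y.
Proof. by have := act_linear a w 1 x y; rewrite !scale1r. Qed.
Lemma actZ w c x : a w (c *: x) = c *: a w x.
Proof. by have := act_linear a w c x 0; rewrite act0 !addr0. Qed.
Lemma act_sum w (I : finType) (F : I -> T) :
  a w (\sum_i F i) = \sum_i a w (F i).
Proof. exact: (big_morph _ (actD w) (act0 w)). Qed.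

Definition skew_one : S := skew_W 1%g.

Lemma skew_TE t w : skew_T t w = if w == 1%g then t else 0.
Proof. by rewrite skew_T.unlock ffunE. Qed.
Lemma skew_WE v w : skew_W v w = (w == v)%:R.
Proof. by rewrite skew_W.unlock ffunE. Qed.
Lemma skew_mulrE (f g : S) w :
  skew_mul f g w = \sum_(u : W) f u * a u (g (u^-1 * w)%g).
Proof. by rewrite skew_mul.unlock ffunE. Qed.
Lemma skew_addE (f g : S) w : (f + g) w = f w + g w.
Proof. by rewrite ffunE. Qed.
Lemma skew_scaleE c (f : S) w : (c *: f) w = c *: f w.
Proof. by rewrite ffunE. Qed.

Lemma skew_mulA : associative skew_mul.
Proof.
move=> f g h; apply/ffunP => w; rewrite !skew_mulrE.
under eq_bigr => u _.
  rewrite skew_mulrE act_sum big_distrr /=.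
  rewrite (reindex_inj (mulgI u^-1%g)) /=.
  under eq_bigr => v _ do
    rewrite (act_monoid a u).2 mulrA -act_mul invMg invgK mulKVg
            -mulgA mulKVg.
  over.
rewrite exchange_big /=; apply: eq_bigr => v _.
by rewrite skew_mulrE big_distrl.
Qed.

Lemma skew_mul1r : left_id skew_one skew_mul.
Proof.
move=> f; apply/ffunP => w.
rewrite skew_mulrE (bigD1 1%g) //= big1 => [|u hu].
  by rewrite skew_WE eqxx mul1r act_one invg1 mul1g addr0.
by rewrite skew_WE (negbTE hu) mul0r.
Qed.

Lemma skew_mulr1 : right_id skew_one skew_mul.
Proof.
move=> f; apply/ffunP => w.
rewrite skew_mulrE (bigD1 w) //= big1 => [|u hu].
  by rewrite skew_WE mulVg eqxx (act_monoid a w).1 mulr1 addr0.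
by rewrite skew_WE -eq_mulVg1 (negbTE hu) act0 mulr0.
Qed.

Lemma skew_mulDl : left_distributive skew_mul +%R.
Proof.
move=> f g h; apply/ffunP => w.
rewrite skew_addE !skew_mulrE -big_split /=.
by apply: eq_bigr => u _; rewrite skew_addE mulrDl.
Qed.

Lemma skew_mulDr : right_distributive skew_mul +%R.
Proof.
move=> f g h; apply/ffunP => w.
rewrite skew_addE !skew_mulrE -big_split /=.
by apply: eq_bigr => u _; rewrite skew_addE actD mulrDr.
Qed.

Lemma skew_oner_neq0 : skew_one != 0.
Proof.
apply/eqP => /ffunP /(_ 1%g); rewrite skew_WE eqxx ffunE.
by apply/eqP/oner_neq0.
Qed.

HB.instance Definition _ := GRing.Zmodule_isNzRing.Build S
  skew_mulA skew_mul1r skew_mulr1 skew_mulDl skew_mulDr skew_oner_neq0.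

Lemma skew_mulE (f g : S) (w : W) :
  (f * g) w = \sum_(u : W) f u * a u (g (u^-1 * w)%g).
Proof. exact: skew_mulrE. Qed.

Lemma skew_oneE w : (1 : S) w = (w == 1%g)%:R.
Proof. exact: skew_WE. Qed.

Lemma skew_scaleAl (c : k) (f g : S) : c *: (f * g) = c *: f * g.
Proof.
apply/ffunP => w; rewrite skew_scaleE !skew_mulE scaler_sumr.
by apply: eq_bigr => u _; rewrite skew_scaleE scalerAl.
Qed.

HB.instance Definition _ := GRing.Lmodule_isLalgebra.Build k S skew_scaleAl.

Lemma skew_scaleAr (c : k) (f g : S) : c *: (f * g) = f * (c *: g).
Proof.
apply/ffunP => w; rewrite skew_scaleE !skew_mulE scaler_sumr.
by apply: eq_bigr => u _; rewrite skew_scaleE actZ scalerAr.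
Qed.

HB.instance Definition _ := GRing.Lalgebra_isAlgebra.Build k S skew_scaleAr.

End Skew.

Section FreeAlg.
Variables (k : comNzRingType) (I : choiceType).

Definition free_alg : Type := malg {fmonom I} k.
Local Notation T := free_alg.

HB.instance Definition _ := GRing.Lalgebra.on T.

Lemma falg_mulC (c : k) (x : T) : x * mkmalgU monalg.one c = c *: x.
Proof.
rewrite -mul_malgC /GRing.mul /= fgmulgU fgmulUg; apply: eq_bigr => m _.
by rewrite mul1m mulm1 mulrC.
Qed.

Lemma falg_scaleAr (c : k) (x y : T) : c *: (x * y) = x * (c *: y).
Proof. by rewrite -!falg_mulC mulrA. Qed.

HB.instance Definition _ := GRing.Lalgebra_isAlgebra.Build k T falg_scaleAr.

Definition fgen (i : I) : T := mkmalgU (fmu i) 1.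

End FreeAlg.

HB.lock Definition falg_eval (k : comNzRingType) (I : choiceType)
    (A : algType k) (h : I -> A) (t : free_alg k I) : A :=
  monalg.mmap (in_alg A) (fun m : {fmonom I} => \prod_(i <- m) h i) t.

Section Eval.
Variables (k : comNzRingType) (I : choiceType) (A : algType k) (h : I -> A).
Local Notation T := (free_alg k I).
Local Notation fgen := (fgen k).

Let hprod (m : {fmonom I}) : A := \prod_(i <- m) h i.

Lemma falg_hprod_mmorphism : mmorphism hprod.
Proof.
split=> [m m'|]; first by rewrite /hprod fmM big_cat.
by rewrite /hprod fm1 big_nil.
Qed.

HB.instance Definition _ :=
  isMultiplicative.Build {fmonom I} A hprod falg_hprod_mmorphism.

Lemma falg_eval_linear : linear (falg_eval h).
Proof.
move=> c x y; rewrite falg_eval.unlock -/hprod raddfD /=.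
by rewrite (@monalg.mmapZ _ _ _ (in_alg A) hprod) /= mulr_algl.
Qed.

Lemma falg_eval_monoid : monoid_morphism (falg_eval h).
Proof.
rewrite falg_eval.unlock.
have [] := @monalg.commr_mmap_is_multiplicative _ _ _ (in_alg A) hprod => //.
by move=> g m m'; rewrite /GRing.comm /= mulr_algl mulr_algr.
Qed.

Lemma falg_eval_gen i : falg_eval h (fgen i) = h i.
Proof. by rewrite falg_eval.unlock monalg.mmapU /= scale1r mul1r fmU big_seq1. Qed.

Lemma falg_eval_uniq (f : T -> A) :
  linear f -> monoid_morphism f -> (forall i, f (fgen i) = h i) ->
  f =1 falg_eval h.
Proof.
move=> fl [f1 fM] fh t.
have f0 : f 0 = 0.
  by have := fl (-1) 0 0; rewrite scaler0 addr0 => ->; rewrite scaleN1r addNr.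
have fD x y : f (x + y) = f x + f y.
  by have := fl 1 x y; rewrite !scale1r.
have fZ c x : f (c *: x) = c *: f x.
  by have := fl c x 0; rewrite f0 !addr0.
rewrite falg_eval.unlock /monalg.mmap {1}[t]monalgE (big_morph f fD f0).
apply: eq_bigr => m _; set c := monalg.mcoeff m t.
have -> : mkmalgU m c = c *: mkmalgU m (1 : k) :> T.
  by apply/malgP => m'; rewrite monalg.mcoeffZ !mcoeffU mulrnAr mulr1.
rewrite fZ /= mulr_algl; congr (_ *: _).
case: m {c} => s; rewrite /=; elim: s => [|i s IHs].
  by rewrite big_nil -f1; congr f; rewrite -fmoneE.
rewrite big_cons -IHs -fh -fM; congr f.
by rewrite /GRing.mul /= fgmulUU mulr1; congr mkmalgU; apply: val_inj; rewrite /= fmM fmU.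
Qed.

End Eval.

(* matrices act on column vectors, V being the space of column vectors *)
Section Dihedral.
Variables (K : realType) (zeta : K[i]).

Definition diag2 (z : K[i]) : 'M[K[i]]_2 :=
  \matrix_(a, b) (if a == b then (if a == 0 then z else z^-1) else 0).
Definition adiag2 (z : K[i]) : 'M[K[i]]_2 :=
  \matrix_(a, b) (if a == b then 0 else (if a == 0 then z else z^-1)).

Definition refl (j : nat) : 'M[K[i]]_2 := adiag2 (zeta ^+ j).

Inductive in_W : 'M[K[i]]_2 -> Prop :=
| InW_one : in_W 1
| InW_s0 : in_W (refl 0)
| InW_s1 : in_W (refl 1)
| InW_mul u v of in_W u & in_W v : in_W (u * v)
| InW_inv u of in_W u : in_W (invmx u).

Lemma mx2P (u v : 'M[K[i]]_2) :
  u 0 0 = v 0 0 -> u 0 1 = v 0 1 -> u 1 0 = v 1 0 -> u 1 1 = v 1 1 -> u = v.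
Proof.
move=> h00 h01 h10 h11; apply/matrixP => a b.
have E (c : 'I_2) : c = 0 \/ c = 1.
  by case: c => [[|[|//]] hc]; [left|right]; apply: val_inj.
by case: (E a) => ->; case: (E b) => ->.
Qed.

Lemma diag2M y z : diag2 y * diag2 z = diag2 (y * z).
Proof.
by apply: mx2P; rewrite !mxE !big_ord_recl big_ord0 !mxE /= ?invfM;
  rewrite ?mulr0 ?mul0r ?addr0 ?add0r.
Qed.
Lemma diag2A y z : diag2 y * adiag2 z = adiag2 (y * z).
Proof.
by apply: mx2P; rewrite !mxE !big_ord_recl big_ord0 !mxE /= ?invfM;
  rewrite ?mulr0 ?mul0r ?addr0 ?add0r.
Qed.
Lemma adiag2D y z : adiag2 y * diag2 z = adiag2 (y / z).
Proof.
by apply: mx2P; rewrite !mxE !big_ord_recl big_ord0 !mxE /= ?invfM ?invrK;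
  rewrite ?mulr0 ?mul0r ?addr0 ?add0r.
Qed.
Lemma adiag2A y z : adiag2 y * adiag2 z = diag2 (y / z).
Proof.
by apply: mx2P; rewrite !mxE !big_ord_recl big_ord0 !mxE /= ?invfM ?invrK;
  rewrite ?mulr0 ?mul0r ?addr0 ?add0r.
Qed.
Lemma diag2_1 : diag2 1 = 1.
Proof. by apply: mx2P; rewrite !mxE ?invr1. Qed.

Hypothesis hz : 4.-primitive_root zeta.

Lemma in_WP u : in_W u ->
  exists2 z, z ^+ 4 = 1 & u = diag2 z \/ u = adiag2 z.
Proof.
have nz (z : K[i]) : z ^+ 4 = 1 -> z != 0.
  by move=> h; apply/eqP => h0; move/eqP: h; rewrite h0 expr0n eq_sym oner_eq0.
elim=> {u} [||| u v _ [y hy eu] _ [z hz' ev]|u _ [z hz' eu]].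
- by exists 1; rewrite ?expr1n ?diag2_1; last left.
- by exists 1; [rewrite expr1n | right; rewrite /refl expr0].
- by exists zeta; [apply: prim_expr_order | right; rewrite /refl expr1].
- have hyz : (y * z) ^+ 4 = 1 by rewrite exprMn hy hz' mulr1.
  have hyz' : (y / z) ^+ 4 = 1 by rewrite exprMn exprVn hy hz' divr1.
  case: eu => ->; case: ev => ->.
  + by exists (y * z) => //; left; rewrite diag2M.
  + by exists (y * z) => //; right; rewrite diag2A.
  + by exists (y / z) => //; right; rewrite adiag2D.
  + by exists (y / z) => //; left; rewrite adiag2A.
- have inv_of (w w' : 'M[K[i]]_2) : w * w' = 1 -> invmx w = w'.
    move=> e; have [uw _] := mulmx1_unit e.
    by rewrite -[RHS](mulKmx uw) -[w *m w']/(w * w') e mulmx1.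
  case: eu => ->.
  + exists z^-1; first by rewrite exprVn hz' invr1.
    by left; apply: inv_of; rewrite diag2M divff ?diag2_1 ?nz.
  + exists z => //.
    by right; apply: inv_of; rewrite adiag2A divff ?diag2_1 ?nz.
Qed.

Lemma in_W_unit u : in_W u -> u \in unitmx.
Proof.
case/in_WP => z h e.
have nz : z != 0.
  by apply/eqP => h0; move/eqP: h; rewrite h0 expr0n eq_sym oner_eq0.
have : exists w, u * w = 1.
  case: e => ->.
    by exists (diag2 z^-1); rewrite diag2M divff ?diag2_1.
  by exists (adiag2 z); rewrite adiag2A divff ?diag2_1.
by case=> w e1; have [] := mulmx1_unit e1.
Qed.

Lemma in_W_refl j : in_W (refl j).
Proof.
elim: j => [|j IHj]; first exact: InW_s0.
have -> : refl j.+1 = refl 1 * refl 0 * refl j.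
  by rewrite /refl adiag2A diag2A expr0 expr1 divr1 exprS.
by apply: InW_mul => //; apply: InW_mul; [apply: InW_s1 | apply: InW_s0].
Qed.

Definition W_enum : seq 'M[K[i]]_2 :=
  [seq diag2 (zeta ^+ j) | j <- iota 0 4] ++
  [seq adiag2 (zeta ^+ j) | j <- iota 0 4].

Lemma in_W_enum u : in_W u -> u \in W_enum.
Proof.
case/in_WP => z /(prim_rootP hz) [j ->] e.
by rewrite mem_cat; case: e => ->; apply/orP; [left|right];
  apply/mapP; exists (val j); rewrite // mem_iota /= ltn_ord.
Qed.

(* W = <s_0, s_1>; it is finite because zeta is a root of unity *)
Definition dihedral of 4.-primitive_root zeta : Type :=
  {u : 'M[K[i]]_2 | `[< in_W u >]}.
Local Notation W := (dihedral hz).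

Definition W_mx (w : W) : 'M[K[i]]_2 := val w.
Lemma W_mxP (w : W) : in_W (W_mx w).
Proof. by apply/asboolP; case: w. Qed.
Definition W_of (u : 'M[K[i]]_2) (h : in_W u) : W := exist _ u (asboolT h).
Lemma W_ofK u (h : in_W u) : W_mx (W_of h) = u.
Proof. by []. Qed.
Lemma W_mx_inj : injective W_mx.
Proof. exact: val_inj. Qed.

Definition W_rank (w : W) : seq_sub W_enum := SeqSub (in_W_enum (W_mxP w)).
Definition W_unrank (x : seq_sub W_enum) : option W := insub (ssval x).
Lemma W_rankK : pcancel W_rank W_unrank.
Proof. by move=> w; rewrite /W_unrank /W_rank /= valK. Qed.

HB.instance Definition _ := Finite.copy W (pcan_type W_rankK).

Definition W_one : W := W_of InW_one.
Definition W_mul (u v : W) : W := W_of (InW_mul (W_mxP u) (W_mxP v)).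
Definition W_inv (u : W) : W := W_of (InW_inv (W_mxP u)).

Lemma W_mulA : associative W_mul.
Proof. by move=> u v w; apply: W_mx_inj; rewrite !W_ofK mulrA. Qed.
Lemma W_mul1 : left_id W_one W_mul.
Proof. by move=> u; apply: W_mx_inj; rewrite !W_ofK mul1r. Qed.
Lemma W_mulV : left_inverse W_one W_inv W_mul.
Proof.
move=> u; apply: W_mx_inj; rewrite !W_ofK.
exact: mulVmx (in_W_unit (W_mxP u)).
Qed.

HB.instance Definition _ := Finite_isGroup.Build W W_mulA W_mul1 W_mulV.

Definition s_ (j : nat) : W := W_of (in_W_refl j).

Lemma W_mxM (u v : W) : W_mx (u * v)%g = W_mx u *m W_mx v.
Proof. by []. Qed.
Lemma W_mx1 : W_mx 1%g = 1%:M.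
Proof. by []. Qed.
Lemma W_mx_unit (w : W) : W_mx w \in unitmx.
Proof. exact: in_W_unit (W_mxP w). Qed.

End Dihedral.

Lemma linear_lcomb (k : pzRingType) (U V : lmodType k) (f : U -> V) n
    (c : 'I_n -> k) (F : 'I_n -> U) :
  linear f -> f (\sum_j c j *: F j) = \sum_j c j *: f (F j).
Proof.
move=> lin.
have z : f 0 = 0.
  by have := lin (-1) 0 0; rewrite scaler0 addr0 => ->; rewrite scaleN1r addNr.
by elim/big_rec2: _ => // j x y _ <-; exact: lin.
Qed.

Lemma lcomb_lcomb (F : pzRingType) (k : pzRingType) (iota : {rmorphism F -> k})
    (U : lmodType k) n m (c : 'I_n -> F) (d : 'I_n -> 'I_m -> F)
    (x : 'I_m -> U) :
  \sum_j iota (c j) *: (\sum_l iota (d j l) *: x l) =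
  \sum_l iota (\sum_j c j * d j l) *: x l.
Proof.
under eq_bigr => j _ do rewrite scaler_sumr.
rewrite exchange_big /=; apply: eq_bigr => l _.
rewrite (rmorph_sum iota) scaler_suml; apply: eq_bigr => j _.
by rewrite rmorphM scalerA.
Qed.

(* inl j is the j-th vector of the canonical basis of V, inr j is the j-th
   vector of the dual basis of V^*; V is the space of column vectors, V^* the
   space of row vectors *)
Definition letter (n : nat) : Type := ('I_n + 'I_n)%type.
HB.instance Definition _ (n : nat) := Finite.on (letter n).

Definition tens (k : comNzRingType) (n : nat) : Type := free_alg k (letter n).
HB.instance Definition _ (k : comNzRingType) (n : nat) :=
  GRing.Algebra.on (tens k n).

(* the embeddings of V and V^*, the scalars being extended from F to k *)
HB.lock Definition vecT (F : fieldType) (k : comNzRingType)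
    (iota : {rmorphism F -> k}) (n : nat) (v : 'cV[F]_n) : tens k n :=
  \sum_(j < n) iota (v j 0) *: (fgen k (inl j : letter n) : tens k n).
HB.lock Definition formT (F : fieldType) (k : comNzRingType)
    (iota : {rmorphism F -> k}) (n : nat) (f : 'rV[F]_n) : tens k n :=
  \sum_(j < n) iota (f 0 j) *: (fgen k (inr j : letter n) : tens k n).

Section Tens.
Variables (F : fieldType) (k : comNzRingType) (iota : {rmorphism F -> k}).
Variable n : nat.
Local Notation letter := (letter n).
Local Notation tens := (tens k n).
Local Notation vecT := (@vecT F k iota n).
Local Notation formT := (@formT F k iota n).

Variables (W : finGroupType) (rho : W -> 'M[F]_n).
Hypotheses (rho1 : rho 1%g = 1%:M)
  (rhoM : forall u v, rho (u * v)%g = rho u *m rho v).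

(* w maps v to w v and the linear form f to f o w^-1 *)
Definition act_letter (w : W) (l : letter) : tens :=
  match l with
  | inl j => vecT (rho w *m delta_mx j 0)
  | inr j => formT (delta_mx 0 j *m invmx (rho w))
  end.
Definition tens_act (w : W) (t : tens) : tens := falg_eval (act_letter w) t.

Lemma tens_act_linear w : linear (tens_act w).
Proof. exact: falg_eval_linear. Qed.
Lemma tens_act_monoid w : monoid_morphism (tens_act w).
Proof. exact: falg_eval_monoid. Qed.

Lemma vecT_sum m (c : 'I_m -> F) (x : 'I_m -> 'cV[F]_n) :
  \sum_j iota (c j) *: vecT (x j) = vecT (\sum_j c j *: x j).
Proof.
rewrite vecT.unlock (lcomb_lcomb iota c (fun j l => x j l 0)).
have E l : \sum_j c j * x j l 0 = (\sum_j c j *: x j) l 0.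
  by rewrite summxE; apply: eq_bigr => j _; rewrite mxE.
by apply: eq_bigr => l _; rewrite E.
Qed.

Lemma formT_sum m (c : 'I_m -> F) (x : 'I_m -> 'rV[F]_n) :
  \sum_j iota (c j) *: formT (x j) = formT (\sum_j c j *: x j).
Proof.
rewrite formT.unlock (lcomb_lcomb iota c (fun j l => x j 0 l)).
have E l : \sum_j c j * x j 0 l = (\sum_j c j *: x j) 0 l.
  by rewrite summxE; apply: eq_bigr => j _; rewrite mxE.
by apply: eq_bigr => l _; rewrite E.
Qed.

Lemma tens_act_vec w v : tens_act w (vecT v) = vecT (rho w *m v).
Proof.
rewrite {1}vecT.unlock (linear_lcomb _ _ (tens_act_linear w)).
under eq_bigr => j _ do rewrite /tens_act falg_eval_gen.
rewrite vecT_sum; congr vecT.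
apply/matrixP => a b; rewrite ord1 summxE !mxE; apply: eq_bigr => j _.
by rewrite -colE !mxE mulrC.
Qed.

Lemma tens_act_form w f : tens_act w (formT f) = formT (f *m invmx (rho w)).
Proof.
rewrite {1}formT.unlock (linear_lcomb _ _ (tens_act_linear w)).
under eq_bigr => j _ do rewrite /tens_act falg_eval_gen.
rewrite formT_sum; congr formT.
apply/matrixP => a b; rewrite ord1 summxE !mxE; apply: eq_bigr => j _.
by rewrite -rowE !mxE.
Qed.

Lemma vecT_delta j : vecT (delta_mx j 0) = fgen k (inl j : letter).
Proof.
rewrite vecT.unlock (bigD1 j) //= big1 => [|l hl].
  by rewrite mxE !eqxx rmorph1 scale1r addr0.
by rewrite mxE (negbTE hl) rmorph0 scale0r.
Qed.

Lemma formT_delta j : formT (delta_mx 0 j) = fgen k (inr j : letter).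
Proof.
rewrite formT.unlock (bigD1 j) //= big1 => [|l hl].
  by rewrite mxE !eqxx rmorph1 scale1r addr0.
by rewrite mxE (negbTE hl) andbF rmorph0 scale0r.
Qed.

Lemma tens_act_one t : tens_act 1%g t = t.
Proof.
rewrite /tens_act; symmetry; move: t; apply: falg_eval_uniq.
- by move=> c x y.
- by split.
- case=> j; rewrite /act_letter /= rho1.
    by rewrite mul1mx vecT_delta.
  by rewrite invmx1 mulmx1 formT_delta.
Qed.

Lemma rho_inv w : invmx (rho w) = rho w^-1%g.
Proof.
have e : rho w *m rho w^-1%g = 1%:M by rewrite -rhoM mulgV rho1.
have [uw _] := mulmx1_unit e.
by rewrite -[RHS](mulKmx uw) e mulmx1.
Qed.

Lemma tens_act_mul u v t : tens_act (u * v)%g t = tens_act u (tens_act v t).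
Proof.
symmetry; move: t; apply: falg_eval_uniq.
- by move=> c x y; rewrite !tens_act_linear.
- split=> [|x y]; first by rewrite !(tens_act_monoid _).1.
  by rewrite !(tens_act_monoid _).2.
- case=> j; rewrite {2}/tens_act falg_eval_gen /=.
    by rewrite tens_act_vec mulmxA rhoM.
  by rewrite tens_act_form !rho_inv -mulmxA -rhoM invMg.
Qed.

Definition tens_action : alg_action tens W :=
  AlgAction tens_act_linear tens_act_monoid tens_act_one tens_act_mul.

Local Notation S := (skew tens_action).

(* x, y, X, Y |-> 0 and w |-> 1 *)
Definition tens_counit (t : tens) : k^o := falg_eval (fun _ => 0) t.

Lemma tens_counitD x y : tens_counit (x + y) = tens_counit x + tens_counit y.
Proof.
have := falg_eval_linear (fun _ : letter => (0 : k^o)) 1 x y.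
by rewrite !scale1r.
Qed.
Lemma tens_counit0 : tens_counit 0 = 0.
Proof. by apply: (addrI (tens_counit 0)); rewrite -tens_counitD !addr0. Qed.
Lemma tens_counitZ c x : tens_counit (c *: x) = c * tens_counit x.
Proof.
have := falg_eval_linear (fun _ : letter => (0 : k^o)) c x 0.
by rewrite -/(tens_counit 0) tens_counit0 !addr0.
Qed.
Lemma tens_counitM x y : tens_counit (x * y) = tens_counit x * tens_counit y.
Proof. by have [_] := falg_eval_monoid (fun _ : letter => (0 : k^o)); apply. Qed.
Lemma tens_counit1 : tens_counit 1 = 1.
Proof. by have [] := falg_eval_monoid (fun _ : letter => (0 : k^o)). Qed.
Lemma tens_counit_vec v : tens_counit (vecT v) = 0.
Proof.
rewrite vecT.unlock (big_morph _ tens_counitD tens_counit0) big1 // => j _.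
by rewrite tens_counitZ /tens_counit falg_eval_gen mulr0.
Qed.
Lemma tens_counit_form f : tens_counit (formT f) = 0.
Proof.
rewrite formT.unlock (big_morph _ tens_counitD tens_counit0) big1 // => j _.
by rewrite tens_counitZ /tens_counit falg_eval_gen mulr0.
Qed.

Lemma tens_counit_act w t : tens_counit (tens_act w t) = tens_counit t.
Proof.
have cl : linear tens_counit by exact: falg_eval_linear.
have cm : monoid_morphism tens_counit by exact: falg_eval_monoid.
move: t; apply: falg_eval_uniq.
- by move=> c x y; rewrite tens_act_linear cl.
- split=> [|x y]; first by rewrite (tens_act_monoid _).1 cm.1.
  by rewrite (tens_act_monoid _).2 cm.2.
- by case=> j; rewrite /tens_act falg_eval_gen /=
    ?tens_counit_vec ?tens_counit_form.
Qed.

Definition skew_counit (f : S) : k := \sum_(w : W) tens_counit (f w).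

Lemma skew_counitD f g : skew_counit (f + g) = skew_counit f + skew_counit g.
Proof.
rewrite /skew_counit -big_split; apply: eq_bigr => w _.
by rewrite skew_addE tens_counitD.
Qed.

Lemma skew_counit0 : skew_counit 0 = 0.
Proof. by apply: (addrI (skew_counit 0)); rewrite -skew_counitD !addr0. Qed.

Lemma skew_counitZ c f : skew_counit (c *: f) = c * skew_counit f.
Proof.
rewrite /skew_counit big_distrr /=; apply: eq_bigr => w _.
by rewrite skew_scaleE tens_counitZ.
Qed.

Lemma skew_counitM f g : skew_counit (f * g) = skew_counit f * skew_counit g.
Proof.
rewrite /skew_counit mulr_suml.
transitivity (\sum_(w : W) \sum_(u : W)
    tens_counit (f u) * tens_counit (g (u^-1 * w)%g)).
  apply: eq_bigr => w _.
  rewrite skew_mulE (big_morph _ tens_counitD tens_counit0).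
  by apply: eq_bigr => u _; rewrite tens_counitM tens_counit_act.
rewrite exchange_big /=; apply: eq_bigr => u _.
by rewrite -big_distrr /= [in RHS](reindex_inj (mulgI u^-1%g)).
Qed.

Lemma skew_counitB f g : skew_counit (f - g) = skew_counit f - skew_counit g.
Proof. by rewrite -scaleN1r skew_counitD skew_counitZ mulN1r. Qed.

Lemma skew_counit_lcomb m (c : 'I_m -> k) (f : 'I_m -> S) :
  skew_counit (\sum_j c j *: f j) = \sum_j c j * skew_counit (f j).
Proof.
rewrite (big_morph _ skew_counitD skew_counit0).
by apply: eq_bigr => j _; rewrite skew_counitZ.
Qed.

Lemma skew_counit1 : skew_counit 1 = 1.
Proof.
rewrite /skew_counit (bigD1 1%g) //= big1 => [|w hw].
  by rewrite skew_oneE eqxx tens_counit1 addr0.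
by rewrite skew_oneE (negbTE hw) tens_counit0.
Qed.

Lemma skew_proper (A : nzRingType) (aug : {rmorphism k -> A}) (rel : S -> Prop) :
  (forall f, rel f -> aug (skew_counit f) = 0) -> ~ gen_ideal rel 1.
Proof.
move=> hrel.
have h0 f : gen_ideal rel f -> aug (skew_counit f) = 0.
  elim=> {f} [f /hrel //|||a f _ IH|f a _ IH].
  - by rewrite skew_counit0 rmorph0.
  - by move=> f f' _ e _ e'; rewrite skew_counitD rmorphD e e' addr0.
  - by rewrite skew_counitM rmorphM IH mulr0.
  - by rewrite skew_counitM rmorphM IH mul0r.
by move/h0; rewrite skew_counit1 rmorph1; apply/eqP/oner_neq0.
Qed.

Lemma skew_counit_T t : skew_counit (skew_T tens_action t) = tens_counit t.
Proof.
rewrite /skew_counit (bigD1 1%g) //= big1 => [|w hw].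
  by rewrite skew_TE eqxx addr0.
by rewrite skew_TE (negbTE hw) tens_counit0.
Qed.

Lemma skew_counit_commvv u v :
  let f := skew_T tens_action (vecT u) in
  let g := skew_T tens_action (vecT v) in skew_counit (f * g - g * f) = 0.
Proof.
by rewrite /= skew_counitB !skew_counitM !skew_counit_T !tens_counit_vec !mul0r
           subr0.
Qed.
Lemma skew_counit_commff u v :
  let f := skew_T tens_action (formT u) in
  let g := skew_T tens_action (formT v) in skew_counit (f * g - g * f) = 0.
Proof.
by rewrite /= skew_counitB !skew_counitM !skew_counit_T !tens_counit_form !mul0r
           subr0.
Qed.
Lemma skew_counit_commvf u v m (c : 'I_m -> k) (h : 'I_m -> S) (a : k) :
  let f := skew_T tens_action (vecT u) in
  let g := skew_T tens_action (formT v) in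
  skew_counit (f * g - g * f - a *: \sum_j c j *: h j) =
  - (a * \sum_j c j * skew_counit (h j)).
Proof.
rewrite /= !skew_counitB !skew_counitM !skew_counit_T tens_counit_form.
by rewrite tens_counit_vec !mul0r subr0 skew_counitZ skew_counit_lcomb sub0r.
Qed.

End Tens.

(* monalg also has this notation, for another type *)
Local Notation "{ 'mpoly' T [ n ] }" := (mpoly n T) : type_scope.

Section Cherednik.
Variables (K : realType) (zeta : K[i]) (hz : 4.-primitive_root zeta).

Local Notation C := K[i].
Local Notation W := (dihedral hz).

(* C[A, B] = C[curly C] *)
Local Notation k := {mpoly C[2]}.
Definition parA : k := 'X_ord0.
Definition parB : k := 'X_ord_max.

(* C_j, evaluation at s_j: the classes of reflections are {s_0, s_2} and
   {s_1, s_3} *)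
Definition parC (j : nat) : k := if odd j then parB else parA.

Definition W_action : alg_action (tens k 2) W :=
  tens_action (@mpolyC 2 C : {rmorphism C -> k}) (W_mx1 hz) (@W_mxM _ _ hz).

(* The skew group algebra of T(V + V^* ) by W, over C[A, B] *)
Definition TW : algType k := skew W_action.

Definition TW_vec (v : 'cV[C]_2) : TW :=
  skew_T W_action (vecT (@mpolyC 2 C : {rmorphism C -> k}) v).
Definition TW_form (f : 'rV[C]_2) : TW :=
  skew_T W_action (formT (@mpolyC 2 C : {rmorphism C -> k}) f).
Definition TW_grp (w : W) : TW := skew_W W_action w.

Definition pairing (v : 'cV[C]_2) (f : 'rV[C]_2) : C := (f *m v) 0 0.

(* alphav j = zeta^j x - y and alpha j = X - zeta^j Y *)
Definition alphav (j : nat) : 'cV[C]_2 :=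
  zeta ^+ j *: delta_mx 0 0 - delta_mx 1 0.
Definition alpha (j : nat) : 'rV[C]_2 :=
  delta_mx 0 0 - zeta ^+ j *: delta_mx 0 1.

Definition cherednik_rhs (u : 'cV[C]_2) (U : 'rV[C]_2) : TW :=
  - 2%:R *: \sum_(j < 4)
    (parC j * (pairing u (alpha j) * pairing (alphav j) U /
               pairing (alphav j) (alpha j))%:MP_[2]) *: TW_grp (s_ hz j).

Inductive cherednik_rel : TW -> Prop :=
| Rel_VV u u' :
    cherednik_rel (TW_vec u * TW_vec u' - TW_vec u' * TW_vec u)
| Rel_V'V' U U' :
    cherednik_rel (TW_form U * TW_form U' - TW_form U' * TW_form U)
| Rel_VV' u U :
    cherednik_rel (TW_vec u * TW_form U - TW_form U * TW_vec u
                   - cherednik_rhs u U).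

Lemma cherednik_proper : ~ gen_ideal cherednik_rel 1.
Proof.
have par0 j : mcoeff 0%MM (parC j) = 0.
  rewrite /parC; case: odd; rewrite mcoeffX; case: eqP => // /mnmP.
    by move/(_ ord_max); rewrite mnm1E mnm0E eqxx.
  by move/(_ ord0); rewrite mnm1E mnm0E eqxx.
apply: (@skew_proper _ _ _ _ _ _ _ _ _ (mcoeff 0%MM : {rmorphism k -> C})).
move=> f [u u'|U U'|u U].
- by rewrite skew_counit_commvv rmorph0.
- by rewrite skew_counit_commff rmorph0.
- rewrite skew_counit_commvf rmorphN rmorphM rmorph_sum big1 ?mulr0 ?oppr0 //.
  by move=> j _; rewrite rmorphM rmorphM /= par0 !mul0r.
Qed.

Definition cherednik : algType k := alg_quot cherednik_proper.
Local Notation H := cherednik.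

Definition H_pi (h : TW) : H := aq_pi cherednik_proper h.
Definition H_x : H := H_pi (TW_vec (delta_mx 0 0)).
Definition H_y : H := H_pi (TW_vec (delta_mx 1 0)).
Definition H_X : H := H_pi (TW_form (delta_mx 0 0)).
Definition H_Y : H := H_pi (TW_form (delta_mx 0 1)).
Definition H_w (w : W) : H := H_pi (TW_grp w).

Definition centre (z : H) : Prop := forall h : H, z * h = h * z.

(* C[C x V x V^*], in the indeterminates x, y, X, Y *)
Local Notation P := {mpoly k[4]}.
Definition P_x : P := 'X_(inord 0).
Definition P_y : P := 'X_(inord 1).
Definition P_X : P := 'X_(inord 2).
Definition P_Y : P := 'X_(inord 3).

(* the multiplication map from C[A, B] (x) C[V] (x) CW (x) C[V^*] to H, where
   C[V] = C[X, Y] and C[V^*] = C[x, y]; F stands for \sum_w F w (x) w *)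
Definition pbw (F : {ffun W -> P}) : H :=
  \sum_(w : W) \sum_(m <- msupp (F w)) (F w)@_m *:
    (H_X ^+ m (inord 2) * H_Y ^+ m (inord 3) * H_w w *
     (H_x ^+ m (inord 0) * H_y ^+ m (inord 1))).

(* pbw is bijective, and trunc induces a bijection from the centre onto
   the W-invariants of P: the default values of xget are not used there *)
Definition pbw_inv (h : H) : {ffun W -> P} := xget 0 (fun F => pbw F = h).
Definition trunc (h : H) : P := pbw_inv h 1%g.
Definition trunc_inv (f : P) : H := xget 0 (fun z => centre z /\ trunc z = f).

Definition H_q : H := H_x * H_y.
Definition H_r : H := H_x ^+ 4 + H_y ^+ 4.
Definition H_Q : H := H_X * H_Y.
Definition H_R : H := H_X ^+ 4 + H_Y ^+ 4.
Definition H_eu : H := trunc_inv (P_x * P_X + P_y * P_Y).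
Definition H_a (j : nat) : H :=
  trunc_inv (P_x ^+ (4 - j) * P_Y ^+ j + P_y ^+ (4 - j) * P_X ^+ j).

End Cherednik.

(* The subalgebra Z of A (a predicate), assumed commutative, is presented by
   the family g of generators and the set rels of relators. *)
Definition presented_by (k : comNzRingType) (A : algType k) (Z : A -> Prop)
    (n : nat) (g : 'I_n -> A) (rels : seq {mpoly k[n]}) : Prop :=
  let ev : {mpoly k[n]} -> A := mmap (in_alg A) g in
  [/\ forall j, Z (g j),
      forall z, Z z -> exists p, ev p = z
    & forall p, ev p = 0 <-> gen_ideal (fun r => r \in rels) p].

(* Main.v *)
(* H is represented on functions on a generic W-orbit: over T = G[t], with G
   the fraction field of P = C[A,B][x,y,X,Y] and x, y scaled by t, the element
   h becomes a #|W| x #|W| matrix, V acting by Dunkl operators.  The top t-degree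
   part of this matrix is the symbol of h; hence the PBW map is injective, and
   z is central exactly when its matrix is a scalar, written hat z.
   For u = x + s Y and v = y + s X the elements u v and u^4 + v^4 are central;
   finite Fourier inversion in s recovers eu, a_1, a_2 and a_3, and applying the
   Dunkl operators to the constant function 1 gives the scalars of the eight
   generators in closed form, so that the nine relations are polynomial
   identities.
   Generation is an induction on the t-degree of hat z, whose leading
   coefficient is W-invariant, the classical generators of P^W being the symbols.
   Modulo the relations every polynomial is a combination of
   1, eu, eu^2, eu^3, eu^4, a_1, a_2, a_3 over C[A,B][q,r,Q,R]; looking at symbols
   and at the action of W on x, y alone shows these to be free, so there are no
   further relations. *)
Require Import Defs.
From HB Require Import structures.
From mathcomp Require Import all_boot all_fingroup all_algebra.
From mathcomp Require Import boolp classical_sets reals complex.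
From mathcomp Require Import finmap monalg.
From mathcomp Require Import ssrcomplements mpoly.
From mathcomp Require Import ring zify ssrAC.
Require Import Defs.

Set Implicit Arguments.
Unset Strict Implicit.
Unset Printing Implicit Defensive.

Import GRing.Theory.
Local Open Scope ring_scope.
Local Notation "{ 'mpoly' T [ n ] }" := (mpoly n T) : type_scope.

(** The generators are prescribed by Trunc, which is not multiplicative, while relations have to be
    tested on products; on the centre [hat] is multiplicative. So the same elements must be known in
    both pictures, and the pencil u = x + s Y, v = y + s X is the bridge. W preserves the quadratic
    form x y, so (Y, X) transforms like (x, y); moreover [x, X] and [Y, y] are opposite. Hence u and
    v commute and span another copy of V, and the basic invariants u v and u^4 + v^4 of that copy
    are central. For u^4 + v^4 both Trunc and [hat] can be computed. The term A^2 - B^2 enters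
    through Trunc: the square of the commutator of x and Y has Trunc equal to the sum of C_j^2
    zeta^(6j), that is 2 (A^2 - B^2), which shifts the coefficient of s^2 in the pencil and must be
    subtracted to reach a_2. Only x and y are scaled by t, because the denominators of the Dunkl
    operators are roots evaluated at X, Y: they then have degree 0, the matrices stay polynomial in
    t, and the reflection terms fall below the diagonal term. *)

(** * Restriction of scalars; universal properties of skew group algebras and quotients *)

(** The universal properties below need a target algebra over C[A, B], whereas the matrices have
    entries in the larger ring T. A type alias carries the restricted scalar action without clashing
    with the one over T. *)
Definition restr (k T : comNzRingType) (iota : {rmorphism k -> T})
  (S : algType T) : Type := S.

Section Restr.
Variables (k T : comNzRingType) (iota : {rmorphism k -> T}) (S : algType T).
Local Notation R := (restr iota S).
HB.instance Definition _ := GRing.NzRing.copy R S.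
Definition restr_scale (c : k) (x : R) : R := iota c *: (x : S).
Lemma restr_scaleA a b x : restr_scale a (restr_scale b x) = restr_scale (a * b) x.
Proof. by rewrite /restr_scale scalerA rmorphM. Qed.
Lemma restr_scale1 : left_id 1 restr_scale.
Proof. by move=> x; rewrite /restr_scale rmorph1 scale1r. Qed.
Lemma restr_scaleDr : right_distributive restr_scale +%R.
Proof. by move=> c x y; rewrite /restr_scale scalerDr. Qed.
Lemma restr_scaleDl x : {morph restr_scale^~ x : a b / a + b}.
Proof. by move=> a b; rewrite /restr_scale rmorphD scalerDl. Qed.
HB.instance Definition _ := GRing.Zmodule_isLmodule.Build k R
  restr_scaleA restr_scale1 restr_scaleDr restr_scaleDl.
Lemma restr_scaleAl (c : k) (x y : R) : c *: (x * y) = c *: x * y.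
Proof. exact: (@scalerAl T S). Qed.
HB.instance Definition _ := GRing.Lmodule_isLalgebra.Build k R restr_scaleAl.
Lemma restr_scaleAr (c : k) (x y : R) : c *: (x * y) = x * (c *: y).
Proof. exact: (@scalerAr T S). Qed.
HB.instance Definition _ := GRing.Lalgebra_isAlgebra.Build k R restr_scaleAr.
Lemma restr_scaleE (c : k) (x : R) : c *: x = iota c *: (x : S) :> S.
Proof. by []. Qed.
End Restr.

Section SkewLift.
Variables (k : comNzRingType) (T : algType k) (W : finGroupType).
Variables (a : alg_action T W) (A : algType k).
Variables (phi : T -> A) (psi : W -> A).
Hypotheses (phi_lin : linear phi) (phi_mon : monoid_morphism phi).
Hypotheses (psi1 : psi 1%g = 1) (psiM : forall u v, psi (u * v)%g = psi u * psi v).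
Hypothesis psi_phi : forall w t, psi w * phi t = phi (a w t) * psi w.

(** Universal property of the skew group algebra: an algebra map [phi] and a group morphism [psi]
    that satisfy the covariance [psi_phi] glue to one algebra map. *)
Definition skew_lift (f : skew a) : A := \sum_(w : W) phi (f w) * psi w.

Let phi0 : phi 0 = 0.
Proof.
by have := phi_lin (-1) 0 0; rewrite scaler0 addr0 => ->; rewrite scaleN1r addNr.
Qed.
Let phiD x y : phi (x + y) = phi x + phi y.
Proof. by have := phi_lin 1 x y; rewrite !scale1r. Qed.

Lemma skew_lift_linear : linear skew_lift.
Proof.
move=> c f g; rewrite /skew_lift scaler_sumr -big_split; apply: eq_bigr => w _.
by rewrite skew_addE skew_scaleE phi_lin mulrDl scalerAl.
Qed.

Lemma skew_lift_monoid : monoid_morphism skew_lift.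
Proof.
split=> [|f g].
  rewrite /skew_lift (bigD1 1%g) //= big1 => [|w hw].
    by rewrite skew_oneE eqxx phi_mon.1 psi1 mulr1 addr0.
  by rewrite skew_oneE (negbTE hw) phi0 mul0r.
rewrite /skew_lift mulr_suml.
transitivity (\sum_w \sum_u phi (f u) * phi (a u (g (u^-1 * w)%g)) * psi w).
  apply: eq_bigr => w _; rewrite skew_mulE (big_morph _ phiD phi0) mulr_suml.
  by apply: eq_bigr => u _; rewrite phi_mon.2.
rewrite exchange_big; apply: eq_bigr => u _ /=.
rewrite mulr_sumr (reindex_inj (mulgI u)) /=; apply: eq_bigr => w _.
by rewrite mulKg psiM -!mulrA [psi u * (phi _ * _)]mulrA psi_phi !mulrA.
Qed.

Lemma skew_lift_T t : skew_lift (skew_T a t) = phi t.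
Proof.
rewrite /skew_lift (bigD1 1%g) //= big1 => [|w hw].
  by rewrite skew_TE eqxx psi1 mulr1 addr0.
by rewrite skew_TE (negbTE hw) phi0 mul0r.
Qed.

Lemma skew_lift_W w : skew_lift (skew_W a w) = psi w.
Proof.
rewrite /skew_lift (bigD1 w) //= big1 => [|u hu].
  by rewrite skew_WE eqxx phi_mon.1 mul1r addr0.
by rewrite skew_WE (negbTE hu) phi0 mul0r.
Qed.
End SkewLift.

Lemma mulVg_eq (W : finGroupType) (u v w : W) :
  ((u^-1 * w)%g == v) = (w == (u * v)%g).
Proof. by rewrite -(inj_eq (mulgI u)) mulKVg. Qed.

Section SkewRel.
Variables (k : comNzRingType) (T : algType k) (W : finGroupType).
Variable a : alg_action T W.
Lemma skew_TM s t : skew_T a (s * t) = skew_T a s * skew_T a t.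
Proof.
apply/ffunP => w; rewrite skew_mulE (bigD1 1%g) //= big1 => [|u hu].
  by rewrite !skew_TE eqxx act_one invg1 mul1g addr0; case: eqP; rewrite ?mulr0.
by rewrite !skew_TE (negbTE hu) mul0r.
Qed.
Lemma skew_WM u v : skew_W a (u * v)%g = skew_W a u * skew_W a v.
Proof.
apply/ffunP => w; rewrite skew_mulE (bigD1 u) //= big1 => [|x hx].
  rewrite !skew_WE eqxx mul1r addr0 mulVg_eq.
  by case: eqP => _; rewrite ?act0 // (act_monoid a u).1.
by rewrite !skew_WE (negbTE hx) mul0r.
Qed.
Lemma skew_WT w t : skew_W a w * skew_T a t = skew_T a (a w t) * skew_W a w.
Proof.
apply/ffunP => x; rewrite !skew_mulE (bigD1 w) //= big1 => [|y hy]; last first.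
  by rewrite !skew_WE (negbTE hy) mul0r.
rewrite [RHS](bigD1 1%g) //= big1 => [|y hy]; last first.
  by rewrite !skew_TE (negbTE hy) mul0r.
rewrite !skew_TE !skew_WE !eqxx act_one invg1 mul1g mul1r !addr0.
rewrite mulVg_eq mulg1.
by case: eqP => _; rewrite ?act0 ?mulr1 ?mulr0.
Qed.
Lemma skew_T_linear : linear (skew_T a).
Proof.
move=> c s t; apply/ffunP => w; rewrite skew_addE skew_scaleE !skew_TE.
by case: eqP => // _; rewrite scaler0 addr0.
Qed.
Lemma skew_T1 : skew_T a 1 = 1.
Proof. by apply/ffunP => w; rewrite skew_TE skew_oneE; case: eqP. Qed.
Lemma skew_decomp (f : skew a) :
  f = \sum_(w : W) skew_T a (f w) * skew_W a w.
Proof.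
apply/ffunP => w; rewrite sum_ffunE (bigD1 w) //= big1 => [|u hu].
  rewrite skew_mulE (bigD1 1%g) //= big1 => [|u hu].
    by rewrite skew_TE skew_WE eqxx invg1 mul1g eqxx act_one mulr1 !addr0.
  by rewrite skew_TE (negbTE hu) mul0r.
rewrite skew_mulE big1 // => v _; rewrite skew_TE skew_WE.
case: eqP => [->|_]; last by rewrite mul0r.
by rewrite invg1 mul1g eq_sym (negbTE hu) act0 mulr0.
Qed.
End SkewRel.

Section QuotLift.
Variables (k : comNzRingType) (S A : algType k) (rel : S -> Prop).
Variable proper : ~ gen_ideal rel 1.
Variable f : S -> A.
Hypotheses (f_lin : linear f) (f_mon : monoid_morphism f).
Hypothesis f_rel : forall s, rel s -> f s = 0.
Definition quot_lift (x : alg_quot proper) : A := f (aq_repr x).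
Let fD x y : f (x + y) = f x + f y.
Proof. by have := f_lin 1 x y; rewrite !scale1r. Qed.
Let f0 : f 0 = 0.
Proof. by apply: (addrI (f 0)); rewrite -fD !addr0. Qed.
Let f_ideal s : gen_ideal rel s -> f s = 0.
Proof.
elim=> {s} [s /f_rel //|//|s s' _ e _ e'|a s _ e|s a _ e].
- by rewrite fD e e' addr0.
- by rewrite f_mon.2 e mulr0.
- by rewrite f_mon.2 e mul0r.
Qed.
Lemma quot_lift_pi s : quot_lift (aq_pi proper s) = f s.
Proof.
apply: subr0_eq; have /aq_piP/f_ideal := aq_reprK (aq_pi proper s).
by rewrite -scaleN1r addrC f_lin scaleN1r addrC.
Qed.
Lemma quot_lift_linear : linear quot_lift.
Proof.
move=> c x y; rewrite -[x]aq_reprK -[y]aq_reprK.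
have -> s t : c *: aq_pi proper s + aq_pi proper t = aq_pi proper (c *: s + t).
  by rewrite aq_piD -aq_piZ.
by rewrite !quot_lift_pi f_lin.
Qed.
Lemma quot_lift_monoid : monoid_morphism quot_lift.
Proof.
split=> [|x y]; first by rewrite -f_mon.1 -(quot_lift_pi 1).
rewrite -[x]aq_reprK -[y]aq_reprK.
have -> s t : aq_pi proper s * aq_pi proper t = aq_pi proper (s * t).
  exact: aq_piM.
by rewrite !quot_lift_pi f_mon.2.
Qed.
End QuotLift.

(** Moving reflections past each other leaves closed indices modulo 4; once they are evaluated,
    equal group elements and equal inverse roots become the same atom for [ring]. *)
Ltac evaln :=
  repeat match goal with
  | |- context [modn ?a ?b] =>
    let c := eval vm_compute in (modn a b) in change (modn a b) with c
  | |- context [muln ?a ?b] =>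
    let c := eval vm_compute in (muln a b) in change (muln a b) with c
  | |- context [addn ?a ?b] =>
    let c := eval vm_compute in (addn a b) in change (addn a b) with c
  end.

Lemma conj_mul (R : nzRingType) (a b x y z : R) :
  b * x = y * b -> a * y = z * a -> a * b * x = z * (a * b).
Proof. by move=> e f; rewrite -mulrA e mulrA f mulrA. Qed.
Lemma conj_inv (R : nzRingType) (a b x y : R) :
  a * b = 1 -> b * a = 1 -> a * y = x * a -> b * x = y * b.
Proof.
by move=> ab ba e; rewrite -[LHS]mulr1 -ab mulrA -[b * x * a]mulrA -e !mulrA ba mul1r.
Qed.

Lemma conj_back (R : nzRingType) (a b x y : R) :
  a * x * b = y -> b * a = 1 -> a * x = y * a.
Proof. by move=> <- e; rewrite -[RHS]mulrA e mulr1. Qed.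
Lemma conj_morph (R : nzRingType) (a b x y : R) :
  b * a = 1 -> a * (x * y) * b = (a * x * b) * (a * y * b).
Proof. by move=> e; rewrite -!mulrA [b * _]mulrA e mul1r. Qed.

Lemma conj_cancel (R : nzRingType) (a b x y : R) :
  a * x = y * a -> a * b = 1 -> a * x * b = y.
Proof. by move=> -> e; rewrite -mulrA e mulr1. Qed.

(* The matrices below are locked: unfolding them makes comparisons of their
   entries intractable. *)
Fact wdiag_key : unit. Proof. exact: tt. Qed.
Fact wperm_key : unit. Proof. exact: tt. Qed.
Fact dunkl_key : unit. Proof. exact: tt. Qed.

(** * The Dunkl representation on a generic orbit *)

Section GroupMatrix.
Variables (W : finGroupType) (T : comNzRingType).
(* [wdim.+1] is [#|W|]; the successor form gives the matrices a ring structure. *)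
Definition wdim : nat := #|W|.-1.
Definition wval (i : 'I_wdim.+1) : W := nth 1%g (enum W) i.
Definition wrank (w : W) : 'I_wdim.+1 := inord (index w (enum W)).

Lemma wdimE : wdim.+1 = #|W|.
Proof. by rewrite prednK //; apply/card_gt0P; exists 1%g. Qed.
Lemma wrankK : cancel wrank wval.
Proof.
move=> w; rewrite /wval /wrank inordK ?nth_index ?mem_enum //.
by rewrite wdimE cardE index_mem mem_enum.
Qed.
Lemma wvalK : cancel wval wrank.
Proof.
move=> i; rewrite /wval /wrank index_uniq ?enum_uniq ?inord_val //.
by rewrite -cardE -wdimE.
Qed.

Local Notation M := 'M[T]_wdim.+1.

Definition wmx (E : W -> W -> T) : M := \matrix_(i, j) E (wval i) (wval j).
Definition went (A : M) (g h : W) : T := A (wrank g) (wrank h).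

Lemma wmxE E g h : went (wmx E) g h = E g h.
Proof. by rewrite /went mxE !wrankK. Qed.
Lemma went_inj (A B : M) : (forall g h, went A g h = went B g h) -> A = B.
Proof.
by move=> e; apply/matrixP => g h; rewrite -[g]wvalK -[h]wvalK; apply: e.
Qed.
Lemma wentM A B g h : went (A * B) g h = \sum_k went A g k * went B k h.
Proof.
rewrite /went mxE (reindex wrank) //=.
by exists wval => i _; rewrite ?wrankK ?wvalK.
Qed.
Lemma wentD A B g h : went (A + B) g h = went A g h + went B g h.
Proof. by rewrite /went mxE. Qed.
Lemma went0 g h : went 0 g h = 0.
Proof. by rewrite /went mxE. Qed.
Lemma wentZ c A g h : went (c *: A) g h = c * went A g h.
Proof. by rewrite /went mxE. Qed.
Lemma went1 g h : went 1 g h = (g == h)%:R.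
Proof. by rewrite /went mxE (inj_eq (can_inj wrankK)). Qed.
Lemma went_scalar c g h : went c%:M g h = (g == h)%:R * c.
Proof. by rewrite /went mxE (inj_eq (can_inj wrankK)) mulr_natl. Qed.
Lemma went_sum I (r : seq I) P (F : I -> M) g h :
  went (\sum_(i <- r | P i) F i) g h = \sum_(i <- r | P i) went (F i) g h.
Proof. by rewrite /went summxE. Qed.

Definition wdiag (d : W -> T) : M :=
  locked_with wdiag_key (wmx (fun g h => (g == h)%:R * d g)).
(** Right translation of functions, so that [wperm] is multiplicative and not
    anti-multiplicative. *)
Definition wperm (w : W) : M := locked_with wperm_key (wmx (fun g h => (h == (g * w)%g)%:R)).
Definition wact (A : M) (f : W -> T) (g : W) : T := \sum_h went A g h * f h.

Lemma wactM A B f g : wact (A * B) f g = wact A (wact B f) g.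
Proof.
rewrite /wact; under eq_bigr => h _ do rewrite wentM mulr_suml.
rewrite exchange_big; apply: eq_bigr => k _ /=.
by rewrite mulr_sumr; apply: eq_bigr => h _; rewrite mulrA.
Qed.
Lemma wactD A B f g : wact (A + B) f g = wact A f g + wact B f g.
Proof.
by rewrite /wact -big_split; apply: eq_bigr => h _; rewrite wentD mulrDl.
Qed.
Lemma wactZ c A f g : wact (c *: A) f g = c * wact A f g.
Proof.
by rewrite /wact mulr_sumr; apply: eq_bigr => h _; rewrite wentZ mulrA.
Qed.
Lemma wactN A f g : wact (- A) f g = - wact A f g.
Proof. by rewrite -scaleN1r wactZ mulN1r. Qed.
Lemma wactB A B f g : wact (A - B) f g = wact A f g - wact B f g.
Proof. by rewrite wactD wactN. Qed.
Lemma wact_sum I (r : seq I) P (F : I -> M) f g :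
  wact (\sum_(i <- r | P i) F i) f g = \sum_(i <- r | P i) wact (F i) f g.
Proof.
rewrite /wact; under eq_bigr => h _ do rewrite went_sum mulr_suml.
by rewrite exchange_big.
Qed.
Lemma sum_delta (g : W) (F : W -> T) : \sum_h (h == g)%:R * F h = F g.
Proof.
rewrite (bigD1 g) //= big1 => [|h /negbTE ->]; last by rewrite mul0r.
by rewrite eqxx mul1r addr0.
Qed.
Lemma wact_diag d f g : wact (wdiag d) f g = d g * f g.
Proof.
rewrite /wdiag locked_withE /wact.
under eq_bigr => h _ do rewrite wmxE eq_sym -mulrA.
by rewrite (sum_delta g (fun h => d g * f h)).
Qed.
Lemma went_diag d g h : went (wdiag d) g h = (g == h)%:R * d g.
Proof. by rewrite /wdiag locked_withE wmxE. Qed.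
Lemma went_perm w g h : went (wperm w) g h = (h == (g * w)%g)%:R.
Proof. by rewrite /wperm locked_withE wmxE. Qed.
Lemma wact_perm w f g : wact (wperm w) f g = f (g * w)%g.
Proof.
rewrite /wperm locked_withE /wact.
by under eq_bigr => h _ do rewrite wmxE; rewrite sum_delta.
Qed.
Lemma wact1 f g : wact 1 f g = f g.
Proof.
by rewrite /wact; under eq_bigr => h _ do rewrite went1 eq_sym; rewrite sum_delta.
Qed.
Lemma wact_scalar c f g : wact c%:M f g = c * f g.
Proof. by rewrite -[c%:M]scalemx1 wactZ wact1. Qed.
Lemma wact_ext A f f' g : f =1 f' -> wact A f g = wact A f' g.
Proof. by move=> e; apply: eq_bigr => h _; rewrite e. Qed.
(** Indicator functions recover the entries. Identities between operators are therefore checked on a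
    function at one point of the orbit, where they become commutative algebra. *)
Lemma wact_inj A B : (forall f g, wact A f g = wact B f g) -> A = B.
Proof.
move=> e; apply: went_inj => g h; have := e (fun k => (k == h)%:R) g.
have E C : wact C (fun k => (k == h)%:R) g = went C g h.
  by rewrite /wact; under eq_bigr => k _ do rewrite mulrC; rewrite sum_delta.
by rewrite !E.
Qed.
Lemma wpermM u v : wperm (u * v)%g = wperm u * wperm v.
Proof.
by apply: wact_inj => f g; rewrite wactM !wact_perm mulgA.
Qed.
Lemma wperm1 : wperm 1%g = 1.
Proof. by apply: wact_inj => f g; rewrite wact1 wact_perm mulg1. Qed.
End GroupMatrix.

(** * The dihedral group of order 8 and its Dunkl operators *)

Section Dihedral4.
Variables (K : realType) (zeta : K[i]) (hz : 4.-primitive_root zeta).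
Local Notation C := K[i].
Local Notation W := (dihedral hz).

Lemma zeta4 : zeta ^+ 4 = 1.
Proof. exact: prim_expr_order. Qed.
Lemma zeta_neq0 : zeta != 0.
Proof. by apply: contra_eq_neq zeta4 => ->; rewrite expr0n eq_sym oner_neq0. Qed.
Lemma zeta2 : zeta * zeta = -1.
Proof.
have : (zeta ^+ 2 - 1) * (zeta ^+ 2 + 1) = 0.
  by rewrite -subr_sqr -exprM zeta4 expr1n subrr.
move/eqP; rewrite mulf_eq0 => /orP [|]; last by rewrite addr_eq0 => /eqP.
by rewrite subr_eq0 -(prim_order_dvd hz).
Qed.
Lemma zetaV j : (zeta ^+ j)^-1 = zeta ^+ (3 * j).
Proof.
apply: (mulfI (expf_neq0 j zeta_neq0)).
by rewrite divff ?expf_neq0 ?zeta_neq0 // -exprD -mulSn exprM zeta4 expr1n.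
Qed.

Lemma W_eq (u v : W) : W_mx u = W_mx v -> u = v.
Proof. exact: W_mx_inj. Qed.

Lemma s_00 j : W_mx (s_ hz j) 0 0 = 0.
Proof. by rewrite mxE. Qed.
Lemma s_01 j : W_mx (s_ hz j) 0 1 = zeta ^+ j.
Proof. by rewrite mxE. Qed.
Lemma s_10 j : W_mx (s_ hz j) 1 0 = zeta ^+ (3 * j).
Proof. by rewrite mxE /= zetaV. Qed.
Lemma s_11 j : W_mx (s_ hz j) 1 1 = 0.
Proof. by rewrite mxE. Qed.

Definition rot (j : nat) : W := (s_ hz j * s_ hz 0)%g.
Lemma s_ss j l : (s_ hz j * s_ hz l)%g = rot ((j + 3 * l) %% 4).
Proof.
rewrite /rot.
apply: W_eq; rewrite !W_mxM /W_mx.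
rewrite -![adiag2 _ *m _]/(adiag2 _ * _) /refl !adiag2A expr0 divr1.
by rewrite (prim_expr_mod hz) exprD zetaV.
Qed.
Lemma s_sq j : (s_ hz j * s_ hz j = 1)%g.
Proof.
apply: W_eq; rewrite W_mxM /=.
rewrite -[adiag2 _ *m _]/(adiag2 _ * _) /refl !adiag2A divff ?diag2_1 //.
by rewrite expf_neq0 ?zeta_neq0.
Qed.

Lemma W_ind (P : W -> Prop) : P 1%g -> P (s_ hz 0) -> P (s_ hz 1) ->
  (forall u v, P u -> P v -> P (u * v)%g) -> (forall u, P u -> P u^-1%g) ->
  forall w, P w.
Proof.
move=> P1 P2 P3 PM PV w; suff : forall A, in_W zeta A ->
  exists2 u : W, W_mx u = A & P u.
  by move=> /(_ _ (W_mxP w)) [u /W_eq ->].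
move=> A; elim=> {A} [|||A B _ [u <- Pu] _ [v <- Pv]|A _ [u <- Pu]].
- by exists 1%g.
- by exists (s_ hz 0).
- by exists (s_ hz 1).
- by exists (u * v)%g => //; apply: PM.
- by exists u^-1%g => //; apply: PV.
Qed.

Variables (T : comNzRingType).
Local Notation k := {mpoly C[2]}.
Variable iota : {rmorphism k -> T}.
Definition cst : {rmorphism C -> T} := (iota \o @mpolyC 2 C)%FUN.
Variables x y X Y : T.

Definition mvx (g : W) : T := cst (W_mx g 0 0) * x + cst (W_mx g 1 0) * y.
Definition mvy (g : W) : T := cst (W_mx g 0 1) * x + cst (W_mx g 1 1) * y.
(** The coefficients are those of [mvx]: under W the pair (Y, X) transforms as (x, y) does, see
    [W_inv_mx]. *)
Definition mvY (g : W) : T := cst (W_mx g 0 0) * Y + cst (W_mx g 1 0) * X.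
Definition mvX (g : W) : T := cst (W_mx g 0 1) * Y + cst (W_mx g 1 1) * X.

Lemma W_mxME (g h : W) a b :
  W_mx (g * h)%g a b = W_mx g a 0 * W_mx h 0 b + W_mx g a 1 * W_mx h 1 b.
Proof.
rewrite W_mxM mxE big_ord_recl big_ord1.
by congr (_ * _ + W_mx g _ _ * W_mx h _ _); apply: val_inj.
Qed.
Lemma mvxM g h : mvx (g * h)%g = cst (W_mx h 0 0) * mvx g + cst (W_mx h 1 0) * mvy g.
Proof. by rewrite /mvx /mvy !W_mxME !rmorphD !rmorphM; ring. Qed.
Lemma mvyM g h : mvy (g * h)%g = cst (W_mx h 0 1) * mvx g + cst (W_mx h 1 1) * mvy g.
Proof. by rewrite /mvx /mvy !W_mxME !rmorphD !rmorphM; ring. Qed.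
Lemma mvYM g h : mvY (g * h)%g = cst (W_mx h 0 0) * mvY g + cst (W_mx h 1 0) * mvX g.
Proof. by rewrite /mvX /mvY !W_mxME !rmorphD !rmorphM; ring. Qed.
Lemma mvXM g h : mvX (g * h)%g = cst (W_mx h 0 1) * mvY g + cst (W_mx h 1 1) * mvX g.
Proof. by rewrite /mvX /mvY !W_mxME !rmorphD !rmorphM; ring. Qed.

Local Notation z := (cst zeta).
Lemma z4 : z ^+ 4 = 1. Proof. by rewrite -rmorphXn zeta4 rmorph1. Qed.
Lemma z2 : z * z = -1. Proof. by rewrite -rmorphM zeta2 rmorphN1. Qed.
Lemma z_mod n : z ^+ n = z ^+ (n %% 4).
Proof. by rewrite {1}(divn_eq n 4) exprD mulnC exprM z4 expr1n mul1r. Qed.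

Lemma mvx_s g j : mvx (g * s_ hz j)%g = z ^+ (3 * j) * mvy g.
Proof. by rewrite mvxM s_00 s_10 rmorph0 mul0r add0r rmorphXn. Qed.
Lemma mvy_s g j : mvy (g * s_ hz j)%g = z ^+ j * mvx g.
Proof. by rewrite mvyM s_01 s_11 rmorph0 mul0r addr0 rmorphXn. Qed.
Lemma mvY_s g j : mvY (g * s_ hz j)%g = z ^+ (3 * j) * mvX g.
Proof. by rewrite mvYM s_00 s_10 rmorph0 mul0r add0r rmorphXn. Qed.
Lemma mvX_s g j : mvX (g * s_ hz j)%g = z ^+ j * mvY g.
Proof. by rewrite mvXM s_01 s_11 rmorph0 mul0r addr0 rmorphXn. Qed.

Variable il : W -> nat -> T.
Hypothesis ilP : forall g j, il g j * (mvX g - z ^+ j * mvY g) = 1.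

Lemma inv_uniq (a b c : T) : a * c = 1 -> b * c = 1 -> a = b.
Proof. by move=> h h'; rewrite -[a]mulr1 -h' mulrCA h mulr1. Qed.

Lemma il_mod g j : il g j = il g (j %% 4).
Proof. by apply: inv_uniq (ilP g j) _; rewrite z_mod ilP. Qed.
(** The reflection s_j carries alpha_l to - zeta^(l - j) alpha_(2j - l). Subtraction modulo 4 is
    written as addition of 3 l, and uniqueness of inverses gives the rule for 1 / alpha_l. *)
Lemma il_s g j l :
  il (g * s_ hz j)%g l = - z ^+ (j + 3 * l) * il g ((2 * j + 3 * l) %% 4).
Proof.
rewrite -il_mod; apply: inv_uniq (ilP _ l) _.
rewrite mvX_s mvY_s -[RHS](ilP g (2 * j + 3 * l)).
have -> : z ^+ (2 * j + 3 * l) = z ^+ j * z ^+ j * z ^+ l ^+ 3.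
  by rewrite -!exprM -!exprD; congr (z ^+ _); lia.
have e (n : nat) : z ^+ (n * 4) = 1 by rewrite mulnC exprM z4 expr1n.
have ej : z ^+ j ^+ 4 = 1 by rewrite -exprM e.
have el : z ^+ l ^+ 4 = 1 by rewrite -exprM e.
rewrite exprD ![(3 * _)%N]mulnC !(exprM z).
move: (z ^+ j) (z ^+ l) ej el => u v; set I := il _ _ => hu hv.
have -> : - (u * v ^+ 3) * I * (u * mvY g - v * (u ^+ 3 * mvX g)) =
  I * (u ^+ 4 * v ^+ 4 * mvX g - u * u * v ^+ 3 * mvY g) by ring.
by rewrite hu hv !mul1r.
Qed.

(* [mvx g], ..., [mvY g] are the coordinates of the point g of the orbit, and
   [il g j] is the inverse of alpha_j there. *)
Definition mvec (v : 'cV[C]_2) g : T := cst (v 0 0) * mvx g + cst (v 1 0) * mvy g.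
Definition mform (f : 'rV[C]_2) g : T := cst (f 0 0) * mvX g + cst (f 0 1) * mvY g.
Definition par j : T := iota (parC K j).

Local Notation M := (restr iota 'M[T]_((wdim W).+1)).

(** Dunkl operator at t = 0: multiplication by the symbol [mvec v] replaces the derivative. The
    coefficient of each reflection is C_j times the pairing of v with alpha_j, divided by
    alpha_j. *)
Definition dunkl (v : 'cV[C]_2) : M :=
  locked_with dunkl_key (wdiag (mvec v) + \sum_(j < 4) wdiag (fun g : W =>
    par j * cst (v 0 0 - zeta ^+ j * v 1 0) * il g j) * wperm T (s_ hz j)).
Definition dperm (w : W) : M := wperm T w.
Definition dform (f : 'rV[C]_2) : M := wdiag (mform f).

Lemma wact_dunkl v f g : wact (dunkl v) f g = mvec v g * f g +
  \sum_(j < 4) par j * cst (v 0 0 - zeta ^+ j * v 1 0) * il g j * f (g * s_ hz j)%g.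
Proof.
rewrite /dunkl locked_withE wactD wact_diag wact_sum; congr (_ + _).
by apply: eq_bigr => j _; rewrite wactM wact_diag wact_perm.
Qed.

Lemma par_mod j : par j = par (j %% 2).
Proof. by rewrite /par /parC modn2; case: odd. Qed.

(* the telescoping identity behind the commutation of the Dunkl operators *)
Lemma il_cycle g :
  il g 1 * il g 2 = il g 3 * il g 0 + z * il g 0 * il g 1 - z * il g 2 * il g 3.
Proof.
have := (ilP g 0, ilP g 1, ilP g 2, ilP g 3).
rewrite expr0 expr1 expr2 z2 (exprS _ 2) expr2 z2.
move: (il g 0) (il g 1) (il g 2) (il g 3) (mvX g) (mvY g) => i0 i1 i2 i3 a b.
case=> [[[h0 h1] h2] h3]; apply: subr0_eq.
pose l0 := a - 1 * b; pose l1 := a - z * b; pose l2 := a - -1 * b.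
pose l3 := a - z * -1 * b.
(* Every product i_j l_j is 1, so each term is brought to the common denominator before the
   numerators are compared. *)
transitivity ((i1 * i2) * (i0 * l0) * (i3 * l3) -
  ((i3 * i0) * (i1 * l1) * (i2 * l2) + (z * i0 * i1) * (i2 * l2) * (i3 * l3)
  - (z * i2 * i3) * (i0 * l0) * (i1 * l1))).
  by rewrite h0 h1 h2 h3 !mulr1.
by rewrite /l0 /l1 /l2 /l3; ring: z2.
Qed.

(** The products of two reflections that give a rotation of order 4 cancel by [il_cycle]. All other
    terms are symmetric in u and v, once [par_mod] has identified C_0 with C_2 and C_1 with C_3. *)
Lemma dunklC u v : dunkl u * dunkl v = dunkl v * dunkl u.
Proof.
apply: wact_inj => f g; rewrite !wactM !wact_dunkl.
rewrite !big_ord_recl !big_ord0 /= !wact_dunkl.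
rewrite !big_ord_recl !big_ord0 /= /bump /=.
rewrite -!mulgA !s_ss /= !il_s /mvec !mvx_s !mvy_s.
rewrite !(add1n, muln0, muln1, addn0, add0n) /=.
have := il_cycle g; have := z2; rewrite !(par_mod 2, par_mod 3) /=.
move: (il g) => I.
evaln.
rewrite !rmorphB /= !rmorphM !rmorphXn /=.
move=> hz2 hI.
ring: hz2 hI.
Qed.

Lemma mvec_delta0 g : mvec (delta_mx 0 0) g = mvx g.
Proof. by rewrite /mvec !mxE rmorph1 rmorph0 mul1r mul0r addr0. Qed.
Lemma mvec_delta1 g : mvec (delta_mx 1 0) g = mvy g.
Proof. by rewrite /mvec !mxE rmorph1 rmorph0 mul1r mul0r add0r. Qed.
Lemma mform_delta0 g : mform (delta_mx 0 0) g = mvX g.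
Proof. by rewrite /mform !mxE rmorph1 rmorph0 mul1r mul0r addr0. Qed.
Lemma mform_delta1 g : mform (delta_mx 0 1) g = mvY g.
Proof. by rewrite /mform !mxE rmorph1 rmorph0 mul1r mul0r add0r. Qed.

Lemma went_dunkl v g h : went (dunkl v) g h = (g == h)%:R * mvec v g +
  \sum_(j < 4) par j * cst (v 0 0 - zeta ^+ j * v 1 0) * il g j *
    (h == (g * s_ hz j)%g)%:R.
Proof.
rewrite /dunkl locked_withE wentD went_sum went_diag; congr (_ + _).
apply: eq_bigr => j _; rewrite wentM (bigD1 g) //= big1 => [|l hl].
  by rewrite went_diag went_perm eqxx mul1r addr0.
by rewrite went_diag eq_sym (negbTE hl) !mul0r.
Qed.

Lemma pairingE v f : pairing v f = f 0 0 * v 0 0 + f 0 1 * v 1 0 :> C.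
Proof.
rewrite /pairing mxE big_ord_recl big_ord1.
by congr (_ + f 0 _ * v _ 0); apply: val_inj.
Qed.
Lemma pairing_alpha v j : pairing v (alpha zeta j) = v 0 0 - zeta ^+ j * v 1 0.
Proof. by rewrite pairingE !mxE /= !mulr1n !mulr0n; ring. Qed.
Lemma pairing_alphav f j : pairing (alphav zeta j) f = zeta ^+ j * f 0 0 - f 0 1.
Proof. by rewrite pairingE !mxE /= !mulr1n !mulr0n; ring. Qed.
Lemma pairing_alphavv j : pairing (alphav zeta j) (alpha zeta j) = 2%:R * zeta ^+ j.
Proof. by rewrite pairing_alphav !mxE /= !mulr1n !mulr0n; ring. Qed.

Lemma dformC f f' : dform f * dform f' = dform f' * dform f.
Proof.
by apply: wact_inj => h g; rewrite !wactM !wact_diag mulrCA.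
Qed.

(** The factor 2 cancels against the pairing of alpha_j with its coroot, which is 2 zeta^j. *)
Lemma cherednik_coef u U j :
  - 2%:R * (pairing u (alpha zeta j) * pairing (alphav zeta j) U /
    pairing (alphav zeta j) (alpha zeta j)) =
  (u 0 0 - zeta ^+ j * u 1 0) * (zeta ^+ (3 * j) * U 0 1 - U 0 0).
Proof.
rewrite pairing_alpha pairing_alphav pairing_alphavv -zetaV.
have := expf_neq0 j zeta_neq0; move: (zeta ^+ j) => w hw.
by field.
Qed.

Lemma cherednik_coefk u U j :
  - 2%:R * (parC K j * (pairing u (alpha zeta j) * pairing (alphav zeta j) U /
    pairing (alphav zeta j) (alpha zeta j))%:MP_[2]) =
  parC K j *
    ((u 0 0 - zeta ^+ j * u 1 0) * (zeta ^+ (3 * j) * U 0 1 - U 0 0))%:MP_[2].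
Proof.
rewrite mulrCA -cherednik_coef; congr (_ * _).
by rewrite [in RHS]mpolyCM mpolyCN mpolyC_nat.
Qed.

(** The diagonal parts commute. In the reflection terms U is evaluated at g and at g s_j; the
    difference is a multiple of alpha_j, which cancels the denominator. *)
Lemma dunkl_form u U : dunkl u * dform U - dform U * dunkl u =
  - 2%:R *: \sum_(j < 4)
    (parC K j * (pairing u (alpha zeta j) * pairing (alphav zeta j) U /
      pairing (alphav zeta j) (alpha zeta j))%:MP_[2]) *:
    dperm (s_ hz j).
Proof.
rewrite scaler_sumr; apply: wact_inj => f g.
rewrite wactB !wactM wact_dunkl !wact_diag wact_dunkl wact_sum.
rewrite mulrDr addrAC opprD addrA [mvec u g * (_ * _)]mulrCA subrr sub0r addrC.
rewrite mulr_sumr -sumrB; apply: eq_bigr => j _.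
rewrite /dform wact_diag scalerA cherednik_coefk.
rewrite [_ *: _]restr_scaleE wactZ wact_perm.
rewrite rmorphM -/(par j) -[iota _]/(cst _) rmorphM /mform mvX_s mvY_s.
rewrite [cst (_ * _ - _)]rmorphB rmorphM rmorphXn.
have h := ilP g j; have h3 : z ^+ (3 * j) * z ^+ j = 1.
  by rewrite -exprD -mulSnr exprM z4 expr1n.
move: (z ^+ j) (z ^+ (3 * j)) h h3 => w w3 h h3.
move: (cst _) (il g j) h => c I h.
transitivity (par j * c * (f (g * s_ hz j)%g) * (w3 * cst (U 0 1) - cst (U 0 0))
  * (I * (mvX g - w * mvY g))); last by rewrite h; ring.
by ring: h3.
Qed.

Lemma dunkl_lin (c : C) u v : dunkl (c *: u + v) = c%:MP_[2] *: dunkl u + dunkl v.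
Proof.
apply: wact_inj => f g; rewrite [_%:MP_[_] *: _]restr_scaleE [RHS]wactD wactZ !wact_dunkl.
rewrite mulrDr mulr_sumr addrACA -big_split /mvec !mxE !rmorphD !rmorphM /=.
congr (_ + _); first ring.
by apply: eq_bigr => j _; rewrite !rmorphB !rmorphM !rmorphD !rmorphM /=; ring.
Qed.
Lemma dpermM u v : dperm (u * v)%g = dperm u * dperm v.
Proof. exact: wpermM. Qed.
Lemma dperm1 : dperm 1%g = 1.
Proof. exact: wperm1. Qed.
Lemma wact_dperm w f g : wact (dperm w) f g = f (g * w)%g.
Proof. exact: wact_perm. Qed.
Lemma wact_dform U f g : wact (dform U) f g = mform U g * f g.
Proof. exact: wact_diag. Qed.
Lemma dform_lin (c : C) u v : dform (c *: u + v) = c%:MP_[2] *: dform u + dform v.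
Proof.
apply: wact_inj => f g; rewrite [_%:MP_[_] *: _]restr_scaleE [RHS]wactD wactZ /dform !wact_diag.
by rewrite /mform !mxE !rmorphD !rmorphM /=; ring.
Qed.

(** Checked by computation on the generators s_0 and s_1; the relation passes to products and
    inverses, hence to all of W by [W_ind]. *)
Lemma dunkl_conj w v :
  dperm w * dunkl v = dunkl (W_mx w *m v) * dperm w.
Proof.
have base m : (m < 2)%N -> forall v, dperm (s_ hz m) * dunkl v =
    dunkl (W_mx (s_ hz m) *m v) * dperm (s_ hz m).
  move=> hm {}v; apply: wact_inj => f g; rewrite [LHS]wactM [RHS]wactM.
  rewrite wact_dperm [LHS]wact_dunkl [RHS]wact_dunkl.
  have E : W_mx (s_ hz m) *m v = \col_i
      (if i == 0 then zeta ^+ m * v 1 0 else zeta ^+ (3 * m) * v 0 0).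
    apply/matrixP => i j; rewrite ord1 !mxE big_ord_recl big_ord1 /=.
    rewrite (_ : lift ord0 ord0 = 1); last exact: val_inj.
    have [->|->] : i = 0 \/ i = 1.
      by case: i => [[|[|//]] ?]; [left|right]; apply: val_inj.
    - by rewrite s_00 s_01 mul0r add0r.
    - by rewrite s_10 s_11 mul0r addr0.
  rewrite /mvec mvx_s mvy_s E !mxE /= !rmorphM !rmorphXn.
  rewrite !big_ord_recl !big_ord0 /= /bump /= !wact_dperm.
  rewrite -!mulgA !s_ss !il_s.
  case: m hm {E} => [|[|//]] _; evaln; rewrite !(par_mod 2, par_mod 3); evaln;
    rewrite !rmorphB !rmorphM !rmorphXn /=; move: (il g) => I; ring: z2.
move: v; elim/W_ind: w => [v||||].
- by rewrite dperm1 mul1r mulr1 W_mx1 mul1mx.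
- exact: base.
- exact: base.
- move=> u v hu hv w; rewrite dpermM W_mxM -mulmxA.
  exact: conj_mul (hv _) (hu _).
- move=> u hu v; apply: (@conj_inv _ (dperm u)).
  + by rewrite -dpermM mulgV dperm1.
  + by rewrite -dpermM mulVg dperm1.
  + by rewrite hu mulmxA -W_mxM mulgV W_mx1 mul1mx.
Qed.

Lemma dform_conj w U :
  dperm w * dform U = dform (U *m invmx (W_mx w)) * dperm w.
Proof.
have base m : forall U,
    dperm (s_ hz m) * dform U = dform (U *m W_mx (s_ hz m)) * dperm (s_ hz m).
  move=> {}U; apply: wact_inj => f g; rewrite [LHS]wactM [RHS]wactM.
  rewrite wact_dperm [LHS]wact_dform [RHS]wact_dform wact_dperm; congr (_ * _).
  have E i : (U *m W_mx (s_ hz m)) 0 i =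
      if i == 0 then zeta ^+ (3 * m) * U 0 1 else zeta ^+ m * U 0 0.
    rewrite mxE big_ord_recl big_ord1.
    rewrite (_ : lift ord0 ord0 = 1); last exact: val_inj.
    have [->|->] : i = 0 \/ i = 1.
      by case: i => [[|[|//]] ?]; [left|right]; apply: val_inj.
    - by rewrite s_00 s_10 mulr0 add0r mulrC.
    - by rewrite s_01 s_11 mulr0 addr0 mulrC.
  by rewrite /mform !E mvX_s mvY_s /= !rmorphM !rmorphXn /=; ring.
have sV m : invmx (W_mx (s_ hz m)) = W_mx (s_ hz m).
  rewrite -[invmx _]/(W_mx (s_ hz m)^-1%g); congr W_mx.
  by apply: (mulgI (s_ hz m)); rewrite mulgV s_sq.
move: U; elim/W_ind: w => [v||||].
- by rewrite dperm1 mul1r mulr1 W_mx1 invmx1 mulmx1.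
- by move=> U; rewrite sV base.
- by move=> U; rewrite sV base.
- move=> u v hu hv U; rewrite dpermM.
  rewrite -[invmx _]/(W_mx (u * v)^-1%g) invMg W_mxM mulmxA.
  exact: conj_mul (hv _) (hu _).
- move=> u hu v; apply: (@conj_inv _ (dperm u)).
  + by rewrite -dpermM mulgV dperm1.
  + by rewrite -dpermM mulVg dperm1.
  + by rewrite hu -mulmxA -[invmx (W_mx u^-1%g)]/(W_mx (u^-1)^-1%g) -[invmx _]/(W_mx u^-1%g) -W_mxM mulVg W_mx1 mulmx1.
Qed.

Definition letter_rep (l : letter 2) : M :=
  match l with inl j => dunkl (delta_mx j 0) | inr j => dform (delta_mx 0 j) end.
Definition tens_rep : tens k 2 -> M := falg_eval letter_rep.

Lemma tens_rep_linear : linear tens_rep. Proof. exact: falg_eval_linear. Qed.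
Lemma tens_rep_monoid : monoid_morphism tens_rep.
Proof. exact: falg_eval_monoid. Qed.

Lemma cV2E (v : 'cV[C]_2) :
  v = v 0 0 *: delta_mx 0 0 + (v 1 0 *: delta_mx 1 0 + 0).
Proof.
apply/matrixP => i j; rewrite ord1 !mxE.
have [->|->] : i = 0 \/ i = 1.
  by case: i => [[|[|//]] ?]; [left|right]; apply: val_inj.
- by rewrite /= mulr1 !mulr0 !addr0.
- by rewrite /= mulr1 !mulr0 addr0 add0r.
Qed.
Lemma rV2E (v : 'rV[C]_2) :
  v = v 0 0 *: delta_mx 0 0 + (v 0 1 *: delta_mx 0 1 + 0).
Proof.
apply/matrixP => j i; rewrite ord1 !mxE.
have [->|->] : i = 0 \/ i = 1.
  by case: i => [[|[|//]] ?]; [left|right]; apply: val_inj.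
- by rewrite /= mulr1 !mulr0 !addr0.
- by rewrite /= mulr1 !mulr0 addr0 add0r.
Qed.
Lemma dunkl0 : dunkl 0 = 0.
Proof.
by have := dunkl_lin (-1) 0 0; rewrite scaler0 addr0 mpolyCN scaleN1r addNr.
Qed.
Lemma dform0 : dform 0 = 0.
Proof.
by have := dform_lin (-1) 0 0; rewrite scaler0 addr0 mpolyCN scaleN1r addNr.
Qed.

Lemma tens_rep_vec v :
  tens_rep (vecT (@mpolyC 2 C : {rmorphism C -> k}) v) = dunkl v.
Proof.
rewrite vecT.unlock (linear_lcomb _ _ tens_rep_linear).
under eq_bigr => j _ do rewrite /tens_rep falg_eval_gen.
rewrite big_ord_recl big_ord1 [in RHS](cV2E v) !dunkl_lin dunkl0 addr0.
by rewrite (_ : lift ord0 ord0 = 1); last exact: val_inj.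
Qed.
Lemma tens_rep_form v :
  tens_rep (formT (@mpolyC 2 C : {rmorphism C -> k}) v) = dform v.
Proof.
rewrite formT.unlock (linear_lcomb _ _ tens_rep_linear).
under eq_bigr => j _ do rewrite /tens_rep falg_eval_gen.
rewrite big_ord_recl big_ord1 [in RHS](rV2E v) !dform_lin dform0 addr0.
by rewrite (_ : lift ord0 ord0 = 1); last exact: val_inj.
Qed.

(** Conjugation by w and the action of w on the tensor algebra both give algebra morphisms out of a
    free algebra, so it is enough to compare them on letters. *)
Lemma tens_rep_conj w t :
  dperm w * tens_rep t = tens_rep (W_action hz w t) * dperm w.
Proof.
pose h l := dperm w * letter_rep l * dperm w^-1%g.
have wV : dperm w^-1%g * dperm w = 1 by rewrite -dpermM mulVg dperm1.
have Vw : dperm w * dperm w^-1%g = 1 by rewrite -dpermM mulgV dperm1.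
have e1 s : dperm w * tens_rep s * dperm w^-1%g = falg_eval h s.
  move: s; apply: falg_eval_uniq.
  - by move=> c a b; rewrite tens_rep_linear mulrDr mulrDl -scalerAr -scalerAl.
  - split=> [|a b]; first by rewrite tens_rep_monoid.1 mulr1 Vw.
    have -> := tens_rep_monoid.2 a b.
    exact: conj_morph wV.
  - by move=> l; rewrite /tens_rep falg_eval_gen.
have e2 s : tens_rep (W_action hz w s) = falg_eval h s.
  move: s; apply: falg_eval_uniq.
  - by move=> c a b; rewrite act_linear tens_rep_linear.
  - split=> [|a b]; first by rewrite (act_monoid _ w).1 tens_rep_monoid.1.
    by rewrite (act_monoid _ w).2 tens_rep_monoid.2.
  - move=> l; rewrite /W_action /= /tens_act falg_eval_gen /h.
    case: l => j /=; rewrite ?tens_rep_vec ?tens_rep_form.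
      exact: esym (conj_cancel (dunkl_conj _ _) Vw).
    exact: esym (conj_cancel (dform_conj _ _) Vw).
exact: conj_back (etrans (e1 t) (esym (e2 t))) wV.
Qed.

Definition TW_rep : TW hz -> M := skew_lift tens_rep dperm.
Lemma TW_rep_linear : linear TW_rep.
Proof. exact: skew_lift_linear dperm tens_rep_linear. Qed.
Lemma TW_rep_monoid : monoid_morphism TW_rep.
Proof.
exact: skew_lift_monoid tens_rep_linear tens_rep_monoid dperm1 dpermM tens_rep_conj.
Qed.
Lemma TW_rep_vec v : TW_rep (TW_vec hz v) = dunkl v.
Proof.
by rewrite /TW_rep (skew_lift_T _ tens_rep_linear dperm1) tens_rep_vec.
Qed.
Lemma TW_rep_form v : TW_rep (TW_form hz v) = dform v.
Proof.
by rewrite /TW_rep (skew_lift_T _ tens_rep_linear dperm1) tens_rep_form.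
Qed.
Lemma TW_rep_grp w : TW_rep (TW_grp w) = dperm w.
Proof.
exact: skew_lift_W _ dperm tens_rep_linear tens_rep_monoid w.
Qed.

Lemma TW_rep_rel s : cherednik_rel s -> TW_rep s = 0.
Proof.
have fD a b : TW_rep (a + b) = TW_rep a + TW_rep b.
  by have := TW_rep_linear 1 a b; rewrite !scale1r.
have fZ c a : TW_rep (c *: a) = c *: TW_rep a.
  have := TW_rep_linear c a 0; rewrite addr0 => ->.
  have f0 : TW_rep 0 = 0 by apply: (addrI (TW_rep 0)); rewrite -fD !addr0.
  by rewrite f0 addr0.
have fB a b : TW_rep (a - b) = TW_rep a - TW_rep b.
  by rewrite -scaleN1r fD fZ scaleN1r.
case=> [u v|u v|u v]; rewrite !fB !TW_rep_monoid.2 ?TW_rep_vec ?TW_rep_form.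
- by rewrite dunklC subrr.
- by rewrite dformC subrr.
- rewrite dunkl_form /cherednik_rhs fZ (linear_lcomb _ _ TW_rep_linear).
  by apply: subr0_eq; rewrite subr0; apply/eqP; rewrite subr_eq0; apply/eqP;
     congr (_ *: _); apply: eq_bigr => j _; rewrite TW_rep_grp.
Qed.

Definition hrep : cherednik hz -> M := quot_lift TW_rep.
Lemma hrep_linear : linear hrep.
Proof. exact: quot_lift_linear TW_rep_linear TW_rep_monoid TW_rep_rel. Qed.
Lemma hrep_monoid : monoid_morphism hrep.
Proof. exact: quot_lift_monoid TW_rep_linear TW_rep_monoid TW_rep_rel. Qed.
Lemma hrep_pi s : hrep (H_pi s) = TW_rep s.
Proof. exact: quot_lift_pi _ TW_rep_linear TW_rep_monoid TW_rep_rel _. Qed.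
End Dihedral4.

Section MpolyLin.
Variables (k : comNzRingType) (n : nat) (V : lmodType k) (e : 'X_{1..n} -> V).
Definition mlin (p : {mpoly k[n]}) : V := \sum_(m <- msupp p) p@_m *: e m.

(** A sum over all monomials below a common bound, instead of the support of p, makes linearity a
    termwise matter. *)
Lemma mlinE i p : (msize p <= i)%N ->
  mlin p = \sum_(m : 'X_{1..n < i}) p@_m *: e m.
Proof.
move=> le_pi; rewrite /mlin (big_mksub 'X_{1..n < i}) ?msupp_uniq //=; first last.
  by move=> x /msize_mdeg_lt /leq_trans; apply.
by rewrite big_rmcond //= => j /memN_msupp_eq0 ->; rewrite scale0r.
Qed.
Lemma mlin_linear : linear mlin.
Proof.
move=> c p q; pose i := maxn (msize (c *: p + q)) (maxn (msize p) (msize q)).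
rewrite !(@mlinE i) ?leq_max ?leqnn ?orbT //.
rewrite scaler_sumr -big_split; apply: eq_bigr => m _.
by rewrite mcoeffD mcoeffZ scalerDl scalerA.
Qed.
Lemma mlinX m : mlin 'X_[m] = e m.
Proof. by rewrite /mlin msuppX big_seq1 mcoeffX eqxx scale1r. Qed.
Lemma mlin0 : mlin 0 = 0.
Proof. by rewrite /mlin msupp0 big_nil. Qed.
End MpolyLin.

Definition mn4 (a b c d : nat) : 'X_{1..4} :=
  [multinom nth 0%N [:: a; b; c; d] i | i < 4].
Lemma mn4E a b c d : ((mn4 a b c d (inord 0) = a) * (mn4 a b c d (inord 1) = b)
  * (mn4 a b c d (inord 2) = c) * (mn4 a b c d (inord 3) = d))%type.
Proof. by rewrite !mnmE !inordK. Qed.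
Lemma I4E (i : 'I_4) : [\/ i = inord 0, i = inord 1, i = inord 2 | i = inord 3].
Proof.
by case: i => [[|[|[|[|//]]]] ?]; [constructor 1|constructor 2|constructor 3|constructor 4];
  apply: val_inj; rewrite /= inordK.
Qed.
Lemma mn4_eta (m : 'X_{1..4}) :
  m = mn4 (m (inord 0)) (m (inord 1)) (m (inord 2)) (m (inord 3)).
Proof. by apply/mnmP => i; case: (I4E i) => ->; rewrite mn4E. Qed.
(** Expanding [u^4, h] gives minus the sum of u^i k0 u^(3-i), and [v^4, h] the sum of v^i k3
    v^(3-i). Moving u to the right raises the index of k and moving v lowers it, so the sums are
    those of k_i v^i u^(3-i) and k_(3-i) u^i v^(3-i): the same sum in reverse order. *)
Lemma pow4_comm (R : nzRingType) (u v h k0 k1 k2 k3 : R) :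
  u * v = v * u -> u * h = h * u - k0 -> v * h = h * v + k3 ->
  u * k0 = k1 * v -> u * k1 = k2 * v -> u * k2 = k3 * v ->
  v * k3 = k2 * u -> v * k2 = k1 * u -> v * k1 = k0 * u ->
  (u ^+ 4 + v ^+ 4) * h = h * (u ^+ 4 + v ^+ 4).
Proof.
move=> uv uh vh u0 u1 u2 v3 v2 v1.
have uvz t : u * (v * t) = v * (u * t) by rewrite !mulrA uv.
have uhz t : u * (h * t) = h * (u * t) - k0 * t by rewrite !mulrA uh mulrBl.
have vhz t : v * (h * t) = h * (v * t) + k3 * t by rewrite !mulrA vh mulrDl.
have u0z t : u * (k0 * t) = k1 * (v * t) by rewrite !mulrA u0.
have u1z t : u * (k1 * t) = k2 * (v * t) by rewrite !mulrA u1.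
have u2z t : u * (k2 * t) = k3 * (v * t) by rewrite !mulrA u2.
have v3z t : v * (k3 * t) = k2 * (u * t) by rewrite !mulrA v3.
have v2z t : v * (k2 * t) = k1 * (u * t) by rewrite !mulrA v2.
have v1z t : v * (k1 * t) = k0 * (u * t) by rewrite !mulrA v1.
rewrite mulrDl mulrDr !exprS !expr0 !mulr1 -!mulrA uh vh.
rewrite !(mulrBr, mulrDr, uhz, vhz, u0z, u1z, u2z, v3z, v2z, v1z, u0, u1, u2,
  v3, v2, v1, uv, uvz).
rewrite -!addrA; congr (_ + _).
by rewrite [h * _ + (_ + _)]addrC -!addrA !addKr.
Qed.

(** Here q is the left letter and p the right letter of the normal order, and [atr] is
    multiplicative for these two sides only. Among the six words with two p and two q only p q p q
    leaves a correction D: in p p q q the contributions of ka ka and p ka q cancel. *)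
Lemma trace_pow4 (k : comNzRingType) (H : algType k) (P : comAlgType k)
    (atr : H -> P) (p q ka : H) (Pp Pq D : P) (al be : k) :
  linear atr -> atr 1 = 1 ->
  p * q = q * p + ka ->
  (forall h, atr (h * p) = atr h * Pp) -> (forall h, atr (q * h) = Pq * atr h) ->
  atr ka = 0 -> atr (p * ka) = 0 -> atr (ka * q) = 0 ->
  atr (p * p * ka) = 0 -> atr (ka * q * q) = 0 ->
  atr (ka * ka) = D -> atr (p * ka * q) = - D ->
  atr ((al *: p + be *: q) ^+ 4) =
  (al *: Pp + be *: Pq) ^+ 4 + (al ^+ 2 * be ^+ 2) *: D.
Proof.
move=> atr_lin atr1.
have atrD h h' : atr (h + h') = atr h + atr h'.
  by have := atr_lin 1 h h'; rewrite !scale1r.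
have atr0 : atr 0 = 0 by apply: (addrI (atr 0)); rewrite -atrD !addr0.
have atrZ c h : atr (c *: h) = c *: atr h.
  by have := atr_lin c h 0; rewrite atr0 !addr0.
move=> pq hp hq k1 kp kq kpp kqq kk pkq.
have hq' : atr q = Pq by rewrite -[q]mulr1 hq atr1 mulr1.
have hp' : atr p = Pp by rewrite -[p]mul1r hp atr1 mul1r.
have e1 : atr (p * q) = Pq * Pp by rewrite pq atrD hq hp' k1 addr0.
have e2 : atr (p * p * q) = Pq * Pp ^+ 2.
  by rewrite -mulrA pq mulrDr atrD kp mulrA hp e1 addr0 expr2 mulrA.
have e3 : atr (p * q * q) = Pq ^+ 2 * Pp.
  by rewrite pq mulrDl atrD kq -mulrA hq e1 addr0 expr2 mulrA.
have e4 : atr (p * p * p * q) = Pq * Pp ^+ 3.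
  rewrite -mulrA pq mulrDr atrD kpp mulrA hp e2 addr0.
  by ring.
have e5 : atr (p * q * q * q) = Pq ^+ 3 * Pp.
  rewrite pq !mulrDl atrD kqq -!mulrA hq [p * _]mulrA e3 addr0.
  by ring.
have e6 : atr (p * p * q * q) = Pq ^+ 2 * Pp ^+ 2.
  rewrite -[p * p * q]mulrA pq mulrDr mulrDl atrD pkq mulrA pq mulrDl mulrDl.
  rewrite -[ka * p * q]mulrA pq mulrDr !atrD kk mulrA hp kq mul0r add0r.
  rewrite addrK -!mulrA hq pq mulrDr atrD mulrA hp e1 kp addr0.
  by rewrite !expr2 !mulrA.
have e7 : atr (p * q * p * q) = Pq ^+ 2 * Pp ^+ 2 + D.
  rewrite -mulrA pq mulrDr !mulrDl !atrD kk [ka * (q * p)]mulrA hp kq mul0r addr0.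
  rewrite -!mulrA !hq kp mulr0 add0r !mulrA hp e1; congr (_ + _).
  by ring.
set u := _ + _.
have E1 a b : atr (a * u * b) = al *: atr (a * p * b) + be *: atr (a * q * b).
  by rewrite mulrDr mulrDl atrD -!scalerAr -!scalerAl !atrZ.
have E2 a b : atr (a * u * u * b) = (al ^+ 2) *: atr (a * p * p * b) +
    (al * be) *: (atr (a * p * q * b) + atr (a * q * p * b)) +
    (be ^+ 2) *: atr (a * q * q * b).
  rewrite E1 -[a * u * p * b]mulrA -[a * u * q * b]mulrA !E1 !mulrA !scalerDr !scalerA.
  by rewrite -!expr2 [be * al]mulrC !addrA [LHS](ACl (1*3*2*4)).
have -> : u ^+ 4 = 1 * u * u * (u * u).
  by rewrite !exprS expr0 mulr1 mul1r !mulrA.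
rewrite E2 !mul1r.
have E3 a : atr (a * (u * u)) = (al ^+ 2) *: atr (a * p * p) +
    (al * be) *: (atr (a * p * q) + atr (a * q * p)) + (be ^+ 2) *: atr (a * q * q).
  by have := E2 a 1; rewrite !mulr1 !mulrA.
have q4 a b c : atr (q * a * b * c) = Pq * atr (a * b * c).
  by rewrite -!mulrA hq.
have q3 a b : atr (q * a * b) = Pq * atr (a * b) by rewrite -!mulrA hq.
rewrite !E3 !(hp, e1, e2, e3, e4, e5, e6, e7, hp', q4, q3, hq, hq').
have inE c (t : P) : c *: t = in_alg P c * t by rewrite /= mulr_algl.
rewrite !inE; ring.
Qed.

(** * PBW spanning and central elements *)

Section AbstractCherednik.
Variables (K : realType) (zeta : K[i]) (hz : 4.-primitive_root zeta).
Local Notation C := K[i].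
Local Notation W := (dihedral hz).
Local Notation k := {mpoly C[2]}.
Local Notation P := {mpoly k[4]}.
Variables (H : algType k) (x y X Y : H) (w : W -> H).
Local Notation "c %:k" := (c%:MP_[2] : k) (at level 2).
(** All commutators between V and V^* have this form, which makes them computable through the
    function c alone. *)
Definition kap (c : nat -> C) : H :=
  \sum_(j < 4) (parC K j * (c j)%:k) *: w (s_ hz j).
Hypotheses (w1 : w 1%g = 1) (wM : forall g h, w (g * h)%g = w g * w h).
Hypothesis wx : forall g,
  w g * x = ((W_mx g 0 0)%:k *: x + (W_mx g 1 0)%:k *: y) * w g.
Hypothesis wy : forall g,
  w g * y = ((W_mx g 0 1)%:k *: x + (W_mx g 1 1)%:k *: y) * w g.
Hypothesis wY : forall g,
  w g * Y = ((W_mx g 0 0)%:k *: Y + (W_mx g 1 0)%:k *: X) * w g.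
Hypothesis wX : forall g,
  w g * X = ((W_mx g 0 1)%:k *: Y + (W_mx g 1 1)%:k *: X) * w g.
Hypotheses (xy : x * y = y * x) (XY : X * Y = Y * X).
Hypothesis xX : x * X = X * x - kap (fun=> 1).
Hypothesis xY : x * Y = Y * x + kap (fun j => zeta ^+ (3 * j)).
Hypothesis yX : y * X = X * y + kap (fun j => zeta ^+ j).
Hypothesis yY : y * Y = Y * y - kap (fun=> 1).

Definition mono (g : W) (m : 'X_{1..4}) : H :=
  X ^+ m (inord 2) * Y ^+ m (inord 3) * w g * (x ^+ m (inord 0) * y ^+ m (inord 1)).
(** For the Cherednik algebra this is convertible to [pbw], as are [ainv] and [atr] below to
    [pbw_inv] and [trunc]; results of this section are transported by [exact]. *)
Definition apbw (F : {ffun W -> P}) : H := \sum_(g : W) mlin (mono g) (F g).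

Lemma apbw_linear : linear apbw.
Proof.
move=> c F G; rewrite /apbw scaler_sumr -big_split; apply: eq_bigr => g _.
by rewrite !ffunE mlin_linear.
Qed.
Lemma apbw0 : apbw 0 = 0.
Proof. by rewrite /apbw big1 // => g _; rewrite ffunE mlin0. Qed.
Definition single (g : W) (p : P) : {ffun W -> P} :=
  [ffun h => if h == g then p else 0].
Lemma apbw_single g p : apbw (single g p) = mlin (mono g) p.
Proof.
rewrite /apbw (bigD1 g) //= big1 => [|h hh]; rewrite ffunE ?eqxx ?addr0 //.
by rewrite (negbTE hh) mlin0.
Qed.

Definition apbw_im (h : H) : Prop := exists F, apbw F = h.
Lemma apbw_im0 : apbw_im 0. Proof. by exists 0; apply: apbw0. Qed.
Lemma apbw_imD h h' : apbw_im h -> apbw_im h' -> apbw_im (h + h').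
Proof.
move=> [F <-] [G <-]; exists (F + G).
by have := apbw_linear 1 F G; rewrite !scale1r.
Qed.
Lemma apbw_imZ c h : apbw_im h -> apbw_im (c *: h).
Proof.
move=> [F <-]; exists (c *: F).
by have := apbw_linear c F 0; rewrite apbw0 !addr0.
Qed.
Lemma apbw_im_sum I (r : seq I) (Q : pred I) (F : I -> H) :
  (forall i, Q i -> apbw_im (F i)) -> apbw_im (\sum_(i <- r | Q i) F i).
Proof. by move=> hF; elim/big_ind: _ => //; [apply: apbw_im0 | apply: apbw_imD]. Qed.
Lemma apbw_im_mono g a b c d : apbw_im (X ^+ c * Y ^+ d * w g * (x ^+ a * y ^+ b)).
Proof.
exists (single g 'X_[mn4 a b c d]).
by rewrite apbw_single mlinX /mono !mn4E.
Qed.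
Lemma apbw_im_left (a : H) :
  (forall g m1 m2 m3 m4,
    apbw_im (a * (X ^+ m3 * Y ^+ m4 * w g * (x ^+ m1 * y ^+ m2)))) ->
  forall h, apbw_im h -> apbw_im (a * h).
Proof.
move=> ha h [F <-]; rewrite mulr_sumr; apply: apbw_im_sum => g _.
rewrite /mlin mulr_sumr; apply: apbw_im_sum => m _.
by rewrite -scalerAr; apply: apbw_imZ; apply: ha.
Qed.
Lemma apbw_im_X h : apbw_im h -> apbw_im (X * h).
Proof.
move: h; apply: apbw_im_left => g a b c d.
by rewrite !mulrA -exprS -[_ * x ^+ a * _]mulrA; apply: apbw_im_mono.
Qed.
Lemma XYn n : Y * X ^+ n = X ^+ n * Y.
Proof. by apply: commrX; rewrite /GRing.comm XY. Qed.
Lemma yxn n : y * x ^+ n = x ^+ n * y.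
Proof. by apply: commrX; rewrite /GRing.comm xy. Qed.
Lemma apbw_im_Y h : apbw_im h -> apbw_im (Y * h).
Proof.
move: h; apply: apbw_im_left => g a b c d.
rewrite !mulrA XYn -[X ^+ c * Y * _]mulrA -exprS.
by rewrite -[_ * x ^+ a * _]mulrA; apply: apbw_im_mono.
Qed.
Lemma apbw_im_w g h : apbw_im h -> apbw_im (w g * h).
Proof.
move: h; apply: apbw_im_left => h a b c d.
elim: c => [|c IHc]; last first.
  rewrite exprS !mulrA wX -!mulrA mulrDl -!scalerAl.
  move: IHc; rewrite -!mulrA => IHc.
  by apply: apbw_imD; apply: apbw_imZ; [apply: apbw_im_Y | apply: apbw_im_X].
elim: d => [|d IHd]; last first.
  rewrite expr0 mul1r in IHd; rewrite expr0 mul1r exprS !mulrA wY -!mulrA mulrDl -!scalerAl.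
  move: IHd; rewrite -!mulrA => IHd.
  by apply: apbw_imD; apply: apbw_imZ; [apply: apbw_im_Y | apply: apbw_im_X].
rewrite !expr0 !mul1r mulrA -wM.
by have := apbw_im_mono (g * h)%g a b 0 0; rewrite !expr0 !mul1r.
Qed.
Lemma apbw_im_kap c h : apbw_im h -> apbw_im (kap c * h).
Proof.
move=> hh; rewrite mulr_suml; apply: apbw_im_sum => j _.
by rewrite -scalerAl; apply: apbw_imZ; apply: apbw_im_w.
Qed.

Lemma xw g : x * w g = w g *
   ((W_mx g^-1%g 0 0)%:k *: x + (W_mx g^-1%g 1 0)%:k *: y).
Proof.
apply: esym; apply: (@conj_inv _ (w g^-1%g)); last exact: wx.
  by rewrite -wM mulVg w1.
by rewrite -wM mulgV w1.
Qed.
Lemma yw g : y * w g = w g *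
   ((W_mx g^-1%g 0 1)%:k *: x + (W_mx g^-1%g 1 1)%:k *: y).
Proof.
apply: esym; apply: (@conj_inv _ (w g^-1%g)); last exact: wy.
  by rewrite -wM mulVg w1.
by rewrite -wM mulgV w1.
Qed.

(** Treats v = x and v = y together: v is pushed past X and Y, each step leaving a [kap] term with
    one letter less, then past w g, where it turns into a combination of x and y. *)
Lemma apbw_im_base (v : H) (c d : nat -> C) (p q : W -> C) :
  v * X = X * v + kap c -> v * Y = Y * v + kap d ->
  (forall g, v * w g = w g * ((p g)%:k *: x + (q g)%:k *: y)) ->
  forall h, apbw_im h -> apbw_im (v * h).
Proof.
move=> vX vY vw; apply: apbw_im_left => g a b m n.
elim: m => [|m IHm]; last first.
  rewrite exprS !mulrA vX -!mulrA mulrDl -!mulrA.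
  move: IHm; rewrite -!mulrA => IHm.
  apply: apbw_imD; first by apply: apbw_im_X.
  by apply: apbw_im_kap; rewrite !mulrA -[_ * x ^+ a * _]mulrA; apply: apbw_im_mono.
elim: n => [|n IHn]; last first.
  rewrite expr0 mul1r in IHn; rewrite expr0 mul1r exprS !mulrA vY -!mulrA mulrDl -!mulrA.
  move: IHn; rewrite -!mulrA => IHn.
  apply: apbw_imD; first by apply: apbw_im_Y.
  apply: apbw_im_kap; have := apbw_im_mono g a b 0 n.
  by rewrite expr0 mul1r -!mulrA.
rewrite !expr0 !mul1r mulrA vw -mulrA mulrDl mulrDr -!scalerAl -!scalerAr.
apply: apbw_imD; apply: apbw_imZ.
  by have := apbw_im_mono g a.+1 b 0 0; rewrite !expr0 !mul1r exprS -!mulrA.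
rewrite [y * _]mulrA yxn -mulrA -exprS.
by have := apbw_im_mono g a b.+1 0 0; rewrite !expr0 !mul1r.
Qed.

Lemma kapN c : - kap c = kap (fun j => - c j).
Proof.
rewrite /kap -sumrN; apply: eq_bigr => j _.
by rewrite -scaleNr -mulrN -mpolyCN.
Qed.
Lemma apbw_im_x h : apbw_im h -> apbw_im (x * h).
Proof.
have h1 : x * X = X * x + kap (fun=> -1) by rewrite xX kapN.
exact: (apbw_im_base (p := fun g => W_mx g^-1%g 0 0)
  (q := fun g => W_mx g^-1%g 1 0) h1 xY xw).
Qed.
Lemma apbw_im_y h : apbw_im h -> apbw_im (y * h).
Proof.
have h1 : y * Y = Y * y + kap (fun=> -1) by rewrite yY kapN.
exact: (apbw_im_base (p := fun g => W_mx g^-1%g 0 1)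
  (q := fun g => W_mx g^-1%g 1 1) yX h1 yw).
Qed.

Hypothesis gen_ind : forall (Q : H -> Prop),
  Q 1 -> (forall h h', Q h -> Q h' -> Q (h + h')) -> (forall c h, Q h -> Q (c *: h)) ->
  (forall h, Q h -> Q (x * h)) -> (forall h, Q h -> Q (y * h)) ->
  (forall h, Q h -> Q (X * h)) -> (forall h, Q h -> Q (Y * h)) ->
  (forall g h, Q h -> Q (w g * h)) -> forall h, Q h.

(** The image of [apbw] contains 1 and is stable under left multiplication by all generators. *)
Lemma apbw_surj h : exists F, apbw F = h.
Proof.
move: h; apply: gen_ind.
- by have := apbw_im_mono 1%g 0 0 0 0; rewrite !expr0 w1 !mul1r.
- exact: apbw_imD.
- exact: apbw_imZ.
- exact: apbw_im_x.
- exact: apbw_im_y.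
- exact: apbw_im_X.
- exact: apbw_im_Y.
- exact: apbw_im_w.
Qed.

Lemma s_w j (m := s_ hz j) : (w m * x = (zeta ^+ (3 * j))%:k *: y * w m) *
  (w m * y = (zeta ^+ j)%:k *: x * w m) *
  (w m * Y = (zeta ^+ (3 * j))%:k *: X * w m) *
  (w m * X = (zeta ^+ j)%:k *: Y * w m).
Proof.
rewrite wx wy wX wY s_00 s_01 s_10 s_11 mpolyC0 !scale0r.
by rewrite !add0r !addr0.
Qed.

Lemma zexp j : zeta ^+ (3 * j) * zeta ^+ j = 1.
Proof. by rewrite -exprD -mulSnr exprM zeta4 // expr1n. Qed.

Lemma eq_kap c d : (forall j, c j = d j) -> kap c = kap d.
Proof. by move=> e; apply: eq_bigr => j _; rewrite e. Qed.
Lemma kapZ (a : C) c : a%:k *: kap c = kap (fun j => a * c j).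
Proof.
rewrite scaler_sumr; apply: eq_bigr => j _; rewrite scalerA mpolyCM.
by rewrite mulrCA.
Qed.
Lemma kap_swap (p q : H) (e c : nat -> C) :
  (forall j, w (s_ hz j) * q = (e j)%:k *: p * w (s_ hz j)) ->
  kap c * q = p * kap (fun j => c j * e j).
Proof.
move=> h; rewrite mulr_suml mulr_sumr; apply: eq_bigr => j _.
by rewrite -scalerAl h -!scalerAl scalerA -scalerAr -mulrA -mpolyCM.
Qed.

Section CentralElements.
Variables (al be : C).
Definition cu : H := al%:k *: x + be%:k *: Y.
Definition cv : H := al%:k *: y + be%:k *: X.

(** The cross terms are al be ([x, X] + [Y, y]), and these two commutators are opposite. *)
Lemma cuv : cu * cv = cv * cu.
Proof.
rewrite /cu /cv !(mulrDl, mulrDr) -!(scalerAl, scalerAr) !scalerA.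
rewrite xX yY xy XY ![be%:k * al%:k]mulrC !scalerBr.
rewrite -!addrA; congr (_ + _); rewrite addrCA [RHS]addrCA; congr (_ + _).
by rewrite addrCA.
Qed.

Lemma s_cu j : w (s_ hz j) * cu = (zeta ^+ (3 * j))%:k *: cv * w (s_ hz j).
Proof.
rewrite mulrDr -!scalerAr !s_w -!scalerAl [in RHS]mulrDl -!scalerAl.
by rewrite !scalerDr !scalerA ![_ * (zeta ^+ _)%:k]mulrC.
Qed.
Lemma s_cv j : w (s_ hz j) * cv = (zeta ^+ j)%:k *: cu * w (s_ hz j).
Proof.
rewrite mulrDr -!scalerAr !s_w -!scalerAl [in RHS]mulrDl -!scalerAl.
by rewrite !scalerDr !scalerA ![_ * (zeta ^+ _)%:k]mulrC.
Qed.

Lemma cu_kap c : cu * kap c = kap (fun j => zeta ^+ (3 * j) * c j) * cv.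
Proof.
rewrite (kap_swap _ s_cv); congr (_ * _); apply: eq_kap => j.
by rewrite mulrAC zexp mul1r.
Qed.
Lemma cv_kap c : cv * kap c = kap (fun j => zeta ^+ j * c j) * cu.
Proof.
rewrite (kap_swap _ s_cu); congr (_ * _); apply: eq_kap => j.
by rewrite mulrAC [_ * zeta ^+ (3 * j)]mulrC zexp mul1r.
Qed.

Definition comm2 h := (cu * cv) * h = h * (cu * cv) /\
  (cu ^+ 4 + cv ^+ 4) * h = h * (cu ^+ 4 + cv ^+ 4).

(** With e n = kap (zeta^(3jn) c_j), moving u past e n raises n and moving v lowers it. Since
    zeta^(9j) = zeta^j, the two commutators are e 0 and e 3, as [pow4_comm] requires. For u v the
    two corrections kap c * v cancel directly. *)
Lemma central_core h c :
  cu * h = h * cu - kap c -> cv * h = h * cv + kap (fun j => zeta ^+ j * c j) ->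
  comm2 h.
Proof.
move=> uh vh; pose e n := kap (fun j => zeta ^+ (3 * j) ^+ n * c j).
have ue n : cu * e n = e n.+1 * cv.
  by rewrite cu_kap; congr (_ * _); apply: eq_kap => j; rewrite exprS mulrA.
have ve n : cv * e n.+1 = e n * cu.
  rewrite cv_kap; congr (_ * _); apply: eq_kap => j.
  by rewrite exprS !mulrA [zeta ^+ j * _]mulrC zexp mul1r.
have e0 : kap c = e 0%N by apply: eq_kap => j; rewrite expr0 mul1r.
have e3 : kap (fun j => zeta ^+ j * c j) = e 3%N.
  apply: eq_kap => j; congr (_ * _); rewrite -exprM.
  rewrite (_ : 3 * j * 3 = j + 4 * (2 * j))%N; last lia.
  by rewrite exprD exprM zeta4 // expr1n mulr1.
split; last by apply: (@pow4_comm _ _ _ _ (e 0%N) (e 1%N) (e 2%N) (e 3%N)) => //;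
  rewrite -?e0 -?e3 ?cuv.
have ek : kap (fun j => zeta ^+ (3 * j) * (zeta ^+ j * c j)) = kap c.
  by apply: eq_kap => j; rewrite mulrA zexp mul1r.
by rewrite -mulrA vh mulrDr mulrA uh cu_kap ek mulrBl subrK mulrA.
Qed.

Lemma comm2M (a h : H) : comm2 a -> comm2 h -> comm2 (a * h).
Proof.
have comm_mul z : z * a = a * z -> z * h = h * z -> z * (a * h) = (a * h) * z.
  by move=> ea eh; rewrite mulrA ea -mulrA eh mulrA.
by move=> [a1 a2] [h1 h2]; split; apply: comm_mul.
Qed.

Lemma comm2_core (c d : nat -> C) h : (forall j, d j = zeta ^+ j * c j) ->
  cu * h = h * cu - kap c -> cv * h = h * cv + kap d -> comm2 h.
Proof. by move=> e uh vh; apply: (central_core uh); rewrite vh (eq_kap e). Qed.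

Lemma kap1Z a : a%:k *: kap (fun=> 1) = kap (fun=> a).
Proof. by rewrite kapZ; apply: eq_kap => j; rewrite mulr1. Qed.

Lemma comm2_x : comm2 x.
Proof.
apply: (@comm2_core (fun j => be * zeta ^+ (3 * j)) (fun=> be)) => [j||].
- by rewrite mulrCA [_ * zeta ^+ (3 * j)]mulrC zexp mulr1.
- rewrite mulrDl mulrDr -!scalerAl -!scalerAr xY -kapZ scalerDr.
  by rewrite addrA addrK.
- rewrite mulrDl mulrDr -!scalerAl -!scalerAr xX -xy -(kap1Z be) scalerBr.
  by rewrite -addrA subrK.
Qed.
Lemma comm2_y : comm2 y.
Proof.
apply: (@comm2_core (fun=> - be) (fun j => - be * zeta ^+ j)) => [j||].
- by rewrite mulrC.
- rewrite mulrDl mulrDr -!scalerAl -!scalerAr yY xy scalerBr -kapN -(kap1Z be) opprK.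
  by rewrite -addrA subrK.
- rewrite mulrDl mulrDr -!scalerAl -!scalerAr yX -kapZ scalerDr mpolyCN scaleNr.
  by rewrite addrA addrK.
Qed.
Lemma comm2_X : comm2 X.
Proof.
apply: (@comm2_core (fun=> al) (fun j => al * zeta ^+ j)) => [j||].
- by rewrite mulrC.
- rewrite mulrDl mulrDr -!scalerAl -!scalerAr xX XY scalerBr -(kap1Z al).
  by rewrite addrAC.
- rewrite mulrDl mulrDr -!scalerAl -!scalerAr yX -kapZ scalerDr.
  by rewrite addrAC.
Qed.
Lemma comm2_Y : comm2 Y.
Proof.
apply: (@comm2_core (fun j => - al * zeta ^+ (3 * j)) (fun=> - al)) => [j||].
- by rewrite mulrCA [_ * zeta ^+ (3 * j)]mulrC zexp mulr1.
- rewrite mulrDl mulrDr -!scalerAl -!scalerAr xY -kapZ scalerDr mpolyCN scaleNr opprK.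
  by rewrite addrAC.
- rewrite mulrDl mulrDr -!scalerAl -!scalerAr yY -XY scalerBr -kapN -(kap1Z al).
  by rewrite addrAC.
Qed.

Lemma W_cases (g : W) : exists a b : C, a * b = 1 /\
  ((W_mx g 0 0 = a /\ W_mx g 1 0 = 0 /\ W_mx g 0 1 = 0 /\ W_mx g 1 1 = b) \/
   (W_mx g 0 0 = 0 /\ W_mx g 1 0 = b /\ W_mx g 0 1 = a /\ W_mx g 1 1 = 0)) /\
  a ^+ 4 = 1.
Proof.
have [a a4 e] := in_WP hz (W_mxP g); exists a, a^-1.
have a0 : a != 0.
  by apply: contra_eq_neq a4 => ->; rewrite expr0n eq_sym oner_neq0.
by case: e => ->; rewrite !mxE /= divff //; split=> //; split=> //; [left|right].
Qed.

Lemma w_cu g : w g * cu =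
  ((W_mx g 0 0)%:k *: cu + (W_mx g 1 0)%:k *: cv) * w g.
Proof.
rewrite mulrDr -!scalerAr wx wY /cu /cv !mulrDl -!scalerAl !mulrDl -!scalerAl.
rewrite !scalerDr !scalerA ![al%:k * _]mulrC ![be%:k * _]mulrC.
by rewrite addrACA.
Qed.
Lemma w_cv g : w g * cv =
  ((W_mx g 0 1)%:k *: cu + (W_mx g 1 1)%:k *: cv) * w g.
Proof.
rewrite mulrDr -!scalerAr wy wX /cu /cv !mulrDl -!scalerAl !mulrDl -!scalerAl.
rewrite !scalerDr !scalerA ![al%:k * _]mulrC ![be%:k * _]mulrC.
by rewrite addrACA.
Qed.

Lemma comm2_w g : comm2 (w g).
Proof.
have pw (a : k) (p q g' : H) : g' * p = a *: q * g' ->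
    g' * p ^+ 4 = a ^+ 4 *: q ^+ 4 * g'.
  move=> e; rewrite -exprZn; elim: 4%N => [|n IH]; first by rewrite !expr0 mul1r mulr1.
  by rewrite !exprS mulrA e -mulrA IH mulrA.
have [a [b [ab [e a4]]]] := W_cases g.
have b4 : b ^+ 4 = 1 by rewrite -[LHS]mul1r -{1}a4 -exprMn ab expr1n.
have abk : a%:k * b%:k = 1 by rewrite -mpolyCM ab.
have a4k : a%:k ^+ 4 = 1 by rewrite -rmorphXn a4.
have b4k : b%:k ^+ 4 = 1 by rewrite -rmorphXn b4.
have hq (p q p' q' g' : H) (c d : k) : c * d = 1 -> g' * p = c *: p' * g' ->
    g' * q = d *: q' * g' -> g' * (p * q) = p' * q' * g'.
  move=> cd ep eq; rewrite mulrA ep -[_ * g' * q]mulrA eq mulrA -scalerAl -scalerAr.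
  by rewrite scalerA cd scale1r.
have := w_cv g; have := w_cu g; have uv := cuv; rewrite /comm2.
move: cu cv uv => u v uv.
case: e => [[-> [-> [-> ->]]]|[-> [-> [-> ->]]]];
  rewrite mpolyC0 !scale0r ?addr0 ?add0r => eu ev; split.
- by apply/esym; apply: hq abk eu ev.
- by rewrite mulrDr (pw _ _ _ _ eu) (pw _ _ _ _ ev) a4k b4k !scale1r mulrDl.
- apply/esym; rewrite {1}uv; apply: hq abk ev eu.
- rewrite mulrDr (pw _ _ _ _ eu) (pw _ _ _ _ ev) a4k b4k !scale1r mulrDl.
  by rewrite addrC.
Qed.

Lemma comm2_all h : comm2 h.
Proof.
move: h; apply: gen_ind.
- by rewrite /comm2 !mulr1 !mul1r.
- by move=> h h' [h1 h2] [h1' h2']; split; rewrite [LHS]mulrDr [RHS]mulrDl ?h1 ?h2 ?h1' ?h2'.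
- by move=> c h [h1 h2]; split; rewrite -scalerAl -scalerAr ?h1 ?h2.
- by move=> h; apply/comm2M/comm2_x.
- by move=> h; apply/comm2M/comm2_y.
- by move=> h; apply/comm2M/comm2_X.
- by move=> h; apply/comm2M/comm2_Y.
- by move=> g h; apply/comm2M/comm2_w.
Qed.

End CentralElements.

Hypothesis apbw_inj : injective apbw.
Definition ainv (h : H) : {ffun W -> P} := xget 0 (fun F => apbw F = h).
Definition atr (h : H) : P := ainv h 1%g.

Lemma apbw_ainv h : apbw (ainv h) = h.
Proof. by rewrite /ainv; case: xgetP => [F _ //|nF]; have [F /nF] := apbw_surj h. Qed.
Lemma ainvK F : ainv (apbw F) = F.
Proof. by apply: apbw_inj; rewrite apbw_ainv. Qed.
Lemma ainv_linear : linear ainv.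
Proof.
move=> c h h'; apply: apbw_inj; rewrite apbw_linear !apbw_ainv //.
Qed.
Lemma atr_linear : linear atr.
Proof. by move=> c h h'; rewrite /atr ainv_linear !ffunE. Qed.
Lemma atrD h h' : atr (h + h') = atr h + atr h'.
Proof. by have := atr_linear 1 h h'; rewrite !scale1r. Qed.
Lemma atr0 : atr 0 = 0.
Proof. by apply: (addrI (atr 0)); rewrite -atrD !addr0. Qed.
Lemma atrZ c h : atr (c *: h) = c *: atr h.
Proof. by have := atr_linear c h 0; rewrite atr0 !addr0. Qed.
Lemma atrN h : atr (- h) = - atr h.
Proof. by rewrite -scaleN1r atrZ scaleN1r. Qed.
Lemma atrB h h' : atr (h - h') = atr h - atr h'.
Proof. by rewrite atrD atrN. Qed.
Lemma atr_sum I (r : seq I) (Q : pred I) F :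
  atr (\sum_(i <- r | Q i) F i) = \sum_(i <- r | Q i) atr (F i).
Proof. exact: (big_morph _ atrD atr0). Qed.
Lemma atr_mono g m : atr (mono g m) = (g == 1%g)%:R *: 'X_[m].
Proof.
rewrite -(mlinX (mono g)) -apbw_single /atr ainvK ffunE eq_sym.
by case: eqP => _; rewrite ?scale1r ?scale0r.
Qed.

(** In the normal order X, Y stand on the left and x, y on the right. Hence Trunc is linear over
    C[V] acting on the left and over C[V^*] acting on the right, and such a rule need only be
    verified on monomials. *)
Lemma atr_left (a : H) (q : P) :
  (forall g m, atr (a * mono g m) = q * atr (mono g m)) ->
  forall h, atr (a * h) = q * atr h.
Proof.
move=> ha h; rewrite -[h]apbw_ainv /apbw mulr_sumr !atr_sum mulr_sumr.
apply: eq_bigr => g _; rewrite /mlin mulr_sumr !atr_sum mulr_sumr.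
by apply: eq_bigr => m _; rewrite -scalerAr !atrZ ha scalerAr.
Qed.
Lemma atr_right (a : H) (q : P) :
  (forall g m, atr (mono g m * a) = atr (mono g m) * q) ->
  forall h, atr (h * a) = atr h * q.
Proof.
move=> ha h; rewrite -[h]apbw_ainv /apbw mulr_suml !atr_sum mulr_suml.
apply: eq_bigr => g _; rewrite /mlin mulr_suml !atr_sum mulr_suml.
by apply: eq_bigr => m _; rewrite -scalerAl !atrZ ha scalerAl.
Qed.

Local Notation Px := ('X_(inord 0) : P).
Local Notation Py := ('X_(inord 1) : P).
Local Notation PX := ('X_(inord 2) : P).
Local Notation PY := ('X_(inord 3) : P).

Lemma mn4U a b c d (i : 'I_4) : (U_(i) + mn4 a b c d)%MM =
  mn4 ((i == inord 0) + a) ((i == inord 1) + b) ((i == inord 2) + c)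
      ((i == inord 3) + d).
Proof.
by apply/mnmP => j; case: (I4E j) => ->; rewrite mnmDE !mn4E mnm1E.
Qed.

Lemma inord4_eq a b : (a < 4)%N -> (b < 4)%N ->
  (inord a == inord b :> 'I_4) = (a == b).
Proof. by move=> ha hb; rewrite -val_eqE /= !inordK. Qed.

Lemma monoE g a b c d :
  mono g (mn4 a b c d) = X ^+ c * Y ^+ d * w g * (x ^+ a * y ^+ b).
Proof. by rewrite /mono !mn4E. Qed.

Lemma atr_shift (i : 'I_4) (g : W) (m : 'X_{1..4}) :
  (g == 1%g)%:R *: 'X_[(U_(i) + m)%MM] = 'X_i * ((g == 1%g)%:R *: 'X_[m]) :> P.
Proof. by rewrite -scalerAr mpolyXD. Qed.

Lemma atrX h : atr (X * h) = PX * atr h.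
Proof.
move: h; apply: atr_left => g m; rewrite (mn4_eta m); move: (m _) => a.
move: (m _) (m _) (m _) => b c d; rewrite [atr (mono _ _)]atr_mono -atr_shift mn4U.
rewrite !inord4_eq // !add0n add1n -atr_mono; congr atr.
by rewrite !monoE exprS !mulrA.
Qed.
Lemma atrY h : atr (Y * h) = PY * atr h.
Proof.
move: h; apply: atr_left => g m; rewrite (mn4_eta m); move: (m _) => a.
move: (m _) (m _) (m _) => b c d; rewrite [atr (mono _ _)]atr_mono -atr_shift mn4U.
rewrite !inord4_eq // !add0n add1n -atr_mono; congr atr.
by rewrite !monoE exprS !mulrA XYn.
Qed.
Lemma atrx h : atr (h * x) = atr h * Px.
Proof.
move: h; apply: atr_right => g m; rewrite (mn4_eta m); move: (m _) => a.
move: (m _) (m _) (m _) => b c d; rewrite [atr (mono _ _)]atr_mono mulrC -atr_shift mn4U.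
rewrite !inord4_eq // !add0n add1n -atr_mono; congr atr.
rewrite !monoE exprSr -!mulrA; congr (_ * (_ * (_ * (_ * _)))).
by apply/esym; apply: commrX; rewrite /GRing.comm xy.
Qed.
Lemma atry h : atr (h * y) = atr h * Py.
Proof.
move: h; apply: atr_right => g m; rewrite (mn4_eta m); move: (m _) => a.
move: (m _) (m _) (m _) => b c d; rewrite [atr (mono _ _)]atr_mono mulrC -atr_shift mn4U.
rewrite !inord4_eq // !add0n add1n -atr_mono; congr atr.
by rewrite !monoE exprSr -!mulrA.
Qed.
Lemma atrw g : atr (w g) = (g == 1%g)%:R.
Proof.
have <- : mono g 0%MM = w g by rewrite /mono !mnm0E !expr0 !mul1r mulr1.
by rewrite atr_mono mpolyX0; case: eqP; rewrite ?scale1r ?scale0r.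
Qed.
Lemma atr1 : atr 1 = 1. Proof. by rewrite -w1 atrw eqxx. Qed.

Lemma s_neq1 j : (s_ hz j == 1%g) = false.
Proof.
apply/negP => /eqP e; have : W_mx (s_ hz j) 0 0 = 1 by rewrite e mxE eqxx.
by rewrite s_00 => /esym/eqP; rewrite oner_eq0.
Qed.
Lemma ss_eq1 j l : (j < 4)%N -> (l < 4)%N ->
  ((s_ hz j * s_ hz l)%g == 1%g) = (j == l).
Proof.
move=> hj hl; apply/eqP/eqP => [e|->]; last exact: s_sq.
have : W_mx (s_ hz j * s_ hz l)%g 0 0 = 1 by rewrite e mxE eqxx.
rewrite W_mxME s_00 mul0r add0r s_01 s_10 -exprD => /eqP.
rewrite -(prim_order_dvd hz); lia.
Qed.

Lemma atr_kap c : atr (kap c) = 0.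
Proof.
by rewrite atr_sum big1 // => j _; rewrite atrZ atrw s_neq1 scaler0.
Qed.
(** A product s_j s_l is 1 exactly when j = l, so only the diagonal terms of the double sum
    survive. *)
Lemma atr_kap2 c d : atr (kap c * kap d) =
  (parA K ^+ 2 * (c 0%N * d 0%N + c 2%N * d 2%N)%:k +
   parB K ^+ 2 * (c 1%N * d 1%N + c 3%N * d 3%N)%:k)%:MP.
Proof.
transitivity ((\sum_(j < 4) parC K j ^+ 2 * (c j * d j)%:k)%:MP : P).
  rewrite raddf_sum /kap mulr_suml atr_sum; apply: eq_bigr => j _.
  rewrite mulr_sumr atr_sum (bigD1 j) //= big1 => [|l hl].
    rewrite addr0 -scalerAl -scalerAr scalerA atrZ -wM atrw s_sq eqxx.
    rewrite -mul_mpolyC mulr1; congr (_%:MP).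
    by rewrite [(c j * d j)%:k]mpolyCM expr2 mulrACA.
  rewrite -scalerAl -scalerAr scalerA atrZ -wM atrw ss_eq1 //.
  by rewrite eq_sym (inj_eq val_inj) (negbTE hl) scaler0.
congr (_%:MP); rewrite !big_ord_recl big_ord0 /= /bump /parC addr0.
by rewrite !mpolyCD !mulrDr !addrA [LHS](ACl (1*3*2*4)).
Qed.

Lemma kap_y c : kap c * y = x * kap (fun j => c j * zeta ^+ j).
Proof. by apply: kap_swap => j; rewrite s_w. Qed.
Lemma kap_x c : kap c * x = y * kap (fun j => c j * zeta ^+ (3 * j)).
Proof. by apply: kap_swap => j; rewrite s_w. Qed.
Lemma kap_X c : kap c * X = Y * kap (fun j => c j * zeta ^+ j).
Proof. by apply: kap_swap => j; rewrite s_w. Qed.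
Lemma kap_Y c : kap c * Y = X * kap (fun j => c j * zeta ^+ (3 * j)).
Proof. by apply: kap_swap => j; rewrite s_w. Qed.
Lemma x_kap c : x * kap c = kap (fun j => c j * zeta ^+ (3 * j)) * y.
Proof.
by rewrite kap_y; congr (_ * _); apply: eq_kap => j; rewrite -mulrA zexp mulr1.
Qed.
Lemma y_kap c : y * kap c = kap (fun j => c j * zeta ^+ j) * x.
Proof.
rewrite kap_x; congr (_ * _); apply: eq_kap => j.
by rewrite -mulrA [zeta ^+ j * _]mulrC zexp mulr1.
Qed.

Definition dAB : k := parA K ^+ 2 - parB K ^+ 2.

Lemma atr_kap2_sq c d : c 0%N * d 0%N = 1 -> c 1%N * d 1%N = -1 ->
  c 2%N * d 2%N = 1 -> c 3%N * d 3%N = -1 ->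
  atr (kap c * kap d) = (2%:R * dAB)%:MP.
Proof.
move=> h0 h1 h2 h3; rewrite atr_kap2 h0 h1 h2 h3; congr (_%:MP).
by rewrite !mpolyCD mpolyCN mpolyC1 /dAB; ring.
Qed.

Lemma zetaE n : zeta ^+ n = zeta ^+ (n %% 4).
Proof. by rewrite (prim_expr_mod hz). Qed.
Lemma zetaE2 : zeta ^+ 2 = -1. Proof. by rewrite expr2 zeta2. Qed.

(** [trace_pow4] with p = x and q = Y. The correction D is the sum of C_j^2 zeta^(6j), whose signs
    alternate between the two classes of reflections: 2 (A^2 - B^2). *)
Lemma atr_u4 (al be : C) : atr ((al%:k *: x + be%:k *: Y) ^+ 4) =
  (al%:k *: Px + be%:k *: PY) ^+ 4 +
  (al%:k ^+ 2 * be%:k ^+ 2) *: (2%:R * dAB)%:MP.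
Proof.
apply: (@trace_pow4 _ _ _ _ x Y (kap (fun j => zeta ^+ (3 * j)))).
- exact: atr_linear.
- exact: atr1.
- exact: xY.
- exact: atrx.
- exact: atrY.
- exact: atr_kap.
- by rewrite x_kap atry atr_kap mul0r.
- by rewrite kap_Y atrX atr_kap mulr0.
- by rewrite -mulrA x_kap mulrA x_kap !atry atr_kap !mul0r.
- by rewrite kap_Y -mulrA kap_Y !atrX atr_kap !mulr0.
- apply: atr_kap2_sq; rewrite -?exprD zetaE ?expr0 //= ?zetaE2 //.
- rewrite -mulrA kap_Y mulrA xX mulrBl atrB -mulrA atrX x_kap atry atr_kap.
  rewrite mul0r mulr0 sub0r; congr (- _).
  by apply: atr_kap2_sq; rewrite ?mul1r -?exprD zetaE ?expr0 //= ?zetaE2.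
Qed.

Lemma atr_v4 (al be : C) : atr ((al%:k *: y + be%:k *: X) ^+ 4) =
  (al%:k *: Py + be%:k *: PX) ^+ 4 +
  (al%:k ^+ 2 * be%:k ^+ 2) *: (2%:R * dAB)%:MP.
Proof.
apply: (@trace_pow4 _ _ _ _ y X (kap (fun j => zeta ^+ j))).
- exact: atr_linear.
- exact: atr1.
- exact: yX.
- exact: atry.
- exact: atrX.
- exact: atr_kap.
- by rewrite y_kap atrx atr_kap mul0r.
- by rewrite kap_X atrY atr_kap mulr0.
- by rewrite -mulrA y_kap mulrA y_kap !atrx atr_kap !mul0r.
- by rewrite kap_X -mulrA kap_X !atrY atr_kap !mulr0.
- by apply: atr_kap2_sq; rewrite -?exprD zetaE ?expr0 //= ?zetaE2.
- rewrite -mulrA kap_X mulrA yY mulrBl atrB -mulrA atrY y_kap atrx atr_kap.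
  rewrite mul0r mulr0 sub0r; congr (- _).
  by apply: atr_kap2_sq; rewrite ?mul1r -?exprD zetaE ?expr0 //= ?zetaE2.
Qed.

Lemma atr_eu : atr (x * X + Y * y) = Px * PX + Py * PY.
Proof.
rewrite xX atrD atrB atr_kap subr0 atrX atrY.
rewrite -[x]mul1r atrx -[y]mul1r atry atr1 !mul1r.
by rewrite [PX * _]mulrC [PY * _]mulrC.
Qed.
End AbstractCherednik.

Lemma free_alg_ind (k : comNzRingType) (I : choiceType) (Q : free_alg k I -> Prop) :
  Q 1 -> (forall s t, Q s -> Q t -> Q (s + t)) -> (forall c t, Q t -> Q (c *: t)) ->
  (forall i t, Q t -> Q (fgen k i * t)) -> forall t, Q t.
Proof.
move=> Q1 QD QZ QM t; rewrite [t]monalgE; apply: big_ind => //.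
  by have := QZ 0 _ Q1; rewrite scale0r.
move=> m _; set c := monalg.mcoeff m t.
have -> : mkmalgU m c = c *: mkmalgU m (1 : k) :> free_alg k I.
  by apply/malgP => m'; rewrite monalg.mcoeffZ !mcoeffU mulrnAr mulr1.
apply: QZ; case: m {c} => s; elim: s => [|i s IHs].
  by move: Q1; congr Q; rewrite -fmoneE.
move: (QM i _ IHs); congr Q.
by rewrite /GRing.mul /= fgmulUU mulr1; congr mkmalgU; apply: val_inj; rewrite /= fmM fmU.
Qed.

(** * The abstract relations in the Cherednik algebra itself *)

Section Concrete.
Variables (K : realType) (zeta : K[i]) (hz : 4.-primitive_root zeta).
Local Notation C := K[i].
Local Notation W := (dihedral hz).
Local Notation k := {mpoly C[2]}.
Local Notation H := (cherednik hz).
Local Notation pi := (@H_pi K zeta hz).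
Local Notation "c %:k" := (c%:MP_[2] : k) (at level 2).

Lemma H_piM s t : pi (s * t) = pi s * pi t.
Proof. by rewrite /H_pi -(aq_piM (@cherednik_proper K zeta hz)). Qed.
Lemma H_piD s t : pi (s + t) = pi s + pi t.
Proof. exact: aq_piD. Qed.
Lemma H_pi1 : pi 1 = 1.
Proof. by []. Qed.
Lemma H_piZ c s : pi (c *: s) = c *: pi s.
Proof. by rewrite /H_pi -(aq_piZ (@cherednik_proper K zeta hz)). Qed.
Lemma H_piB s t : pi (s - t) = pi s - pi t.
Proof. by rewrite -scaleN1r H_piD H_piZ scaleN1r. Qed.
Lemma H_pi_rel s : cherednik_rel s -> pi s = 0.
Proof.
move=> h; rewrite -(aq_pi0 (@cherednik_proper K zeta hz)); apply/aq_piP.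
by rewrite subr0; apply: GenIdeal_gen.
Qed.
Lemma H_pi_surj h : exists s, pi s = h.
Proof. by exists (aq_repr h); apply: aq_reprK. Qed.

Lemma H_w1 : H_w (1%g : W) = 1.
Proof. exact: H_pi1. Qed.
Lemma H_wM (g h : W) : H_w (g * h)%g = H_w g * H_w h.
Proof. by rewrite /H_w /TW_grp skew_WM H_piM. Qed.

Local Notation emb := (@mpolyC 2 C : {rmorphism C -> k}).

Lemma vecT_lin (c : C) (u v : 'cV[C]_2) :
  vecT emb (c *: u + v) = c%:k *: vecT emb u + vecT emb v.
Proof.
rewrite !vecT.unlock scaler_sumr -big_split; apply: eq_bigr => j _.
by rewrite !mxE rmorphD rmorphM scalerDl scalerA.
Qed.
Lemma formT_lin (c : C) (u v : 'rV[C]_2) :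
  formT emb (c *: u + v) = c%:k *: formT emb u + formT emb v.
Proof.
rewrite !formT.unlock scaler_sumr -big_split; apply: eq_bigr => j _.
by rewrite !mxE rmorphD rmorphM scalerDl scalerA.
Qed.

Definition H_vec (v : 'cV[C]_2) : H := pi (TW_vec hz v).
Definition H_form (v : 'rV[C]_2) : H := pi (TW_form hz v).
Lemma H_vec_lin c u v : H_vec (c *: u + v) = c%:k *: H_vec u + H_vec v.
Proof.
by rewrite /H_vec /TW_vec vecT_lin skew_T_linear H_piD H_piZ.
Qed.
Lemma H_form_lin c u v : H_form (c *: u + v) = c%:k *: H_form u + H_form v.
Proof.
by rewrite /H_form /TW_form formT_lin skew_T_linear H_piD H_piZ.
Qed.
Lemma H_vec0 : H_vec 0 = 0.
Proof.
by have := H_vec_lin (-1) 0 0; rewrite scaler0 addr0 mpolyCN scaleN1r addNr.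
Qed.
Lemma H_form0 : H_form 0 = 0.
Proof.
by have := H_form_lin (-1) 0 0; rewrite scaler0 addr0 mpolyCN scaleN1r addNr.
Qed.
Lemma H_vecE v : H_vec v = (v 0 0)%:k *: H_x hz + (v 1 0)%:k *: H_y hz.
Proof. by rewrite {1}[v]cV2E !H_vec_lin H_vec0 addr0. Qed.
Lemma H_formE v : H_form v = (v 0 0)%:k *: H_X hz + (v 0 1)%:k *: H_Y hz.
Proof. by rewrite {1}[v]rV2E !H_form_lin H_form0 addr0. Qed.

Lemma H_w_vec (g : W) v : H_w g * H_vec v = H_vec (W_mx g *m v) * H_w g.
Proof.
rewrite /H_w /H_vec /TW_grp /TW_vec -!H_piM skew_WT; congr (pi (skew_T _ _ * _)).
exact: tens_act_vec.
Qed.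
Lemma H_w_form (g : W) v : H_w g * H_form v = H_form (v *m invmx (W_mx g)) * H_w g.
Proof.
rewrite /H_w /H_form /TW_grp /TW_form -!H_piM skew_WT; congr (pi (skew_T _ _ * _)).
exact: tens_act_form.
Qed.

(** W preserves the quadratic form x y, so the inverse is the transpose in the antidiagonal. This
    identifies V^* with V by letting Y correspond to x and X to y. *)
Lemma W_inv_mx (g : W) : invmx (W_mx g) =
  \matrix_(i, j) W_mx g (1 - j) (1 - i).
Proof.
have [a a4 e] := in_WP hz (W_mxP g).
have a0 : a != 0.
  by apply: contra_eq_neq a4 => ->; rewrite expr0n eq_sym oner_neq0.
have inv_of (u v : 'M[C]_2) : u * v = 1 -> invmx u = v.
  move=> h; have [uw _] := mulmx1_unit h.
  by rewrite -[RHS](mulKmx uw) -[u *m v]/(u * v) h mulmx1.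
case: e => ->.
  rewrite (inv_of _ (diag2 a^-1)); last by rewrite diag2M divff ?diag2_1.
  by apply: mx2P; rewrite !mxE /= ?invrK.
rewrite (inv_of _ (adiag2 a)); last by rewrite adiag2A divff ?diag2_1.
by apply: mx2P; rewrite !mxE.
Qed.

Lemma W_inv_delta (g : W) i j :
  (delta_mx 0 i *m invmx (W_mx g) : 'rV_2) 0 j = W_mx g (1 - j) (1 - i).
Proof. by rewrite W_inv_mx -rowE !mxE. Qed.

Lemma H_wx (g : W) : H_w g * H_x hz =
  ((W_mx g 0 0)%:k *: H_x hz + (W_mx g 1 0)%:k *: H_y hz) * H_w g.
Proof. by rewrite [LHS]H_w_vec H_vecE -colE !mxE. Qed.
Lemma H_wy (g : W) : H_w g * H_y hz =
  ((W_mx g 0 1)%:k *: H_x hz + (W_mx g 1 1)%:k *: H_y hz) * H_w g.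
Proof. by rewrite [LHS]H_w_vec H_vecE -colE !mxE. Qed.
Lemma H_wY (g : W) : H_w g * H_Y hz =
  ((W_mx g 0 0)%:k *: H_Y hz + (W_mx g 1 0)%:k *: H_X hz) * H_w g.
Proof. by rewrite [LHS]H_w_form H_formE !W_inv_delta ?(subrr, subr0) addrC. Qed.
Lemma H_wX (g : W) : H_w g * H_X hz =
  ((W_mx g 0 1)%:k *: H_Y hz + (W_mx g 1 1)%:k *: H_X hz) * H_w g.
Proof. by rewrite [LHS]H_w_form H_formE !W_inv_delta ?(subrr, subr0) addrC. Qed.

Lemma H_xy : H_x hz * H_y hz = H_y hz * H_x hz.
Proof.
apply: subr0_eq; rewrite -!H_piM -H_piB; apply: H_pi_rel; exact: Rel_VV.
Qed.
Lemma H_XY : H_X hz * H_Y hz = H_Y hz * H_X hz.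
Proof.
apply: subr0_eq; rewrite -!H_piM -H_piB; apply: H_pi_rel; exact: Rel_V'V'.
Qed.

Lemma H_vec_form u U : H_vec u * H_form U = H_form U * H_vec u +
  kap (@H_w K zeta hz) (fun j =>
    (u 0 0 - zeta ^+ j * u 1 0) * (zeta ^+ (3 * j) * U 0 1 - U 0 0)).
Proof.
apply: (addrI (- (H_form U * H_vec u))); rewrite addKr addrC.
rewrite /H_vec /H_form -!H_piM -H_piB; apply: subr0_eq.
have := H_pi_rel (Rel_VV' hz u U); apply: etrans; rewrite !H_piB; congr (_ - _).
rewrite /cherednik_rhs H_piZ (linear_lcomb (f := pi)); last first.
  by move=> c s t; rewrite H_piD H_piZ.
rewrite scaler_sumr; apply: eq_bigr => j _.
by rewrite scalerA cherednik_coefk.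
Qed.

(** H is spanned by products of a word in the letters with a group element. Keeping an arbitrary
    right factor h in the auxiliary claim allows the letters to be stripped off from the left. *)
Lemma H_gen_ind (Q : H -> Prop) :
  Q 1 -> (forall h h', Q h -> Q h' -> Q (h + h')) -> (forall c h, Q h -> Q (c *: h)) ->
  (forall h, Q h -> Q (H_x hz * h)) -> (forall h, Q h -> Q (H_y hz * h)) ->
  (forall h, Q h -> Q (H_X hz * h)) -> (forall h, Q h -> Q (H_Y hz * h)) ->
  (forall g h, Q h -> Q (H_w g * h)) -> forall h, Q h.
Proof.
move=> Q1 QD QZ Qx Qy QX QY Qw.
have Qt t : forall h, Q h -> Q (pi (skew_T (W_action hz) t) * h).
  have lin := @skew_T_linear _ _ _ (W_action hz).
  have piT s u : pi (skew_T (W_action hz) (s + u)) =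
      pi (skew_T (W_action hz) s) + pi (skew_T (W_action hz) u).
    by rewrite -H_piD; congr pi; have := lin 1 s u; rewrite !scale1r.
  have skew0 : skew_T (W_action hz) 0 = 0.
    by apply/ffunP => v; rewrite skew_TE ffunE; case: eqP.
  have piTZ c s : pi (skew_T (W_action hz) (c *: s)) =
      c *: pi (skew_T (W_action hz) s).
    by rewrite -H_piZ; congr pi; have := lin c s 0; rewrite skew0 !addr0.
  move: t; apply: free_alg_ind => [h|s u hs hu h Qh|c s hs h Qh|l s hs h Qh].
  - by rewrite skew_T1 H_pi1 mul1r.
  - by rewrite piT mulrDl; apply: QD; [apply: hs | apply: hu].
  - by rewrite piTZ -scalerAl; apply/QZ/hs.
  - rewrite skew_TM H_piM -mulrA; move: (hs h Qh); move: (_ * h) => {hs Qh}h.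
    case: l => j.
      rewrite -(vecT_delta emb); have [->|->] : j = 0 \/ j = 1.
        by case: j => [[|[|//]] ?]; [left|right]; apply: val_inj.
      + exact: Qx.
      + exact: Qy.
    rewrite -(formT_delta emb); have [->|->] : j = 0 \/ j = 1.
      by case: j => [[|[|//]] ?]; [left|right]; apply: val_inj.
    + exact: QX.
    + exact: QY.
move=> h; have [f <-] := H_pi_surj h; rewrite [f]skew_decomp.
have Q0 : Q 0 by have := QZ 0 _ Q1; rewrite scale0r.
have pi0 : pi 0 = 0 by apply: (addrI (pi 0)); rewrite -H_piD !addr0.
rewrite (big_morph pi H_piD pi0); apply: big_ind => // w _.
rewrite H_piM; apply: Qt; rewrite -[pi _]mulr1; exact: Qw.
Qed.
End Concrete.

(** * Symbols, PBW injectivity and the centre *)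

Section PolyLead.
Variable G : comNzRingType.
Implicit Types p q : {poly G}.
(** The degree is only bounded by n, so c may be 0. This keeps the predicate stable under sums,
    where leading terms can cancel. *)
Definition plead n p c := (size p <= n.+1)%N /\ p`_n = c.

Lemma plead0 n : plead n 0 0.
Proof. by rewrite /plead size_poly0 coef0. Qed.
Lemma pleadC c : plead 0 c%:P c.
Proof. by split; rewrite ?coefC // size_polyC; case: eqP. Qed.
Lemma plead_small n p : (size p <= n)%N -> plead n p 0.
Proof. by move=> h; split; [apply: leqW | apply/leq_sizeP: (leqnn n); exact: h]. Qed.
Lemma plead_leq n p : plead n p 0 -> (size p <= n)%N.
Proof.
move=> [h e]; apply/leq_sizeP => j; rewrite leq_eqVlt => /orP [/eqP <- //|hj].
by move/leq_sizeP: h; apply.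
Qed.
Lemma pleadD n p q c d : plead n p c -> plead n q d -> plead n (p + q) (c + d).
Proof.
move=> [sp <-] [sq <-]; split; last by rewrite coefD.
by apply: leq_trans (size_polyD _ _) _; rewrite geq_max sp.
Qed.
Lemma pleadM n m p q c d : plead n p c -> plead m q d -> plead (n + m) (p * q) (c * d).
Proof.
move=> [sp <-] [sq <-]; split.
  by apply: leq_trans (size_polyMleq _ _) _; lia.
rewrite coefM (bigD1 (inord n)) //= inordK; last by lia.
rewrite addKn big1 ?addr0 // => i hi.
have {}hi : (i : nat) != n by apply: contraNneq hi => e; apply/eqP/val_inj; rewrite /= inordK; lia.
have [hin|hin] := ltnP i n; last first.
  by rewrite nth_default ?mul0r // (leq_trans sp) // ltn_neqAle eq_sym hi.
by rewrite [q`_ _]nth_default ?mulr0 // (leq_trans sq) //; lia.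
Qed.
Lemma pleadX n p c e : plead n p c -> plead (n * e) (p ^+ e) (c ^+ e).
Proof.
move=> h; elim: e => [|e IH]; first by rewrite muln0 !expr0; apply: pleadC.
by rewrite mulnS !exprS; apply: pleadM.
Qed.
Lemma plead_sum n I (r : seq I) (Q : pred I) (F : I -> {poly G}) f :
  (forall i, Q i -> plead n (F i) (f i)) ->
  plead n (\sum_(i <- r | Q i) F i) (\sum_(i <- r | Q i) f i).
Proof.
move=> h; elim/big_rec2: _ => [|i p q /h]; first exact: plead0.
by move=> h1 h2; apply: pleadD.
Qed.
Lemma plead_weak n m p c : plead n p c -> (n < m)%N -> plead m p 0.
Proof. by move=> [h _] hm; apply: plead_small; apply: leq_trans h _. Qed.
End PolyLead.

Section MatLead.
Variables (W : finGroupType) (G : comNzRingType).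
Local Notation T := {poly G}.
Local Notation M := 'M[T]_((wdim W).+1).
Definition mlead n (A : M) (L : W -> W -> G) :=
  forall g h, plead n (went A g h) (L g h).
Lemma mleadM n m A B L L' : mlead n A L -> mlead m B L' ->
  mlead (n + m) (A * B) (fun g h => \sum_k L g k * L' k h).
Proof. by move=> a b g h; rewrite wentM; apply: plead_sum => k _; apply: pleadM. Qed.
Lemma mlead_ext n A L L' : (forall g h, L g h = L' g h) -> mlead n A L -> mlead n A L'.
Proof. by move=> e h g g'; rewrite -e. Qed.
Definition ldiag (d : W -> G) g h := (g == h)%:R * d g.
Lemma mleadMdl n m A B d L' : mlead n A (ldiag d) -> mlead m B L' ->
  mlead (n + m) (A * B) (fun g h => d g * L' g h).
Proof.
move=> a b; apply: mlead_ext (mleadM a b) => g h.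
rewrite (bigD1 g) //= big1 => [|l hl]; first by rewrite /ldiag eqxx mul1r addr0.
by rewrite /ldiag eq_sym (negbTE hl) !mul0r.
Qed.
Lemma mleadMdr n m A B d L' : mlead n A L' -> mlead m B (ldiag d) ->
  mlead (n + m) (A * B) (fun g h => L' g h * d h).
Proof.
move=> a b; apply: mlead_ext (mleadM a b) => g h.
rewrite (bigD1 h) //= big1 => [|l hl]; first by rewrite /ldiag eqxx mul1r addr0.
by rewrite /ldiag (negbTE hl) mul0r mulr0.
Qed.
Lemma mleadXd n A d e : mlead n A (ldiag d) ->
  mlead (n * e) (A ^+ e) (ldiag (fun g => d g ^+ e)).
Proof.
move=> a; elim: e => [|e IH].
  rewrite muln0 expr0 => g h; rewrite went1 /ldiag expr0 mulr1.
  by case: eqP => _; [apply: pleadC | apply: plead0].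
rewrite mulnS exprS; apply: mlead_ext (mleadMdl a IH) => g h.
by rewrite /ldiag exprS mulrCA.
Qed.
Lemma mlead_sum n I (r : seq I) (Q : pred I) (F : I -> M) L :
  (forall i, Q i -> mlead n (F i) (L i)) ->
  mlead n (\sum_(i <- r | Q i) F i) (fun g h => \sum_(i <- r | Q i) L i g h).
Proof. by move=> a g h; rewrite went_sum; apply: plead_sum => i Qi; apply: a. Qed.
Lemma mleadZ n (c : G) A L : mlead n A L -> mlead n (c%:P *: A) (fun g h => c * L g h).
Proof. by move=> a g h; rewrite wentZ -[n]add0n; apply: pleadM; [apply: pleadC|]. Qed.
End MatLead.

Lemma mpoly_lin_free (R : nzRingType) n (i j : 'I_n) (a b : R) : i != j ->
  a%:MP * 'X_i + b%:MP * 'X_j = 0 :> {mpoly R[n]} -> a = 0 /\ b = 0.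
Proof.
move=> ij e.
have ne (i' j' : 'I_n) : i' != j' -> (U_(i') == U_(j') :> 'X_{1..n})%MM = false.
  move=> h; apply/negP => /eqP/mnmP/(_ i'); rewrite !mnm1E eqxx eq_sym.
  by rewrite (negbTE h).
have c l : (a%:MP * 'X_i + b%:MP * 'X_j : {mpoly R[n]})@_U_(l) =
    a * (U_(i) == U_(l))%MM%:R + b * (U_(j) == U_(l))%MM%:R.
  by rewrite mcoeffD !mcoeffCM !mcoeffX.
have ha := c i; have hb := c j; have ji : j != i by rewrite eq_sym.
move: ha hb; rewrite e !mcoeff0 !eqxx (ne _ _ ij) (ne _ _ ji).
by rewrite !mulr1 !mulr0 addr0 add0r => <- <-.
Qed.

Lemma morph_al (R1 R2 : comNzRingType) (f : {rmorphism R1 -> R2}) a b z j :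
  f a - f z ^+ j * f b = f (a - z ^+ j * b).
Proof. by rewrite rmorphB rmorphM rmorphXn. Qed.

Section MvMap.
Variables (K : realType) (zeta : K[i]) (hz : 4.-primitive_root zeta).
Local Notation k := {mpoly K[i][2]}.
Variables (T1 T2 : comNzRingType) (i1 : {rmorphism k -> T1}) (i2 : {rmorphism k -> T2}).
Variable f : {rmorphism T1 -> T2}.
Hypothesis fi : forall c, i2 c = f (i1 c).
Variables (x y : T1) (g : dihedral hz).
Lemma mvx_map : mvx i2 (f x) (f y) g = f (mvx i1 x y g).
Proof. by rewrite /mvx rmorphD !rmorphM /= !fi. Qed.
Lemma mvy_map : mvy i2 (f x) (f y) g = f (mvy i1 x y g).
Proof. by rewrite /mvy rmorphD !rmorphM /= !fi. Qed.
Lemma mvX_map : mvX i2 (f x) (f y) g = f (mvX i1 x y g).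
Proof. by rewrite /mvX rmorphD !rmorphM /= !fi. Qed.
Lemma mvY_map : mvY i2 (f x) (f y) g = f (mvY i1 x y g).
Proof. by rewrite /mvY rmorphD !rmorphM /= !fi. Qed.
End MvMap.

Section Rep.
Variables (K : realType) (zeta : K[i]) (hz : 4.-primitive_root zeta).
Local Notation C := K[i].
Local Notation W := (dihedral hz).
Local Notation k := {mpoly C[2]}.
Local Notation H := (cherednik hz).
Local Notation P := {mpoly k[4]}.
Local Notation Px := ('X_(inord 0) : P).
Local Notation Py := ('X_(inord 1) : P).
Local Notation PX := ('X_(inord 2) : P).
Local Notation PY := ('X_(inord 3) : P).
Local Notation "c %:k" := (c%:MP_[2] : k) (at level 2).

Variables (G : fieldType) (frac : {rmorphism P -> G}).
Hypothesis frac_inj : injective frac.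
Local Notation T := {poly G}.
Definition iotaP : {rmorphism k -> P} := @mpolyC 4 k.
Definition iotaT : {rmorphism k -> T} := (@polyC G \o (frac \o iotaP))%FUN.
(* The degree in 'X of {poly G} records the degree in x, y. *)
Definition tx : T := (frac Px)%:P * 'X.
Definition ty : T := (frac Py)%:P * 'X.
Definition tX : T := (frac PX)%:P.
Definition tY : T := (frac PY)%:P.

Lemma frac_eq0 (p : P) : (frac p == 0) = (p == 0).
Proof. by rewrite -(rmorph0 frac) (inj_eq frac_inj). Qed.

Local Notation gx g := (mvx (hz := hz) iotaP Px Py g).
Local Notation gy g := (mvy (hz := hz) iotaP Px Py g).
Local Notation gX g := (mvX (hz := hz) iotaP PX PY g).
Local Notation gY g := (mvY (hz := hz) iotaP PX PY g).

Definition fcst : {rmorphism P -> T} := (@polyC G \o frac)%FUN.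
Lemma mvXT g : mvX (hz := hz) iotaT tX tY g = (frac (gX g))%:P.
Proof. exact: (@mvX_map _ _ hz _ _ iotaP iotaT fcst). Qed.
Lemma mvYT g : mvY (hz := hz) iotaT tX tY g = (frac (gY g))%:P.
Proof. exact: (@mvY_map _ _ hz _ _ iotaP iotaT fcst). Qed.
Lemma mvxT g : mvx (hz := hz) iotaT tx ty g = (frac (gx g))%:P * 'X.
Proof.
transitivity (mvx (hz := hz) iotaT (fcst Px) (fcst Py) g * 'X).
  by rewrite /mvx mulrDl !mulrA.
by congr (_ * _); exact: (@mvx_map _ _ hz _ _ iotaP iotaT fcst).
Qed.
Lemma mvyT g : mvy (hz := hz) iotaT tx ty g = (frac (gy g))%:P * 'X.
Proof.
transitivity (mvy (hz := hz) iotaT (fcst Px) (fcst Py) g * 'X).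
  by rewrite /mvy mulrDl !mulrA.
by congr (_ * _); exact: (@mvy_map _ _ hz _ _ iotaP iotaT fcst).
Qed.

Lemma lin_free (i j : 'I_4) (a b : C) : i != j ->
  iotaP a%:k * 'X_i + iotaP b%:k * 'X_j = 0 :> P -> a = 0 /\ b = 0.
Proof.
move=> ij e; have [/eqP + /eqP] := mpoly_lin_free ij e.
by rewrite !mpolyC_eq0 => /eqP -> /eqP ->.
Qed.

Lemma inord32 : inord 3 != inord 2 :> 'I_4.
Proof. by rewrite inord4_eq. Qed.

Lemma al_neq0 (g : W) j : gX g - cst iotaP zeta ^+ j * gY g != 0.
Proof.
apply/negP => /eqP e.
have {e}e : iotaP (W_mx g 0 1 - zeta ^+ j * W_mx g 0 0)%:k * PY +
    iotaP (W_mx g 1 1 - zeta ^+ j * W_mx g 1 0)%:k * PX = 0.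
  rewrite -[RHS]e /mvX /mvY -![iotaP _]/(cst iotaP _) !rmorphB !rmorphM !rmorphXn.
  by ring.
have z0 n : zeta ^+ n != 0 by rewrite expf_neq0 // (zeta_neq0 hz).
have [a [b [ab [E _]]]] := W_cases g.
have [a0 b0] : a != 0 /\ b != 0.
  by split; apply/eqP => h; move/eqP: ab; rewrite h ?(mulr0, mul0r) eq_sym oner_eq0.
have [] := lin_free inord32 e.
case: E => [[-> [-> [-> ->]]]|[-> [-> [-> ->]]]] /eqP; rewrite ?mulr0 ?subr0 ?sub0r.
  by rewrite oppr_eq0 mulf_eq0 (negbTE (z0 _)) (negbTE a0).
by rewrite (negbTE a0).
Qed.

Definition il (g : W) (j : nat) : T :=
  ((frac (gX g - cst iotaP zeta ^+ j * gY g))^-1)%:P.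

Lemma ilP g j : il g j * (mvX (hz := hz) iotaT tX tY g -
  cst iotaT zeta ^+ j * mvY (hz := hz) iotaT tX tY g) = 1.
Proof.
rewrite mvXT mvYT.
transitivity (il g j * fcst (gX g - cst iotaP zeta ^+ j * gY g)).
  by congr (_ * _); apply: (morph_al fcst).
have := al_neq0 g j; rewrite -frac_eq0 /il /= -polyCM.
by move: (frac _) => a a0; rewrite mulVf.
Qed.

Definition rho : H -> restr iotaT 'M[T]_((wdim W).+1) := hrep iotaT tx ty tX tY il.
Lemma rho_linear : linear rho. Proof. exact: hrep_linear ilP. Qed.
Lemma rho_monoid : monoid_morphism rho. Proof. exact: hrep_monoid ilP. Qed.
Lemma rhoM a b : rho (a * b) = rho a * rho b. Proof. exact: rho_monoid.2. Qed.
Lemma rho1 : rho 1 = 1. Proof. exact: rho_monoid.1. Qed.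
Lemma rhoD a b : rho (a + b) = rho a + rho b.
Proof. by have := rho_linear 1 a b; rewrite !scale1r. Qed.
Lemma rho0 : rho 0 = 0. Proof. by apply: (addrI (rho 0)); rewrite -rhoD !addr0. Qed.
Lemma rhoZ c a : rho (c *: a) = c *: rho a.
Proof. by have := rho_linear c a 0; rewrite rho0 !addr0. Qed.
Lemma rhoX a n : rho (a ^+ n) = rho a ^+ n.
Proof. by elim: n => [|n IH]; rewrite ?expr0 ?rho1 // !exprS rhoM IH. Qed.
Lemma rho_sum I (r : seq I) (Q : pred I) F :
  rho (\sum_(i <- r | Q i) F i) = \sum_(i <- r | Q i) rho (F i).
Proof. exact: (big_morph _ rhoD rho0). Qed.

Lemma rho_vec v : rho (H_vec hz v) = dunkl iotaT tx ty il v.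
Proof. by rewrite /rho /H_vec hrep_pi ?TW_rep_vec //; apply: ilP. Qed.
Lemma rho_form v : rho (H_form hz v) = dform hz iotaT tX tY v.
Proof. by rewrite /rho /H_form hrep_pi ?TW_rep_form //; apply: ilP. Qed.
Lemma rho_w g : rho (H_w g) = dperm iotaT g.
Proof. by rewrite /rho /H_w hrep_pi ?TW_rep_grp //; apply: ilP. Qed.

Local Notation x := (H_x hz).
Local Notation y := (H_y hz).
Local Notation X := (H_X hz).
Local Notation Y := (H_Y hz).

Lemma plead_cst c : plead 0 (iotaT c) (frac (iotaP c)).
Proof. exact: pleadC. Qed.

(** The reflection terms of a Dunkl operator have degree 0 in t; in degree 1 only the diagonal
    remains. *)
Lemma mlead_rho_vec v d :
  (forall g, mvec iotaT tx ty v g = (d g)%:P * 'X) -> mlead 1 (rho (H_vec hz v)) (ldiag d).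
Proof.
move=> e g h; rewrite rho_vec went_dunkl e.
rewrite -[X in plead _ _ X]addr0; apply: pleadD; last first.
  apply: plead_small; apply: (leq_trans (size_sum _ _ _)); apply/bigmax_leqP => j _.
  have := pleadM (pleadM (pleadM (plead_cst (parC K j))
     (plead_cst (v 0 0 - zeta ^+ j * v 1 0)%:k)) (pleadC _)) (pleadC _).
  by case/(_ (frac (gX g - cst iotaP zeta ^+ j * gY g))^-1 ((h == (g * s_ hz j)%g)%:R));
    rewrite polyC_natr.
rewrite /ldiag -polyC_natr mulrA -polyCM; split.
  by apply: leq_trans (size_polyMleq _ _) _; rewrite size_polyX addn2 /= ltnS size_polyC; case: eqP.
by rewrite coefMX coefC.
Qed.
End Rep.

(** Only x and y count, since these are the variables scaled by t. *)
Definition wt (m : 'X_{1..4}) : nat := (m (inord 0) + m (inord 1))%N.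
Definition top (R : comNzRingType) N (p : {mpoly R[4]}) : {mpoly R[4]} :=
  \sum_(m <- msupp p | wt m == N) p@_m *: 'X_[m].
Lemma mcoeff_top (R : comNzRingType) N (p : {mpoly R[4]}) m :
  (top N p)@_m = if wt m == N then p@_m else 0.
Proof.
rewrite /top raddf_sum /=.
under eq_bigr => i _ do rewrite mcoeffZ mcoeffX.
have [hm|hm] := boolP (m \in msupp p); last first.
  rewrite (memN_msupp_eq0 hm) if_same big_seq_cond big1 // => i /andP [hi _].
  case: eqP => [e|_]; rewrite ?mulr0 // -e in hm *.
  by rewrite hi in hm.
rewrite -big_filter; case: ifP => hw.
  rewrite (bigD1_seq m) ?filter_uniq ?msupp_uniq ?mem_filter ?hw //=.
  rewrite eqxx mulr1 big1 ?addr0 // => i /negbTE hi.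
  by rewrite hi mulr0.
rewrite big_filter big1 // => i hi; case: eqP => [e|_]; rewrite ?mulr0 //.
by rewrite -e hi in hw.
Qed.

Lemma morph_mono (R1 R2 : nzRingType) (f : R1 -> R2) (a b c d e : R1) i j l n :
  monoid_morphism f ->
  f (a ^+ i * b ^+ j * c * (d ^+ l * e ^+ n)) =
  f a ^+ i * f b ^+ j * f c * (f d ^+ l * f e ^+ n).
Proof.
move=> [f1 fM]; have fX t s : f (t ^+ s) = f t ^+ s.
  by elim: s => [|s IH]; rewrite ?expr0 // !exprS fM IH.
by rewrite !fM !fX.
Qed.

Lemma rmorph_mono4 (R1 R2 : comNzRingType) (f : {rmorphism R1 -> R2}) a b c d i j l n :
  f (a ^+ i * b ^+ j * c ^+ l * d ^+ n) =
  f a ^+ i * f b ^+ j * f c ^+ l * f d ^+ n.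
Proof. by rewrite !rmorphM !rmorphXn. Qed.

Lemma lead_arith (R : comNzRingType) (a b c d e : R) :
  a * b * e * (c * d) = e * (c * d * a * b).
Proof. by ring. Qed.

Lemma mpoly_rmorph_eq (R S : comNzRingType) n (f g : {rmorphism {mpoly R[n]} -> S}) :
  (forall c, f c%:MP = g c%:MP) -> (forall i, f 'X_i = g 'X_i) -> f =1 g.
Proof.
move=> fC fX p; rewrite [p]mpolyE !rmorph_sum; apply: eq_bigr => m _.
rewrite -mul_mpolyC !rmorphM fC; congr (_ * _).
rewrite mpolyXE_id !rmorph_prod; apply: eq_bigr => i _.
by rewrite !rmorphXn fX.
Qed.

Lemma mpoly_rmorph_eq2 (R S S' : comNzRingType) n
    (f : {rmorphism {mpoly R[n]} -> S}) (f' : {rmorphism S -> S'})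
    (g : {rmorphism {mpoly R[n]} -> S'}) :
  (forall c, f' (f c%:MP) = g c%:MP) -> (forall i, f' (f 'X_i) = g 'X_i) ->
  forall p, f' (f p) = g p.
Proof. exact: (@mpoly_rmorph_eq _ _ _ (f' \o f)%FUN). Qed.

Section Triangularity.
Variables (K : realType) (zeta : K[i]) (hz : 4.-primitive_root zeta).
Local Notation C := K[i].
Local Notation W := (dihedral hz).
Local Notation k := {mpoly C[2]}.
Local Notation H := (cherednik hz).
Local Notation P := {mpoly k[4]}.
Local Notation Px := ('X_(inord 0) : P).
Local Notation Py := ('X_(inord 1) : P).
Local Notation PX := ('X_(inord 2) : P).
Local Notation PY := ('X_(inord 3) : P).
Local Notation "c %:k" := (c%:MP_[2] : k) (at level 2).
Variables (G : fieldType) (frac : {rmorphism P -> G}).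
Hypothesis frac_inj : injective frac.
Local Notation T := {poly G}.
Local Notation gx g := (mvx (hz := hz) (iotaP K) Px Py g).
Local Notation gy g := (mvy (hz := hz) (iotaP K) Px Py g).
Local Notation gX g := (mvX (hz := hz) (iotaP K) PX PY g).
Local Notation gY g := (mvY (hz := hz) (iotaP K) PX PY g).
Local Notation x := (H_x hz).
Local Notation y := (H_y hz).
Local Notation X := (H_X hz).
Local Notation Y := (H_Y hz).
Local Notation rho := (@rho K zeta hz G frac).

Lemma mlead_x : mlead 1 (rho x) (ldiag (fun g => frac (gx g))).
Proof. apply: (mlead_rho_vec frac_inj) => g; rewrite mvec_delta0; exact: mvxT. Qed.
Lemma mlead_y : mlead 1 (rho y) (ldiag (fun g => frac (gy g))).
Proof. apply: (mlead_rho_vec frac_inj) => g; rewrite mvec_delta1; exact: mvyT. Qed.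
Lemma mlead_diag (d : W -> T) (c : W -> G) : (forall g, d g = (c g)%:P) ->
  mlead 0 (wdiag d) (ldiag c).
Proof.
move=> e g h; rewrite went_diag e /ldiag -polyC_natr -polyCM.
exact: pleadC.
Qed.
Lemma mlead_X : mlead 0 (rho X) (ldiag (fun g => frac (gX g))).
Proof. rewrite (rho_form hz frac_inj); apply: mlead_diag => g; rewrite mform_delta0; exact: mvXT. Qed.
Lemma mlead_Y : mlead 0 (rho Y) (ldiag (fun g => frac (gY g))).
Proof. rewrite (rho_form hz frac_inj); apply: mlead_diag => g; rewrite mform_delta1; exact: mvYT. Qed.
Lemma mlead_w (u : W) : mlead 0 (rho (H_w u)) (fun g h => (h == (g * u)%g)%:R).
Proof.
by rewrite (rho_w frac_inj) => g h; rewrite went_perm -polyC_natr; apply: pleadC.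
Qed.

Local Notation mono := (mono x y X Y (@H_w K zeta hz)).
Local Notation apbw := (apbw x y X Y (@H_w K zeta hz)).

(** In the entry (g, h) of a normally ordered monomial the left factors X, Y are evaluated at the
    row g and the right factors x, y at the column h; hence the two group arguments. *)
Definition evals (g h : W) (i : 'I_4) : P :=
  nth 0 [:: gx h; gy h; gX g; gY g] i.
Definition ev (g h : W) : {rmorphism P -> P} := mmap (iotaP K) (evals g h).

Lemma mnm4_mmap1 (R : comNzRingType) (f : 'I_4 -> R) m :
  mmap1 f m = f (inord 0) ^+ m (inord 0) * f (inord 1) ^+ m (inord 1) *
    f (inord 2) ^+ m (inord 2) * f (inord 3) ^+ m (inord 3).
Proof.
rewrite /mmap1 !big_ord_recl big_ord0 mulr1 !mulrA.
by do ![congr (_ * _)]; congr (f _ ^+ m _); apply: val_inj; rewrite /= inordK.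
Qed.
Lemma evX g h m : ev g h 'X_[m] = gx h ^+ m (inord 0) * gy h ^+ m (inord 1) *
    gX g ^+ m (inord 2) * gY g ^+ m (inord 3).
Proof. by rewrite [LHS]mmapX mnm4_mmap1 /evals !inordK. Qed.

Definition lmono (u : W) (m : 'X_{1..4}) (g h : W) : G :=
  (h == (g * u)%g)%:R * frac (ev g h 'X_[m]).

Lemma mlead_mono u m : mlead (wt m) (rho (mono u m)) (lmono u m).
Proof.
have mX := mleadXd (m (inord 2)) mlead_X; have mY := mleadXd (m (inord 3)) mlead_Y.
have mx := mleadXd (m (inord 0)) mlead_x; have my := mleadXd (m (inord 1)) mlead_y.
rewrite !mul0n in mX mY; rewrite !mul1n in mx my.
have h1 := mleadMdl mX mY; have h2 := mleadMdr mx my.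
have h1' : mlead 0 (rho X ^+ m (inord 2) * rho Y ^+ m (inord 3))
    (ldiag (fun g => frac (gX g) ^+ m (inord 2) * frac (gY g) ^+ m (inord 3))).
  by apply: mlead_ext h1 => g h; rewrite /ldiag mulrCA.
have h2' : mlead (wt m) (rho x ^+ m (inord 0) * rho y ^+ m (inord 1))
    (ldiag (fun g => frac (gx g) ^+ m (inord 0) * frac (gy g) ^+ m (inord 1))).
  apply: mlead_ext h2 => g h; rewrite /ldiag; case: eqP => [->|_]; last by rewrite !mul0r.
  by rewrite !mul1r.
have := mleadMdr (mleadMdl h1' (mlead_w u)) h2'; rewrite !add0n.
rewrite /mono (morph_mono _ _ _ _ _ _ _ _ _ (rho_monoid hz frac_inj)).
apply: mlead_ext => g h.
rewrite /lmono evX rmorph_mono4; exact: lead_arith.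
Qed.

Definition degb n (F : {ffun W -> P}) :=
  forall w m, m \in msupp (F w) -> (wt m < n)%N.

(** The group element u only reaches the entries (g, g u). Distinct components of F therefore occupy
    distinct entries, and no cancellation between them can hide a leading term. *)
Lemma mlead_apbw N F : degb N.+1 F ->
  mlead N (rho (apbw F)) (fun g h => frac (ev g h (top N (F (g^-1 * h)%g)))).
Proof.
move=> hF.
pose Lt u m g h := (if wt m == N then 1 else 0) * frac (iotaP K (F u)@_m) * lmono u m g h.
have h1 : mlead N (rho (apbw F))
    (fun g h => \sum_u \sum_(m <- msupp (F u)) Lt u m g h).
  rewrite /apbw (rho_sum frac_inj); apply: mlead_sum => u _.
  rewrite /mlin (rho_sum frac_inj) big_seq => g h; rewrite [X in plead _ _ X]big_seq.
  move: g h; apply: mlead_sum => m hm; rewrite (rhoZ frac_inj).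
  have hz0 := mleadZ (frac (iotaP K (F u)@_m)) (mlead_mono u m).
  have := hF u m hm; rewrite ltnS leq_eqVlt /Lt => /orP [/eqP e|lt].
    by rewrite e eqxx in hz0 *; apply: mlead_ext hz0 => g h; rewrite mul1r.
  rewrite (ltn_eqF lt) => g h; rewrite !mul0r.
  exact: plead_weak (hz0 g h) lt.
apply: mlead_ext h1 => g h; rewrite (bigD1 (g^-1 * h)%g) //= [X in _ + X]big1 => [|u hu].
  rewrite addr0 /top (raddf_sum (ev g h)) (raddf_sum frac) [RHS]big_mkcond.
  apply: eq_bigr => m _; rewrite /Lt /lmono mulKVg eqxx mul1r.
  case: eqP => _; last by rewrite !mul0r.
  rewrite mul1r -rmorphM; congr (frac _).
  rewrite -mul_mpolyC; apply: etrans (esym (rmorphM (ev g h) _ _)).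
  congr (_ * _).
  by rewrite [RHS]mmapC.
have hgu : (h == (g * u)%g) = false.
  by apply/negP => /eqP e; case/negP: hu; rewrite e mulKg.
by rewrite big1 // => m _; rewrite /Lt /lmono hgu mul0r mulr0.
Qed.

(* the substitution [ev 1 h], which moves only x and y, is invertible *)
Lemma evC g h c : ev g h (iotaP K c) = iotaP K c.
Proof. exact: mmapC. Qed.
Lemma evU g h i : ev g h 'X_i = evals g h i.
Proof. by rewrite [LHS]mmapX mmap1U. Qed.
Lemma evals0 g h : evals g h (inord 0) = gx h.
Proof. by rewrite /evals inordK. Qed.
Lemma evals1 g h : evals g h (inord 1) = gy h.
Proof. by rewrite /evals inordK. Qed.
Lemma evals2 g h : evals g h (inord 2) = gX g.
Proof. by rewrite /evals inordK. Qed.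
Lemma evals3 g h : evals g h (inord 3) = gY g.
Proof. by rewrite /evals inordK. Qed.

Lemma mv1 (T' : comNzRingType) (i' : {rmorphism k -> T'}) a b :
  [/\ mvx i' a b (1%g : W) = a, mvy i' a b (1%g : W) = b,
      mvX i' a b (1%g : W) = a & mvY i' a b (1%g : W) = b].
Proof.
by split; rewrite /mvx /mvy /mvX /mvY W_mx1 !mxE rmorph1 rmorph0
  !(mul1r, mul0r, addr0, add0r).
Qed.

Lemma ev_mvx g h h' : ev g h (gx h') = gx (h * h')%g.
Proof.
apply: etrans (esym (mvx_map (fun c => esym (evC g h c)) _ _ h')) _.
have -> : ev g h Px = gx h by apply: etrans (evU g h _) (evals0 g h).
have -> : ev g h Py = gy h by apply: etrans (evU g h _) (evals1 g h).
exact: esym (mvxM _ _ _ h h').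
Qed.
Lemma ev_mvy g h h' : ev g h (gy h') = gy (h * h')%g.
Proof.
apply: etrans (esym (mvy_map (fun c => esym (evC g h c)) _ _ h')) _.
have -> : ev g h Px = gx h by apply: etrans (evU g h _) (evals0 g h).
have -> : ev g h Py = gy h by apply: etrans (evU g h _) (evals1 g h).
exact: esym (mvyM _ _ _ h h').
Qed.
Lemma ev_mvX g h h' : ev g h (gX h') = gX (g * h')%g.
Proof.
apply: etrans (esym (mvX_map (fun c => esym (evC g h c)) _ _ h')) _.
have -> : ev g h PX = gX g by apply: etrans (evU g h _) (evals2 g h).
have -> : ev g h PY = gY g by apply: etrans (evU g h _) (evals3 g h).
exact: esym (mvXM _ _ _ g h').
Qed.
Lemma ev_mvY g h h' : ev g h (gY h') = gY (g * h')%g.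
Proof.
apply: etrans (esym (mvY_map (fun c => esym (evC g h c)) _ _ h')) _.
have -> : ev g h PX = gX g by apply: etrans (evU g h _) (evals2 g h).
have -> : ev g h PY = gY g by apply: etrans (evU g h _) (evals3 g h).
exact: esym (mvYM _ _ _ g h').
Qed.

Lemma ev_comp g h g' h' p : ev g h (ev g' h' p) = ev (g * g')%g (h * h')%g p.
Proof.
move: p; apply: (@mpoly_rmorph_eq2 _ _ _ _ (ev g' h') (ev g h) (ev (g * g')%g (h * h')%g)) => [c|i].
  have h1 := evC g h c; have h2 := evC g' h' c; have h3 := evC (g * g')%g (h * h')%g c.
  have h4 := congr1 (ev g h) h2.
  exact: (etrans h4 (etrans h1 (esym h3))).
have h1 := congr1 (ev g h) (evU g' h' i).
have h3 := evU (g * g')%g (h * h')%g i.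
suff h2 : ev g h (evals g' h' i) = evals (g * g')%g (h * h')%g i.
  exact: (etrans h1 (etrans h2 (esym h3))).
move: {h1 h3}i => i; case: (I4E i) => ->.
- have h1 := congr1 (ev g h) (evals0 g' h'); have h2 := ev_mvx g h h'.
  have h3 := evals0 (g * g')%g (h * h')%g; exact: (etrans h1 (etrans h2 (esym h3))).
- have h1 := congr1 (ev g h) (evals1 g' h'); have h2 := ev_mvy g h h'.
  have h3 := evals1 (g * g')%g (h * h')%g; exact: (etrans h1 (etrans h2 (esym h3))).
- have h1 := congr1 (ev g h) (evals2 g' h'); have h2 := ev_mvX g h g'.
  have h3 := evals2 (g * g')%g (h * h')%g; exact: (etrans h1 (etrans h2 (esym h3))).
- have h1 := congr1 (ev g h) (evals3 g' h'); have h2 := ev_mvY g h g'.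
  have h3 := evals3 (g * g')%g (h * h')%g; exact: (etrans h1 (etrans h2 (esym h3))).
Qed.

Lemma ev_id p : ev 1%g 1%g p = p.
Proof.
move: p; apply: (@mpoly_rmorph_eq _ _ _ (ev 1%g 1%g) idfun) => [c|i].
  exact: evC.
have [ex ey _ _] := mv1 (iotaP K) Px Py.
have [_ _ eX eY] := mv1 (iotaP K) PX PY.
apply: etrans (evU _ _ _) _; case: (I4E i) => ->.
- exact: etrans (evals0 _ _) ex.
- exact: etrans (evals1 _ _) ey.
- exact: etrans (evals2 _ _) eX.
- exact: etrans (evals3 _ _) eY.
Qed.

Lemma ev_inj g h : injective (ev g h).
Proof.
have can p : ev g^-1%g h^-1%g (ev g h p) = p.
  by apply: etrans (ev_comp _ _ _ _ p) _; rewrite !mulVg; apply: ev_id.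
exact: can_inj can.
Qed.

(** The first row is enough: its entry at w has top coefficient [ev 1 w] applied to the top part of
    F w, and this substitution is injective. *)
Lemma degb_step N F : degb N.+1 F ->
  (forall w, (size (went (rho (apbw F)) 1%g w) <= N)%N) -> degb N F.
Proof.
move=> hF hs w m hm; have := hF w m hm; rewrite ltnS leq_eqVlt => /orP [/eqP e|//].
have [_ /esym] := mlead_apbw hF 1%g w; rewrite invg1 mul1g.
have /leq_sizeP -> // := hs w; rewrite -(rmorph0 frac) => /frac_inj.
rewrite -[RHS](rmorph0 (ev 1%g w)) => /ev_inj t0.
by have := mcoeff_top N (F w) m; rewrite t0 mcoeff0 e eqxx => /esym/eqP;
  rewrite mcoeff_eq0 hm.
Qed.

Lemma degb_bound F : exists N, degb N F.
Proof.
exists (\max_w \max_(m <- msupp (F w)) (wt m).+1) => w m hm.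
apply: leq_trans (leq_bigmax w); exact: (@leq_bigmax_seq _ _ xpredT (fun m0 => (wt m0).+1) m hm isT).
Qed.

Lemma degb_size N F : (forall w, (size (went (rho (apbw F)) 1%g w) <= N)%N) -> degb N F.
Proof.
move=> hs; have [M] := degb_bound F; elim: M => [|M IH] hM.
  by move=> w m hm; have := hM w m hm.
have [hMN|hNM] := ltnP M N; first by move=> w m hm; apply: leq_trans (hM w m hm) hMN.
by apply: IH; apply: degb_step => // w; apply: leq_trans (hs w) hNM.
Qed.

Lemma degb0 F : degb 0 F -> F = 0.
Proof.
move=> h; apply/ffunP => w; rewrite ffunE; apply/mpolyP => m.
rewrite mcoeff0; apply/memN_msupp_eq0/negP => hm.
by have := h w m hm.
Qed.

Lemma H_apbw_inj : injective apbw.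
Proof.
move=> F F' e; apply: subr0_eq; apply: degb0; apply: degb_size => w.
have -> : apbw (F - F') = 0.
  rewrite (_ : F - F' = -1 *: F' + F); last by rewrite scaleN1r addrC.
  by rewrite apbw_linear e scaleN1r addNr.
by rewrite (rho0 hz frac_inj) went0 size_poly0.
Qed.

End Triangularity.

(** * Central elements as scalars, and the inverse of Trunc *)

Section Went.
Variables (W : finGroupType) (T : comNzRingType).
Local Notation M := 'M[T]_((wdim W).+1).
Lemma went_muldr (A : M) d g h : went (A * wdiag d) g h = went A g h * d h.
Proof.
rewrite wentM (bigD1 h) //= big1 => [|l hl]; first by rewrite went_diag eqxx mul1r addr0.
by rewrite went_diag (negbTE hl) mul0r mulr0.
Qed.
Lemma went_muldl (A : M) d g h : went (wdiag d * A) g h = d g * went A g h.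
Proof.
rewrite wentM (bigD1 g) //= big1 => [|l hl]; first by rewrite went_diag eqxx mul1r addr0.
by rewrite went_diag eq_sym (negbTE hl) !mul0r.
Qed.
Lemma went_mulpr (A : M) u g h : went (A * wperm T u) g (h * u)%g = went A g h.
Proof.
rewrite wentM (bigD1 h) //= big1 => [|l hl]; first by rewrite went_perm eqxx mulr1 addr0.
by rewrite went_perm (inj_eq (mulIg u)) eq_sym (negbTE hl) mulr0.
Qed.
Lemma went_mulpl (A : M) u g h : went (wperm T u * A) g h = went A (g * u)%g h.
Proof.
rewrite wentM (bigD1 (g * u)%g) //= big1 => [|l hl].
  by rewrite went_perm eqxx mul1r addr0.
by rewrite went_perm (negbTE hl) mul0r.
Qed.
Lemma went_scalarM (c : T) (A : M) g h : went (c%:M * A) g h = c * went A g h.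
Proof. by rewrite -[_ * A]/(_ *m A) mul_scalar_mx wentZ. Qed.
End Went.

Lemma diag_comm (W : finGroupType) (G : fieldType)
    (A : 'M[{poly G}]_((wdim W).+1)) d (D : W -> G) :
  (forall g, d g = (D g)%:P) -> A * wdiag d = wdiag d * A ->
  forall g h, went A g h = 0 \/ D g = D h.
Proof.
move=> dD e g h; have /eqP := went_muldr A d g h.
rewrite e went_muldl mulrC !dD -subr_eq0 -mulrBr -polyCB mulf_eq0 polyC_eq0 subr_eq0.
by case/orP => /eqP; [left|right].
Qed.

Lemma morph_lin2 (R1 R2 : comNzRingType) (f : {rmorphism R1 -> R2}) a b c d u v :
  f a * u + f b * v = f c * u + f d * v -> f (a - c) * u + f (b - d) * v = 0.
Proof. by move=> e; rewrite !rmorphB !mulrBl addrACA e -opprD subrr. Qed.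

Section Centre.
Variables (K : realType) (zeta : K[i]) (hz : 4.-primitive_root zeta).
Local Notation C := K[i].
Local Notation W := (dihedral hz).
Local Notation k := {mpoly C[2]}.
Local Notation H := (cherednik hz).
Local Notation P := {mpoly k[4]}.
Local Notation Px := ('X_(inord 0) : P).
Local Notation Py := ('X_(inord 1) : P).
Local Notation PX := ('X_(inord 2) : P).
Local Notation PY := ('X_(inord 3) : P).
Local Notation "c %:k" := (c%:MP_[2] : k) (at level 2).
Local Notation x := (H_x hz).
Local Notation y := (H_y hz).
Local Notation X := (H_X hz).
Local Notation Y := (H_Y hz).
Local Notation w := (@H_w K zeta hz).
Local Notation apbw := (apbw x y X Y w).
Local Notation kap := (kap w).

Lemma H_vec_form_kap (u : 'cV[C]_2) (U : 'rV[C]_2) (c : nat -> C) :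
  (forall j, (u 0 0 - zeta ^+ j * u 1 0) * (zeta ^+ (3 * j) * U 0 1 - U 0 0) = c j) ->
  H_vec hz u * H_form hz U = H_form hz U * H_vec hz u + kap c.
Proof.
move=> e; apply: etrans (H_vec_form hz u U) _.
exact: (congr1 (+%R (H_form hz U * H_vec hz u)) (eq_kap w e)).
Qed.
Lemma dcol (i j : 'I_2) : (delta_mx i 0 : 'cV[C]_2) j 0 = (j == i)%:R.
Proof. by rewrite mxE eqxx andbT. Qed.
Lemma drow (i j : 'I_2) : (delta_mx 0 i : 'rV[C]_2) 0 j = (j == i)%:R.
Proof. by rewrite mxE. Qed.

Lemma H_xX : x * X = X * x - kap (fun=> 1).
Proof.
rewrite kapN; apply: H_vec_form_kap => j; rewrite !dcol !drow /=; ring.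
Qed.
Lemma H_xY : x * Y = Y * x + kap (fun j => zeta ^+ (3 * j)).
Proof. by apply: H_vec_form_kap => j; rewrite !dcol !drow /=; ring. Qed.
Lemma H_yX : y * X = X * y + kap (fun j => zeta ^+ j).
Proof. by apply: H_vec_form_kap => j; rewrite !dcol !drow /=; ring. Qed.
Lemma H_yY : y * Y = Y * y - kap (fun=> 1).
Proof.
rewrite kapN; apply: H_vec_form_kap => j; rewrite !dcol !drow /=.
by rewrite !(mulr1, mulr0, subr0, sub0r) mulNr mulrC zexp.
Qed.

Lemma H_apbw_surj h : exists F, apbw F = h.
Proof.
exact: (apbw_surj (@H_w1 _ _ hz) (@H_wM _ _ hz) (@H_wx _ _ hz) (@H_wy _ _ hz)
  (@H_wY _ _ hz) (@H_wX _ _ hz) (H_xy hz) (H_XY hz) H_xX H_xY H_yX H_yY (@H_gen_ind _ _ hz)).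
Qed.

Variables (G : fieldType) (frac : {rmorphism P -> G}).
Hypothesis frac_inj : injective frac.
Local Notation T := {poly G}.
Local Notation rho := (@rho K zeta hz G frac).
Local Notation gX g := (mvX (hz := hz) (iotaP K) PX PY g).
Local Notation gY g := (mvY (hz := hz) (iotaP K) PX PY g).

Lemma rho_inj : injective rho.
Proof.
move=> h h' e; apply: subr0_eq; have [F eF] := H_apbw_surj (h - h').
suff F0 : F = 0 by rewrite -eF F0 apbw0.
apply: degb0; apply: (degb_size frac_inj) => u; rewrite eF.
rewrite (_ : h - h' = -1 *: h' + h); last by rewrite scaleN1r addrC.
by rewrite (rho_linear frac_inj) e scaleN1r addNr went0 size_poly0.
Qed.

(** The orbit is free already in the coordinates X, Y: these are independent variables, so their
    coefficients recover the matrix of g. *)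
Lemma gXY_inj (g h : W) : gX g = gX h -> gY g = gY h -> g = h.
Proof.
have lf (a b c d : C) : iotaP K a%:k * PY + iotaP K b%:k * PX =
    iotaP K c%:k * PY + iotaP K d%:k * PX -> a = c /\ b = d.
  move=> e; have : iotaP K (a - c)%:k * PY + iotaP K (b - d)%:k * PX = 0.
    exact: (morph_lin2 (f := cst (iotaP K))).
  move=> e'; have [h1 h2] := lin_free inord32 e'.
  by split; [exact: subr0_eq h1 | exact: subr0_eq h2].
move=> /lf [e01 e11] /lf [e00 e10]; apply: W_eq; exact: mx2P.
Qed.

(** Commuting with the multiplications by X and Y, which separate the points of the orbit, forces a
    diagonal matrix; commuting with the permutation matrices makes the diagonal constant. *)
Lemma rho_scalar z : centre z -> rho z = (went (rho z) 1%g 1%g)%:M.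
Proof.
move=> cz; set M := rho z.
have comm h : M * rho h = rho h * M by rewrite -!(rhoM frac_inj) cz.
have offdiag g h : g != h -> went M g h = 0.
  move=> gh; have := comm X; rewrite (rho_form hz frac_inj) => cX.
  have := comm Y; rewrite (rho_form hz frac_inj) => cY.
  have dX g' : mform (iotaT frac) (tX frac) (tY frac) (delta_mx 0 0) g' =
      (frac (gX g'))%:P by rewrite mform_delta0; apply: mvXT.
  have dY g' : mform (iotaT frac) (tX frac) (tY frac) (delta_mx 0 1) g' =
      (frac (gY g'))%:P by rewrite mform_delta1; apply: mvYT.
  have [//|/frac_inj eX] := diag_comm dX cX g h.
  have [//|/frac_inj eY] := diag_comm dY cY g h.
  by move: gh; rewrite (gXY_inj eX eY) eqxx.
have diag g : went M g g = went M 1%g 1%g.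
  have := comm (w g); rewrite (rho_w frac_inj) => e.
  by have := went_mulpr M g 1%g 1%g; rewrite e went_mulpl mul1g.
apply: went_inj => g h; rewrite went_scalar; case: eqP => [<-|/eqP gh].
  by rewrite diag mul1r.
by rewrite offdiag // mul0r.
Qed.

Definition hat (z : H) : T := went (rho z) 1%g 1%g.

Lemma hat_inj z z' : centre z -> centre z' -> hat z = hat z' -> z = z'.
Proof.
by move=> cz cz' e; apply: rho_inj; rewrite (rho_scalar cz) (rho_scalar cz') -/(hat z) e.
Qed.
Lemma hatM z z' : centre z -> hat (z * z') = hat z * hat z'.
Proof.
move=> cz; rewrite /hat (rhoM frac_inj) {1}(rho_scalar cz).
exact: went_scalarM.
Qed.
Lemma hatD z z' : hat (z + z') = hat z + hat z'.
Proof. by rewrite /hat (rhoD frac_inj) wentD. Qed.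
Lemma hatZ c z : hat (c *: z) = iotaT frac c * hat z.
Proof. by rewrite /hat (rhoZ frac_inj) wentZ. Qed.
Lemma hat1 : hat 1 = 1.
Proof. by rewrite /hat (rho1 hz frac_inj) went1 eqxx. Qed.
Lemma hat0 : hat 0 = 0.
Proof. by rewrite /hat (rho0 hz frac_inj) went0. Qed.

Lemma trunc_lin : linear (@trunc K zeta hz).
Proof.
exact: (atr_linear (@H_w1 _ _ hz) (@H_wM _ _ hz) (@H_wx _ _ hz) (@H_wy _ _ hz)
  (@H_wY _ _ hz) (@H_wX _ _ hz) (H_xy hz) (H_XY hz) H_xX H_xY H_yX H_yY
  (@H_gen_ind _ _ hz) (H_apbw_inj frac_inj)).
Qed.
Lemma trunc_u4 al be : trunc ((al%:k *: x + be%:k *: Y) ^+ 4) =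
  (al%:k *: Px + be%:k *: PY) ^+ 4 +
  (al%:k ^+ 2 * be%:k ^+ 2) *: (2%:R * dAB K)%:MP.
Proof.
exact: (atr_u4 (@H_w1 _ _ hz) (@H_wM _ _ hz) (@H_wx _ _ hz) (@H_wy _ _ hz)
  (@H_wY _ _ hz) (@H_wX _ _ hz) (H_xy hz) (H_XY hz) H_xX H_xY H_yX H_yY
  (@H_gen_ind _ _ hz) (H_apbw_inj frac_inj)).
Qed.
Lemma trunc_v4 al be : trunc ((al%:k *: y + be%:k *: X) ^+ 4) =
  (al%:k *: Py + be%:k *: PX) ^+ 4 +
  (al%:k ^+ 2 * be%:k ^+ 2) *: (2%:R * dAB K)%:MP.
Proof.
exact: (atr_v4 (@H_w1 _ _ hz) (@H_wM _ _ hz) (@H_wx _ _ hz) (@H_wy _ _ hz)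
  (@H_wY _ _ hz) (@H_wX _ _ hz) (H_xy hz) (H_XY hz) H_xX H_xY H_yX H_yY
  (@H_gen_ind _ _ hz) (H_apbw_inj frac_inj)).
Qed.
Lemma trunc_eu : trunc (x * X + Y * y) = Px * PX + Py * PY.
Proof.
exact: (atr_eu (@H_w1 _ _ hz) (@H_wM _ _ hz) (@H_wx _ _ hz) (@H_wy _ _ hz)
  (@H_wY _ _ hz) (@H_wX _ _ hz) (H_xy hz) (H_XY hz) H_xX H_xY H_yX H_yY
  (@H_gen_ind _ _ hz) (H_apbw_inj frac_inj)).
Qed.

Definition uu (al be : C) : H := al%:k *: x + be%:k *: Y.
Definition vv (al be : C) : H := al%:k *: y + be%:k *: X.
Lemma central_uv al be : centre (uu al be * vv al be) /\
  centre (uu al be ^+ 4 + vv al be ^+ 4).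
Proof.
have h := comm2_all (@H_wx _ _ hz) (@H_wy _ _ hz)
  (@H_wY _ _ hz) (@H_wX _ _ hz) (H_xy hz) (H_XY hz) H_xX H_xY H_yX H_yY
  (@H_gen_ind _ _ hz) al be.
by split=> t; have [] := h t.
Qed.

Lemma pbw_invK (z : H) : apbw (pbw_inv z) = z.
Proof.
exact: (apbw_ainv (@H_w1 _ _ hz) (@H_wM _ _ hz) (@H_wx _ _ hz) (@H_wy _ _ hz)
  (@H_wY _ _ hz) (@H_wX _ _ hz) (H_xy hz) (H_XY hz) H_xX H_xY H_yX H_yY
  (@H_gen_ind _ _ hz)).
Qed.

(** The matrix of z is scalar, so the top part of every component F u with u different from 1
    vanishes, while F 1 is 0 by assumption. Repeating this lowers the degree bound down to 0. *)
Lemma trunc0_eq0 (z : H) : centre z -> trunc z = 0 -> z = 0.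
Proof.
move=> cz; rewrite /trunc; have eF := pbw_invK z; move: (pbw_inv z) eF => F eF F1.
have sc u : went (rho z) 1%g u = (1%g == u)%:R * hat z.
  by rewrite [in LHS](rho_scalar cz) went_scalar.
have [N hN] := degb_bound F; suff F0 : F = 0 by rewrite -eF F0 apbw0.
elim: N hN => [|N IH] hN; first exact: degb0.
apply/IH/(degb_step frac_inj) => // u; rewrite eF sc.
have [_|_] := eqVneq 1%g u; last by rewrite mul0r size_poly0.
rewrite mul1r; apply: plead_leq.
have := mlead_apbw frac_inj hN 1%g 1%g; rewrite eF mulVg F1.
rewrite (_ : top N 0 = 0); last by rewrite /top msupp0 big_nil.
by rewrite !rmorph0.
Qed.

(** This is how the generators defined by [trunc_inv] become explicit: a central element with the
    right Trunc suffices. *)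
Lemma trunc_invE (z : H) f : centre z -> trunc z = f -> trunc_inv hz f = z.
Proof.
move=> cz tz; rewrite /trunc_inv; case: xgetP => [z' _ [cz' tz']|/(_ z) []]; last by split.
have truncB : trunc (-1 *: z + z' : H) = 0.
  by rewrite trunc_lin tz tz' scaleN1r addNr.
have cB : centre (-1 *: z + z' : H).
  by move=> h; rewrite mulrDl mulrDr -scalerAl -scalerAr cz cz'.
by have /eqP := trunc0_eq0 cB truncB; rewrite addrC scaleN1r subr_eq0 => /eqP.
Qed.
End Centre.

(** * The scalars of the generators *)

Section DunklPowers.
Variable T : comNzRingType.

(* [dunklUn] and [dunklVn] are the values of u^n and v^n on the constant function 1;
   a and b stand for A / (X^2 - Y^2) and B / (X^2 + Y^2). *)
Definition dunklU1 (u v X Y a b : T) : T :=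
  u + 2%:R * X * a + 2%:R * X * b.
Definition dunklV1 (u v X Y a b : T) : T :=
  v - 2%:R * Y * a + 2%:R * Y * b.
Definition dunklU2 (u v X Y a b : T) : T :=
  u ^+ 2 + 2%:R * u * X * a + 2%:R * u * X * b + 2%:R * v * Y * a + 2%:R * v
  * Y * b - 4%:R * Y ^+ 2 * a ^+ 2 + 4%:R * Y ^+ 2 * b ^+ 2.
Definition dunklV2 (u v X Y a b : T) : T :=
  - 2%:R * u * X * a + 2%:R * u * X * b + v ^+ 2 - 2%:R * v * Y * a + 2%:R *
  v * Y * b - 4%:R * X ^+ 2 * a ^+ 2 + 4%:R * X ^+ 2 * b ^+ 2.
Definition dunklU3 (u v X Y a b : T) : T :=
  u ^+ 3 + 2%:R * u ^+ 2 * X * a + 2%:R * u ^+ 2 * X * b + 2%:R * u * v * Y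
  * a + 2%:R * u * v * Y * b - 4%:R * u * X ^+ 2 * a ^+ 2 + 8%:R * u * X ^+
  2 * a * b - 4%:R * u * X ^+ 2 * b ^+ 2 - 4%:R * u * Y ^+ 2 * a ^+ 2 + 4%:R
  * u * Y ^+ 2 * b ^+ 2 + 2%:R * v ^+ 2 * X * a - 2%:R * v ^+ 2 * X * b -
  4%:R * v * X * Y * a ^+ 2 + 8%:R * v * X * Y * a * b - 4%:R * v * X * Y *
  b ^+ 2 - 8%:R * X ^+ 3 * a ^+ 3 + 8%:R * X ^+ 3 * a ^+ 2 * b + 8%:R * X ^+
  3 * a * b ^+ 2 - 8%:R * X ^+ 3 * b ^+ 3.
Definition dunklV3 (u v X Y a b : T) : T :=
  - 2%:R * u ^+ 2 * Y * a - 2%:R * u ^+ 2 * Y * b - 2%:R * u * v * X * a +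
  2%:R * u * v * X * b - 4%:R * u * X * Y * a ^+ 2 - 8%:R * u * X * Y * a *
  b - 4%:R * u * X * Y * b ^+ 2 + v ^+ 3 - 2%:R * v ^+ 2 * Y * a + 2%:R * v
  ^+ 2 * Y * b - 4%:R * v * X ^+ 2 * a ^+ 2 + 4%:R * v * X ^+ 2 * b ^+ 2 -
  4%:R * v * Y ^+ 2 * a ^+ 2 - 8%:R * v * Y ^+ 2 * a * b - 4%:R * v * Y ^+ 2
  * b ^+ 2 + 8%:R * Y ^+ 3 * a ^+ 3 + 8%:R * Y ^+ 3 * a ^+ 2 * b - 8%:R * Y
  ^+ 3 * a * b ^+ 2 - 8%:R * Y ^+ 3 * b ^+ 3.

Section Step.
Variables (z : T) (F : T -> T -> T -> T -> T -> T -> T).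
(* The action of u and v on a function [F] of the six quantities, which the four
   reflections permute up to roots of unity. *)
Definition stepU u v X Y a b : T := u * F u v X Y a b +
  a * ((X + Y) * F v u Y X (- a) b + (X - Y) * F (- v) (- u) (- Y) (- X) (- a) b) +
  b * ((X + z * Y) * F (- z * v) (z * u) (z * Y) (- z * X) a (- b) +
       (X - z * Y) * F (z * v) (- z * u) (- z * Y) (z * X) a (- b)).
Definition stepV u v X Y a b : T := v * F u v X Y a b -
  a * ((X + Y) * F v u Y X (- a) b - (X - Y) * F (- v) (- u) (- Y) (- X) (- a) b) -
  z * b * ((X + z * Y) * F (- z * v) (z * u) (z * Y) (- z * X) a (- b) -
           (X - z * Y) * F (z * v) (- z * u) (- z * Y) (z * X) a (- b)).
End Step.

(* The scalars of u^4 + v^4 and of u v; a2 and b2 stand for a^2 and b^2. *)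
Definition dunklR (u v X Y a2 b2 : T) : T := u ^+ 4 + v ^+ 4
  - 16%:R * (a2 + b2) * u * v * X * Y
  - 8%:R * (a2 + b2) * (u ^+ 2 * X ^+ 2 + v ^+ 2 * Y ^+ 2)
  - 8%:R * (a2 - b2) * (u ^+ 2 * Y ^+ 2 + v ^+ 2 * X ^+ 2)
  + 16%:R * (a2 - b2) ^+ 2 * (X ^+ 4 + Y ^+ 4).
Definition dunklQ (u v X Y a2 b2 : T) : T := u * v + 4%:R * X * Y * (a2 - b2).

Variable z : T.
Hypothesis z2 : z * z = -1.
Variables u v X Y a b : T.
Lemma stepU1 : stepU z (fun _ _ _ _ _ _ => 1) u v X Y a b = dunklU1 u v X Y a b.
Proof. by rewrite /stepU /dunklU1; ring: z2. Qed.
Lemma stepV1 : stepV z (fun _ _ _ _ _ _ => 1) u v X Y a b = dunklV1 u v X Y a b.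
Proof. by rewrite /stepV /dunklV1; ring: z2. Qed.
Lemma stepU2 : stepU z dunklU1 u v X Y a b = dunklU2 u v X Y a b.
Proof. by rewrite /stepU /dunklU1 /dunklU2; ring: z2. Qed.
Lemma stepV2 : stepV z dunklV1 u v X Y a b = dunklV2 u v X Y a b.
Proof. by rewrite /stepV /dunklV1 /dunklV2; ring: z2. Qed.
Lemma stepU3 : stepU z dunklU2 u v X Y a b = dunklU3 u v X Y a b.
Proof. by rewrite /stepU /dunklU2 /dunklU3; ring: z2. Qed.
Lemma stepV3 : stepV z dunklV2 u v X Y a b = dunklV3 u v X Y a b.
Proof. by rewrite /stepV /dunklV2 /dunklV3; ring: z2. Qed.
Lemma stepUV4 : stepU z dunklU3 u v X Y a b + stepV z dunklV3 u v X Y a b =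
  dunklR u v X Y (a ^+ 2) (b ^+ 2).
Proof. by rewrite /stepU /stepV /dunklU3 /dunklV3 /dunklR; ring: z2. Qed.
Lemma stepUV : stepU z dunklV1 u v X Y a b = dunklQ u v X Y (a ^+ 2) (b ^+ 2).
Proof. by rewrite /stepU /dunklV1 /dunklQ; ring: z2. Qed.
End DunklPowers.

Section DunklOne.
Variables (K : realType) (zeta : K[i]) (hz : 4.-primitive_root zeta).
Local Notation C := K[i].
Local Notation W := (dihedral hz).
Local Notation k := {mpoly C[2]}.
Variables (T : comNzRingType) (iota : {rmorphism k -> T}) (x y X Y : T).
Local Notation cst := (cst iota).
Local Notation z := (cst zeta).
Local Notation mvx := (mvx (hz := hz) iota x y).
Local Notation mvy := (mvy (hz := hz) iota x y).
Local Notation mvX := (mvX (hz := hz) iota X Y).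
Local Notation mvY := (mvY (hz := hz) iota X Y).
Variable il : W -> nat -> T.
Hypothesis ilP : forall g j, il g j * (mvX g - z ^+ j * mvY g) = 1.
Variables al be : C.
Definition ug g : T := cst al * mvx g + cst be * mvY g.
Definition vg g : T := cst al * mvy g + cst be * mvX g.
(** The product [il g 0 * il g 2] is the inverse of X^2 - Y^2 at g. Pairing the two roots of a
    conjugacy class leaves one function per class; the factor al appears because only the vector
    part of u carries reflections. *)
Definition ag g : T := cst al * par iota 0 * (il g 0 * il g 2).
Definition bg g : T := cst al * par iota 1 * (il g 1 * il g 3).

Definition Mu : restr iota 'M[T]_((wdim W).+1) :=
  al%:MP_[2] *: dunkl iota x y il (delta_mx 0 0) +
  be%:MP_[2] *: dform hz iota X Y (delta_mx 0 1).
Definition Mv : restr iota 'M[T]_((wdim W).+1) :=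
  al%:MP_[2] *: dunkl iota x y il (delta_mx 1 0) +
  be%:MP_[2] *: dform hz iota X Y (delta_mx 0 0).

(** Each inverse root is rewritten over the common denominator of its class, as in 1 / (X - Y) = (X
    + Y) / (X^2 - Y^2). *)
Lemma il_lin g : [/\ il g 0 = (mvX g + mvY g) * (il g 0 * il g 2),
  il g 2 = (mvX g - mvY g) * (il g 0 * il g 2),
  il g 1 = (mvX g + z * mvY g) * (il g 1 * il g 3) &
  il g 3 = (mvX g - z * mvY g) * (il g 1 * il g 3)].
Proof.
have := (ilP g 0, ilP g 1, ilP g 2, ilP g 3).
rewrite expr0 expr1 expr2 z2 // (exprS _ 2) expr2 z2 //.
move: (il g 0) (il g 1) (il g 2) (il g 3) (mvX g) (mvY g) => i0 i1 i2 i3 a b.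
case=> [[[h0 h1] h2] h3]; split.
- by rewrite -[LHS]mulr1 -h2; ring.
- by rewrite -[LHS]mulr1 -h0; ring.
- by rewrite -[LHS]mulr1 -h3; ring.
- by rewrite -[LHS]mulr1 -h1; ring.
Qed.

Lemma wact_Mu f g : wact Mu f g = ug g * f g +
  ag g * ((mvX g + mvY g) * f (g * s_ hz 0)%g + (mvX g - mvY g) * f (g * s_ hz 2)%g) +
  bg g * ((mvX g + z * mvY g) * f (g * s_ hz 1)%g +
          (mvX g - z * mvY g) * f (g * s_ hz 3)%g).
Proof.
rewrite /Mu [LHS]wactD ![_%:MP_[_] *: _]restr_scaleE !wactZ.
rewrite wact_dunkl wact_dform mvec_delta0 mform_delta1.
rewrite !big_ord_recl big_ord0 /= /bump /= !mxE /= !mulr0 !subr0.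
have [e0 e2 e1 e3] := il_lin g.
rewrite !(par_mod iota 2, par_mod iota 3); evaln.
rewrite /ug /ag /bg; move: e0 e1 e2 e3.
move: (il g 0 * il g 2) (il g 1 * il g 3) => p q -> -> -> ->.
rewrite !rmorph1; ring.
Qed.

Lemma wact_Mv f g : wact Mv f g = vg g * f g -
  ag g * ((mvX g + mvY g) * f (g * s_ hz 0)%g - (mvX g - mvY g) * f (g * s_ hz 2)%g) -
  z * bg g * ((mvX g + z * mvY g) * f (g * s_ hz 1)%g -
          (mvX g - z * mvY g) * f (g * s_ hz 3)%g).
Proof.
rewrite /Mv [LHS]wactD ![_%:MP_[_] *: _]restr_scaleE !wactZ.
rewrite wact_dunkl wact_dform mvec_delta1 mform_delta0.
rewrite !big_ord_recl big_ord0 /= /bump /= !mxE /= !mulr1 !sub0r.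
have [e0 e2 e1 e3] := il_lin g.
rewrite !(par_mod iota 2, par_mod iota 3); evaln.
rewrite /vg /ag /bg; move: e0 e1 e2 e3.
move: (il g 0 * il g 2) (il g 1 * il g 3) => p q -> -> -> ->.
rewrite !mpolyCN !rmorphN expr0 expr1 -!/(cst _) !rmorphXn.
have h2 := z2 hz iota; have h3 : z ^+ 3 = - z by ring: h2.
rewrite h3 expr2 h2 rmorph1; ring.
Qed.

Lemma ug_s g j : ug (g * s_ hz j)%g = z ^+ (3 * j) * vg g.
Proof. by rewrite /ug /vg mvx_s mvY_s; ring. Qed.
Lemma vg_s g j : vg (g * s_ hz j)%g = z ^+ j * ug g.
Proof. by rewrite /ug /vg mvy_s mvX_s; ring. Qed.
(** The reflections s_0 and s_2 change the sign of X^2 - Y^2, while s_1 and s_3 fix it; for X^2 +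
    Y^2 the roles are exchanged. *)
Lemma ag_s g j : (j < 4)%N -> ag (g * s_ hz j)%g = (if odd j then ag g else - ag g).
Proof.
have h2 := z2 hz iota; case: j => [|[|[|[|//]]]] _ /=;
  by rewrite /ag !(il_s ilP); evaln; ring: h2.
Qed.
Lemma bg_s g j : (j < 4)%N -> bg (g * s_ hz j)%g = (if odd j then - bg g else bg g).
Proof.
have h2 := z2 hz iota; case: j => [|[|[|[|//]]]] _ /=;
  by rewrite /bg !(il_s ilP); evaln; ring: h2.
Qed.

Definition fval F g : T := F (ug g) (vg g) (mvX g) (mvY g) (ag g) (bg g).

Lemma zpow : (z ^+ 3 = - z) * (z ^+ 6 = -1) * (z ^+ 9 = z) * (z ^+ 2 = -1).
Proof.
have h2 := z2 hz iota; have h3 : z ^+ 3 = - z by ring: h2.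
split; [split; [split|]|] => //.
- by ring: h2.
- by ring: h2.
Qed.

Lemma fval_s F g : [/\
  fval F (g * s_ hz 0)%g = F (vg g) (ug g) (mvY g) (mvX g) (- ag g) (bg g),
  fval F (g * s_ hz 1)%g = F (- z * vg g) (z * ug g) (z * mvY g) (- z * mvX g) (ag g) (- bg g),
  fval F (g * s_ hz 2)%g = F (- vg g) (- ug g) (- mvY g) (- mvX g) (- ag g) (bg g) &
  fval F (g * s_ hz 3)%g = F (z * vg g) (- z * ug g) (- z * mvY g) (z * mvX g) (ag g) (- bg g)].
Proof.
split; rewrite /fval ug_s vg_s ag_s // bg_s // mvX_s mvY_s; evaln.
- by rewrite expr0 !mul1r.
- by rewrite expr1 !zpow.
- by rewrite !zpow !mulN1r.
- by rewrite !zpow.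
Qed.

Lemma wact_Mu_fval F g : wact Mu (fval F) g = fval (stepU z F) g.
Proof. by rewrite wact_Mu /stepU; have [-> -> -> ->] := fval_s F g. Qed.
Lemma wact_Mv_fval F g : wact Mv (fval F) g = fval (stepV z F) g.
Proof. by rewrite wact_Mv /stepV; have [-> -> -> ->] := fval_s F g. Qed.

Lemma wact_uv (A : restr iota 'M[T]_((wdim W).+1)) : A = Mu * Mv ->
  forall g, wact A (fun=> 1) g =
    dunklQ (ug g) (vg g) (mvX g) (mvY g) (ag g ^+ 2) (bg g ^+ 2).
Proof.
move=> -> g; rewrite [LHS]wactM.
have h2 := z2 hz iota; have e1 h : wact Mv (fun=> 1) h = fval (@dunklV1 T) h.
  by apply: etrans (wact_Mv_fval (fun _ _ _ _ _ _ => 1) h) (stepV1 h2 _ _ _ _ _ _).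
rewrite (wact_ext _ _ e1); apply: etrans (wact_Mu_fval _ _) (stepUV h2 _ _ _ _ _ _).
Qed.

Lemma wact_u4v4 g : wact (Mu ^+ 4 + Mv ^+ 4) (fun=> 1) g =
  dunklR (ug g) (vg g) (mvX g) (mvY g) (ag g ^+ 2) (bg g ^+ 2).
Proof.
have h2 := z2 hz iota; rewrite [LHS]wactD !exprS !expr0 !mulr1.
have u1 h : wact Mu (fun=> 1) h = fval (@dunklU1 T) h.
  exact: etrans (wact_Mu_fval (fun _ _ _ _ _ _ => 1) h) (stepU1 h2 _ _ _ _ _ _).
have u2 h : wact Mu (wact Mu (fun=> 1)) h = fval (@dunklU2 T) h.
  by rewrite (wact_ext _ _ u1); apply: etrans (wact_Mu_fval _ _) (stepU2 h2 _ _ _ _ _ _).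
have u3 h : wact Mu (wact Mu (wact Mu (fun=> 1))) h = fval (@dunklU3 T) h.
  by rewrite (wact_ext _ _ u2); apply: etrans (wact_Mu_fval _ _) (stepU3 h2 _ _ _ _ _ _).
have v1 h : wact Mv (fun=> 1) h = fval (@dunklV1 T) h.
  exact: etrans (wact_Mv_fval (fun _ _ _ _ _ _ => 1) h) (stepV1 h2 _ _ _ _ _ _).
have v2 h : wact Mv (wact Mv (fun=> 1)) h = fval (@dunklV2 T) h.
  by rewrite (wact_ext _ _ v1); apply: etrans (wact_Mv_fval _ _) (stepV2 h2 _ _ _ _ _ _).
have v3 h : wact Mv (wact Mv (wact Mv (fun=> 1))) h = fval (@dunklV3 T) h.
  by rewrite (wact_ext _ _ v2); apply: etrans (wact_Mv_fval _ _) (stepV3 h2 _ _ _ _ _ _).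
have ww (A : restr iota 'M[T]_((wdim W).+1)) h :
    wact (A * (A * (A * A))) (fun=> 1) h = wact A (wact A (wact A (wact A (fun=> 1)))) h.
  rewrite [LHS]wactM; apply: wact_ext => h'; rewrite [LHS]wactM; apply: wact_ext => h''.
  exact: wactM.
rewrite !ww (wact_ext _ _ u3) (wact_ext _ _ v3) wact_Mu_fval wact_Mv_fval.
exact: stepUV4 h2 _ _ _ _ _ _.
Qed.
End DunklOne.

(** A substitute for division: c stays a symbol, and the goal becomes a polynomial identity
    containing c on both sides. *)
Lemma unit_mulr_eq (R : comNzRingType) (c n a b : R) :
  c * n = 1 -> a = c * n * b -> a = b.
Proof. by move=> -> ->; rewrite mul1r. Qed.

(** * Fourier inversion over the fourth roots of unity *)

Section Fourier.
Variables (R : comNzRingType) (z c16 c24 c23 : R).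
Hypotheses (z2 : z * z = -1) (h16 : c16 * 16%:R = 1) (h24 : c24 * 24%:R = 1)
  (h23 : c23 * 3%:R = 2%:R).
Definition fourier1 (E : R -> R) := c16 * (E 1 - E (-1) - z * (E z - E (- z))).
Definition fourier3 (E : R -> R) := c16 * (E 1 - E (-1) + z * (E z - E (- z))).
Definition fourier2 (E : R -> R) D :=
  c24 * (E 1 + E (-1) - E z - E (- z)) - c23 * D.
Variables x y X Y D a b : R.
Definition pencilP s := (x + s * Y) ^+ 4 + (y + s * X) ^+ 4 + s ^+ 2 * 4%:R * D.
Definition pencilT s := dunklR (x + s * Y) (y + s * X) X Y a b.

(** As 2/3 = 16/24, a single inverse constant remains in the identities for a_2. *)
Let h23' : c23 = 16%:R * c24.
Proof.
apply: esym; apply: (unit_mulr_eq h24); transitivity (c24 * 8%:R * (c23 * 3%:R)).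
  by rewrite h23; ring.
by ring.
Qed.

Lemma fourierP1 : fourier1 pencilP = x ^+ 3 * Y ^+ 1 + y ^+ 3 * X ^+ 1.
Proof.
apply: (unit_mulr_eq h16); rewrite /fourier1 /pencilP.
ring: z2.
Qed.
Lemma fourierP3 : fourier3 pencilP = x ^+ 1 * Y ^+ 3 + y ^+ 1 * X ^+ 3.
Proof.
apply: (unit_mulr_eq h16); rewrite /fourier3 /pencilP.
ring: z2.
Qed.
Lemma fourierP2 : fourier2 pencilP D = x ^+ 2 * Y ^+ 2 + y ^+ 2 * X ^+ 2.
Proof.
apply: (unit_mulr_eq h24); rewrite /fourier2 h23' /pencilP.
ring: z2.
Qed.
Definition hata1 : R := x ^+ 3 * Y + y ^+ 3 * X
  - 8%:R * (a + b) * (x * X + y * Y) * X * Y - 4%:R * (a - b) * (x * Y ^+ 3 + y * X ^+ 3).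
Definition hata2 : R := x ^+ 2 * Y ^+ 2 + y ^+ 2 * X ^+ 2
  - 4%:R * (a + b) * X ^+ 2 * Y ^+ 2 - 2%:R * (a - b) * (X ^+ 4 + Y ^+ 4).
Definition hata3 : R := x * Y ^+ 3 + y * X ^+ 3.
Lemma fourierT1 : fourier1 pencilT = hata1.
Proof.
apply: (unit_mulr_eq h16); rewrite /fourier1 /pencilT /dunklR /hata1.
ring: z2.
Qed.
Lemma fourierT3 : fourier3 pencilT = hata3.
Proof.
apply: (unit_mulr_eq h16); rewrite /fourier3 /pencilT /dunklR /hata3.
ring: z2.
Qed.
Lemma fourierT2 : D = a * (X ^+ 2 - Y ^+ 2) ^+ 2 - b * (X ^+ 2 + Y ^+ 2) ^+ 2 ->
  fourier2 pencilT D = hata2.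
Proof.
move=> ->; apply: (unit_mulr_eq h24); rewrite /fourier2 h23' /pencilT /dunklR /hata2.
ring: z2.
Qed.

Lemma hat_relations (A2 B2 : R) :
  A2 = a * (X ^+ 2 - Y ^+ 2) ^+ 2 -> B2 = b * (X ^+ 2 + Y ^+ 2) ^+ 2 ->
  let q := dunklQ x y X Y a b in let r := dunklR x y X Y a b in
  let Q := X * Y in let S := X ^+ 4 + Y ^+ 4 in let eu := x * X + y * Y in
  let a1 := hata1 in let a2 := hata2 in let a3 := hata3 in
  [/\ [/\ eu * a1 = q * a2 + r * Q - 2%:R * (A2 - B2) * q,
          eu * a2 = q * a3 + Q * a1 - 2%:R * (A2 - B2) * eu &
          eu * a3 = q * S + Q * a2 - 2%:R * (A2 - B2) * Q],
      [/\ a1 ^+ 2 = r * a2 - q ^+ 2 * eu ^+ 2 + 4%:R * q ^+ 3 * Q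
            + 2%:R * (A2 - B2) * r + 8%:R * (A2 + B2) * q ^+ 2,
          a1 * a2 = r * a3 - q * eu ^+ 3 + 4%:R * q ^+ 2 * Q * eu
            + 2%:R * (A2 - B2) * a1 + 8%:R * (A2 + B2) * q * eu &
          a1 * a3 = r * S - eu ^+ 4 + 5%:R * q * Q * eu ^+ 2 - 4%:R * q ^+ 2 * Q ^+ 2
            + 4%:R * (A2 - B2) * a2 + 8%:R * (A2 + B2) * eu ^+ 2
            - 8%:R * (A2 + B2) * q * Q - 8%:R * (A2 - B2) ^+ 2] &
      [/\ a2 ^+ 2 = r * S - eu ^+ 4 + 4%:R * q * Q * eu ^+ 2
            + 4%:R * (A2 - B2) * a2 + 8%:R * (A2 + B2) * eu ^+ 2
            - 4%:R * (A2 - B2) ^+ 2,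
          a2 * a3 = S * a1 - Q * eu ^+ 3 + 4%:R * q * Q ^+ 2 * eu
            + 2%:R * (A2 - B2) * a3 + 8%:R * (A2 + B2) * Q * eu &
          a3 ^+ 2 = S * a2 - Q ^+ 2 * eu ^+ 2 + 4%:R * q * Q ^+ 3
            + 2%:R * (A2 - B2) * S + 8%:R * (A2 + B2) * Q ^+ 2]].
Proof.
move=> -> -> q r Q S eu a1 a2 a3.
rewrite /a1 /a2 /a3 /eu /S /Q /r /q /hata1 /hata2 /hata3 /dunklQ /dunklR.
split; split.
all: ring.
Qed.
End Fourier.

Lemma congr_fun6 (A B : Type) (f : A -> A -> A -> A -> A -> A -> B) a b c d e h a' b' c' d' e' h' :
  a = a' -> b = b' -> c = c' -> d = d' -> e = e' -> h = h' ->
  f a b c d e h = f a' b' c' d' e' h'.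
Proof. by move=> -> -> -> -> -> ->. Qed.

(** * Identification of the generators with coefficients of the pencil *)

Section Generators.
Variables (K : realType) (zeta : K[i]) (hz : 4.-primitive_root zeta).
Local Notation C := K[i].
Local Notation W := (dihedral hz).
Local Notation k := {mpoly C[2]}.
Local Notation H := (cherednik hz).
Local Notation P := {mpoly k[4]}.
Local Notation Px := ('X_(inord 0) : P).
Local Notation Py := ('X_(inord 1) : P).
Local Notation PX := ('X_(inord 2) : P).
Local Notation PY := ('X_(inord 3) : P).
Local Notation "c %:k" := (c%:MP_[2] : k) (at level 2).
Local Notation x := (H_x hz).
Local Notation y := (H_y hz).
Local Notation X := (H_X hz).
Local Notation Y := (H_Y hz).
Variables (G : fieldType) (frac : {rmorphism P -> G}).
Hypothesis frac_inj : injective frac.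
Local Notation T := {poly G}.
Local Notation rho := (@rho K zeta hz G frac).
Local Notation hat := (@hat K zeta hz G frac).
Local Notation iT := (iotaT frac).
Local Notation cT := (cst iT).
Local Notation x0 := (tx frac).
Local Notation y0 := (ty frac).
Local Notation X0 := (tX frac).
Local Notation Y0 := (tY frac).
Local Notation il := (@il K zeta hz G frac).
Local Notation uu := (uu hz).
Local Notation vv := (vv hz).

Lemma hat_wact z : centre z -> hat z = wact (rho z) (fun=> 1) 1%g.
Proof. by move=> cz; rewrite (rho_scalar frac_inj cz) wact_scalar mulr1 -/(hat z). Qed.

(* [aT] is A / (X^2 - Y^2) and [bT] is B / (X^2 + Y^2). *)
Definition aT : T := par iT 0 * (il 1%g 0 * il 1%g 2).
Definition bT : T := par iT 1 * (il 1%g 1 * il 1%g 3).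

Lemma rho_uu al be : rho (uu al be) = Mu iT x0 y0 X0 Y0 il al be.
Proof.
rewrite /uu (rhoD frac_inj) !(rhoZ frac_inj).
by rewrite [rho x](rho_vec hz frac_inj) [rho Y](rho_form hz frac_inj).
Qed.
Lemma rho_vv al be : rho (vv al be) = Mv iT x0 y0 X0 Y0 il al be.
Proof.
rewrite /vv (rhoD frac_inj) !(rhoZ frac_inj).
by rewrite [rho y](rho_vec hz frac_inj) [rho X](rho_form hz frac_inj).
Qed.

Lemma ug1 al be : ug iT x0 y0 X0 Y0 al be (1%g : W) = cT al * x0 + cT be * Y0.
Proof.
have [ex _ _ _] := mv1 hz iT x0 y0; have [_ _ _ eY] := mv1 hz iT X0 Y0.
by rewrite /ug ex eY.
Qed.
Lemma vg1 al be : vg iT x0 y0 X0 Y0 al be (1%g : W) = cT al * y0 + cT be * X0.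
Proof.
have [_ ey _ _] := mv1 hz iT x0 y0; have [_ _ eX _] := mv1 hz iT X0 Y0.
by rewrite /vg ey eX.
Qed.
Lemma ag1 al : ag iT il al 1%g ^+ 2 = cT al ^+ 2 * aT ^+ 2.
Proof. by rewrite /ag -mulrA exprMn. Qed.
Lemma bg1 al : bg iT il al 1%g ^+ 2 = cT al ^+ 2 * bT ^+ 2.
Proof. by rewrite /bg -mulrA exprMn. Qed.

Lemma hat_uv al be : hat (uu al be * vv al be) =
  dunklQ (cT al * x0 + cT be * Y0) (cT al * y0 + cT be * X0) X0 Y0
    (cT al ^+ 2 * aT ^+ 2) (cT al ^+ 2 * bT ^+ 2).
Proof.
have [_ _ eX eY] := mv1 hz iT X0 Y0.
rewrite hat_wact; last exact: (central_uv hz al be).1.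
have e : rho (uu al be * vv al be) =
    Mu iT x0 y0 X0 Y0 il al be * Mv iT x0 y0 X0 Y0 il al be.
  by rewrite (rhoM frac_inj) rho_uu rho_vv.
apply: etrans (wact_uv (ilP frac_inj) e 1%g) _.
exact: congr_fun6 (ug1 _ _) (vg1 _ _) eX eY (ag1 _) (bg1 _).
Qed.

Lemma hat_u4v4 al be : hat (uu al be ^+ 4 + vv al be ^+ 4) =
  dunklR (cT al * x0 + cT be * Y0) (cT al * y0 + cT be * X0) X0 Y0
    (cT al ^+ 2 * aT ^+ 2) (cT al ^+ 2 * bT ^+ 2).
Proof.
have [_ _ eX eY] := mv1 hz iT X0 Y0.
rewrite hat_wact; last exact: (central_uv hz al be).2.
have e : rho (uu al be ^+ 4 + vv al be ^+ 4) =
    Mu iT x0 y0 X0 Y0 il al be ^+ 4 + Mv iT x0 y0 X0 Y0 il al be ^+ 4.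
  by rewrite (rhoD frac_inj) !(rhoX frac_inj) rho_uu rho_vv.
apply: etrans (congr1 (fun A => wact A (fun=> 1) 1%g) e) _.
apply: etrans (wact_u4v4 x0 y0 (ilP frac_inj) al be 1%g) _; exact: congr_fun6 (ug1 _ _) (vg1 _ _) eX eY (ag1 _) (bg1 _).
Qed.

Lemma inv_sq (R : comNzRingType) (A i0 i2 u v : R) :
  i0 * (u - 1 * v) = 1 -> i2 * (u - -1 * v) = 1 ->
  A ^+ 2 = (A * (i0 * i2)) ^+ 2 * (u ^+ 2 - v ^+ 2) ^+ 2.
Proof.
move=> h0 h2; have e : i0 * i2 * (u ^+ 2 - v ^+ 2) = 1.
  by transitivity ((i0 * (u - 1 * v)) * (i2 * (u - -1 * v)));
    [ring | rewrite h0 h2 mulr1].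
transitivity (A ^+ 2 * (i0 * i2 * (u ^+ 2 - v ^+ 2)) ^+ 2); last by ring.
by rewrite e expr1n mulr1.
Qed.
Lemma inv_sq' (R : comNzRingType) (A i1 i3 u v z : R) : z * z = -1 ->
  i1 * (u - z * v) = 1 -> i3 * (u - z * -1 * v) = 1 ->
  A ^+ 2 = (A * (i1 * i3)) ^+ 2 * (u ^+ 2 + v ^+ 2) ^+ 2.
Proof.
move=> h h1 h3; have e : i1 * i3 * (u ^+ 2 + v ^+ 2) = 1.
  by transitivity ((i1 * (u - z * v)) * (i3 * (u - z * -1 * v)));
    [ring: h | rewrite h1 h3 mulr1].
transitivity (A ^+ 2 * (i1 * i3 * (u ^+ 2 + v ^+ 2)) ^+ 2); last by ring.
by rewrite e expr1n mulr1.
Qed.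

Lemma il1P j : il 1%g j * (X0 - cT zeta ^+ j * Y0) = 1.
Proof.
have [_ _ eX eY] := mv1 hz iT X0 Y0; apply: etrans (ilP frac_inj (1%g : W) j).
exact: (congr1 (fun a => il 1%g j * a)
  (congr2 (fun a b => a - cT zeta ^+ j * b) (esym eX) (esym eY))).
Qed.
Lemma aT_sq : iT (parA K) ^+ 2 = aT ^+ 2 * (X0 ^+ 2 - Y0 ^+ 2) ^+ 2.
Proof.
have := il1P 0; have := il1P 2.
rewrite expr0 expr2 (z2 hz iT) => h2 h0.
exact: (inv_sq (iT (parA K)) h0 h2).
Qed.
Lemma bT_sq : iT (parB K) ^+ 2 = bT ^+ 2 * (X0 ^+ 2 + Y0 ^+ 2) ^+ 2.
Proof.
have := il1P 1; have := il1P 3.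
rewrite expr1 (exprS _ 2) expr2 (z2 hz iT) => h3 h1.
exact: (inv_sq' (iT (parB K)) (z2 hz iT) h1 h3).
Qed.

Lemma centreD (z z' : H) : centre z -> centre z' -> centre (z + z').
Proof. by move=> c c' h; rewrite mulrDl mulrDr c c'. Qed.
Lemma centreZ a (z : H) : centre z -> centre (a *: z).
Proof. by move=> c h; rewrite -scalerAl -scalerAr c. Qed.
Lemma centreM (z z' : H) : centre z -> centre z' -> centre (z * z').
Proof. by move=> c c' h; rewrite -mulrA c' mulrA c mulrA. Qed.
Lemma centre1 : centre (1 : H).
Proof. by move=> h; rewrite mul1r mulr1. Qed.
Lemma centre0 : centre (0 : H).
Proof. by move=> h; rewrite mul0r mulr0. Qed.
Lemma centreN (z : H) : centre z -> centre (- z).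
Proof. by rewrite -scaleN1r; apply: centreZ. Qed.

(* Trunc (EH s) = (x + s Y)^4 + (y + s X)^4 + 4 (A^2 - B^2) s^2, whose coefficients
   of s, s^2, s^3 are 4 a_1, 6 a_2 + 4 (A^2 - B^2) and 4 a_3; the sums over
   s = 1, -1, zeta, - zeta extract them. *)
Definition EH s : H := uu 1 s ^+ 4 + vv 1 s ^+ 4.
Definition i16 : C := 16%:R^-1.
Definition i24 : C := 24%:R^-1.
Definition i23 : C := 2%:R / 3%:R.
Definition Ha1 : H := i16%:k *: (EH 1 - EH (-1) - zeta%:k *: (EH zeta - EH (- zeta))).
Definition Ha3 : H := i16%:k *: (EH 1 - EH (-1) + zeta%:k *: (EH zeta - EH (- zeta))).
Definition Ha2 : H := i24%:k *: (EH 1 + EH (-1) - EH zeta - EH (- zeta)) -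
  (i23%:k * dAB K) *: 1.

Lemma EH_centre s : centre (EH s).
Proof. exact: (central_uv hz 1 s).2. Qed.
Lemma Ha1_centre : centre Ha1.
Proof.
have c := EH_centre.
by apply/centreZ/centreD; [|apply/centreN/centreZ]; apply/centreD => //; apply/centreN.
Qed.
Lemma Ha3_centre : centre Ha3.
Proof.
have c := EH_centre.
by apply/centreZ/centreD; [|apply/centreZ]; apply/centreD => //; apply/centreN.
Qed.
Lemma Ha2_centre : centre Ha2.
Proof.
have c := EH_centre; apply/centreD/centreN/centreZ/centre1; apply/centreZ.
by apply/centreD/centreN => //; apply/centreD/centreN => //; apply/centreD.
Qed.
End Generators.

Section LinComb.
Variables (k S : nzRingType) (V : lmodType k) (i : {rmorphism k -> S}) (f : V -> S).
Hypotheses (fD : forall a b, f (a + b) = f a + f b)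
  (fZ : forall c a, f (c *: a) = i c * f a).
Let fB a b : f (a - b) = f a - f b.
Proof. by rewrite -scaleN1r fD fZ rmorphN1 mulN1r. Qed.
Variables (a1 a2 a3 a4 a5 : V) (b1 b2 b3 b4 b5 : S) (c d z : k).
Hypotheses (e1 : f a1 = b1) (e2 : f a2 = b2) (e3 : f a3 = b3) (e4 : f a4 = b4)
  (e5 : f a5 = b5).
(** Trunc and [hat] are both additive and linear over C[A, B] through a ring morphism, so one
    computation covers the two. *)
Lemma lin_fourier1 : f (c *: (a1 - a2 - z *: (a3 - a4))) =
  i c * (b1 - b2 - i z * (b3 - b4)).
Proof. by rewrite fZ !fB fZ fB e1 e2 e3 e4. Qed.
Lemma lin_fourier3 : f (c *: (a1 - a2 + z *: (a3 - a4))) =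
  i c * (b1 - b2 + i z * (b3 - b4)).
Proof. by rewrite fZ fD fZ !fB e1 e2 e3 e4. Qed.
Lemma lin_fourier2 : f (c *: (a1 + a2 - a3 - a4) - d *: a5) =
  i c * (b1 + b2 - b3 - b4) - i d * b5.
Proof. by rewrite fB !fZ !fB fD e1 e2 e3 e4 e5. Qed.
Lemma lin_sub2 : f (a1 + (-1) *: (a2 + a3)) = b1 - (b2 + b3).
Proof. by rewrite fD fZ fD e1 e2 e3 rmorphN1 mulN1r. Qed.
End LinComb.

Section GenTrunc.
Variables (K : realType) (zeta : K[i]) (hz : 4.-primitive_root zeta).
Local Notation C := K[i].
Local Notation W := (dihedral hz).
Local Notation k := {mpoly C[2]}.
Local Notation H := (cherednik hz).
Local Notation P := {mpoly k[4]}.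
Local Notation Px := ('X_(inord 0) : P).
Local Notation Py := ('X_(inord 1) : P).
Local Notation PX := ('X_(inord 2) : P).
Local Notation PY := ('X_(inord 3) : P).
Local Notation "c %:k" := (c%:MP_[2] : k) (at level 2).
Local Notation x := (H_x hz).
Local Notation y := (H_y hz).
Local Notation X := (H_X hz).
Local Notation Y := (H_Y hz).
Local Notation uu := (uu hz).
Local Notation vv := (vv hz).
Local Notation EH := (EH hz).

Section Lin.
Variables (S : comNzRingType) (i : {rmorphism k -> S}) (f : H -> S) (E' : S -> S).
Hypotheses (fD : forall a b, f (a + b) = f a + f b)
  (fZ : forall c a, f (c *: a) = i c * f a) (f1 : f 1 = 1)
  (fE : forall s, f (EH s) = E' (cst i s)).
Local Notation ci := (cst i).
Let fE1 : f (EH 1) = E' 1.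
Proof. by rewrite fE (rmorph1 ci). Qed.
Let fEN1 : f (EH (-1)) = E' (-1).
Proof. by rewrite fE (rmorphN1 ci). Qed.
Let fENz : f (EH (- zeta)) = E' (- ci zeta).
Proof. by rewrite fE (rmorphN ci). Qed.
Lemma lin_Ha1 : f (Ha1 hz) = fourier1 (ci zeta) (ci (i16 K)) E'.
Proof.
exact: (lin_fourier1 fD fZ _ _ fE1 fEN1 (fE _) fENz).
Qed.
Lemma lin_Ha3 : f (Ha3 hz) = fourier3 (ci zeta) (ci (i16 K)) E'.
Proof.
exact: (lin_fourier3 fD fZ _ _ fE1 fEN1 (fE _) fENz).
Qed.
Lemma lin_Ha2 : f (Ha2 hz) =
  fourier2 (ci zeta) (ci (i24 K)) (ci (i23 K)) E' (i (dAB K)).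
Proof.
apply: etrans (lin_fourier2 fD fZ _ _ fE1 fEN1 (fE _) fENz f1) _.
by rewrite mulr1 rmorphM.
Qed.
Lemma ci16 : ci (i16 K) * 16%:R = 1.
Proof. by rewrite -(rmorph_nat ci) -rmorphM mulVf ?rmorph1 // Num.Theory.pnatr_eq0. Qed.
Lemma ci24 : ci (i24 K) * 24%:R = 1.
Proof. by rewrite -(rmorph_nat ci) -rmorphM mulVf ?rmorph1 // Num.Theory.pnatr_eq0. Qed.
Lemma ci23 : ci (i23 K) * 3%:R = 2%:R.
Proof. by rewrite -(rmorph_nat ci) -rmorphM divfK ?rmorph_nat // Num.Theory.pnatr_eq0. Qed.
End Lin.

Variables (G : fieldType) (frac : {rmorphism P -> G}).
Hypothesis frac_inj : injective frac.
Local Notation T := {poly G}.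
Local Notation rho := (@rho K zeta hz G frac).
Local Notation hat := (@hat K zeta hz G frac).
Local Notation iT := (iotaT frac).
Local Notation iP := (iotaP K).
Local Notation cT := (cst iT).
Local Notation cP := (cst iP).
Local Notation x0 := (tx frac).
Local Notation y0 := (ty frac).
Local Notation X0 := (tX frac).
Local Notation Y0 := (tY frac).
Local Notation trunc := (@trunc K zeta hz).

Lemma truncD (a b : H) : trunc (a + b) = trunc a + trunc b.
Proof. by have := trunc_lin frac_inj 1 a b; rewrite !scale1r. Qed.
Lemma trunc_0 : trunc 0 = 0.
Proof. by apply: (addrI (trunc 0)); rewrite -truncD !addr0. Qed.
Lemma truncZ c (a : H) : trunc (c *: a) = iP c * trunc a.
Proof.
have := trunc_lin frac_inj c a 0; rewrite trunc_0 !addr0 => e.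
by apply: etrans e _; rewrite -mul_mpolyC.
Qed.
Lemma trunc_1 : trunc (1 : H) = 1.
Proof.
exact: (atr1 (@H_w1 _ _ hz) (@H_wM _ _ hz) (@H_wx _ _ hz) (@H_wy _ _ hz)
  (@H_wY _ _ hz) (@H_wX _ _ hz) (H_xy hz) (H_XY hz) (H_xX hz) (H_xY hz) (H_yX hz) (H_yY hz)
  (@H_gen_ind _ _ hz) (H_apbw_inj frac_inj)).
Qed.

Lemma pencil_ring (R : comNzRingType) (p q b D : R) :
  p ^+ 4 + b ^+ 2 * (2%:R * D) + (q ^+ 4 + b ^+ 2 * (2%:R * D)) =
  p ^+ 4 + q ^+ 4 + b ^+ 2 * 4%:R * D.
Proof. by ring. Qed.

Lemma pencil_trunc (R : comNzRingType) n (p q r s : {mpoly R[n]}) (a b D : R) : a = 1 ->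
  (a *: p + b *: q) ^+ 4 + (a ^+ 2 * b ^+ 2) *: (2%:R * D)%:MP +
  ((a *: r + b *: s) ^+ 4 + (a ^+ 2 * b ^+ 2) *: (2%:R * D)%:MP) =
  (p + b%:MP * q) ^+ 4 + (r + b%:MP * s) ^+ 4 + b%:MP ^+ 2 * 4%:R * D%:MP.
Proof.
move=> ->; rewrite expr1n !scale1r mul1r -!mul_mpolyC rmorphXn rmorphM rmorph_nat.
exact: pencil_ring.
Qed.

Lemma trunc_EH s : trunc (EH s) = pencilP Px Py PX PY (iP (dAB K)) (cP s).
Proof.
have e1 := trunc_u4 hz frac_inj 1 s; have e2 := trunc_v4 hz frac_inj 1 s.
rewrite /EH truncD; apply: etrans (congr2 +%R e1 e2) _.
exact: (pencil_trunc Px PY Py PX s%:k (dAB K) (mpolyC1 _ _)).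
Qed.
Lemma H_a1E : H_a hz 1 = Ha1 hz.
Proof.
suff e : trunc (Ha1 hz) = P_x K ^+ (4 - 1) * P_Y K ^+ 1 + P_y K ^+ (4 - 1) * P_X K ^+ 1.
  exact: (trunc_invE frac_inj (@Ha1_centre K zeta hz) e).
apply: etrans (lin_Ha1 truncD truncZ trunc_EH) _.
exact: (fourierP1 (z2 hz iP) (ci16 iP)).
Qed.
Lemma H_a2E : H_a hz 2 = Ha2 hz.
Proof.
suff e : trunc (Ha2 hz) = P_x K ^+ (4 - 2) * P_Y K ^+ 2 + P_y K ^+ (4 - 2) * P_X K ^+ 2.
  exact: (trunc_invE frac_inj (@Ha2_centre K zeta hz) e).
apply: etrans (lin_Ha2 truncD truncZ trunc_1 trunc_EH) _.
exact: (fourierP2 (z2 hz iP) (ci24 iP) (ci23 iP)).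
Qed.
Lemma H_a3E : H_a hz 3 = Ha3 hz.
Proof.
suff e : trunc (Ha3 hz) = P_x K ^+ (4 - 3) * P_Y K ^+ 3 + P_y K ^+ (4 - 3) * P_X K ^+ 3.
  exact: (trunc_invE frac_inj (@Ha3_centre K zeta hz) e).
apply: etrans (lin_Ha3 truncD truncZ trunc_EH) _.
exact: (fourierP3 (z2 hz iP) (ci16 iP)).
Qed.

Lemma uu10 : uu 1 0 = x. Proof. by rewrite /uu mpolyC1 mpolyC0 scale1r scale0r addr0. Qed.
Lemma vv10 : vv 1 0 = y. Proof. by rewrite /vv mpolyC1 mpolyC0 scale1r scale0r addr0. Qed.
Lemma uu01 : uu 0 1 = Y. Proof. by rewrite /uu mpolyC1 mpolyC0 scale1r scale0r add0r. Qed.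
Lemma vv01 : vv 0 1 = X. Proof. by rewrite /vv mpolyC1 mpolyC0 scale1r scale0r add0r. Qed.
Lemma uu11 : uu 1 1 = x + Y. Proof. by rewrite /uu mpolyC1 !scale1r. Qed.
Lemma vv11 : vv 1 1 = y + X. Proof. by rewrite /vv mpolyC1 !scale1r. Qed.

Lemma H_qE : H_q hz = uu 1 0 * vv 1 0.
Proof. by rewrite uu10 vv10. Qed.
Lemma H_rE : H_r hz = uu 1 0 ^+ 4 + vv 1 0 ^+ 4.
Proof. by rewrite uu10 vv10. Qed.
Lemma H_QE : H_Q hz = uu 0 1 * vv 0 1.
Proof. by rewrite uu01 vv01; exact: H_XY. Qed.
Lemma H_RE : H_R hz = uu 0 1 ^+ 4 + vv 0 1 ^+ 4.
Proof. by rewrite uu01 vv01; exact: addrC. Qed.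
(** The left side is the coefficient of s in u v = x y + s (x X + Y y) + s^2 Y X, isolated by the
    values of the pencil at s = 1 and at its two ends. *)
Lemma euE : x * X + Y * y = uu 1 1 * vv 1 1 + (-1) *: (uu 1 0 * vv 1 0 + uu 0 1 * vv 0 1).
Proof.
rewrite uu10 vv10 uu01 vv01 uu11 vv11 scaleN1r mulrDl !mulrDr.
by rewrite [_ + x * X]addrC addrACA addrK.
Qed.
Lemma eu_centre : centre (x * X + Y * y).
Proof.
rewrite euE; apply: centreD; first exact: (central_uv hz 1 1).1.
by apply/centreZ/centreD; [exact: (central_uv hz 1 0).1 | exact: (central_uv hz 0 1).1].
Qed.
Lemma H_euE : H_eu hz = x * X + Y * y.
Proof. exact: (trunc_invE frac_inj eu_centre (trunc_eu hz frac_inj)). Qed.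

Definition Zgen (j : nat) : H :=
  [:: H_q hz; H_r hz; H_Q hz; H_R hz; H_eu hz; H_a hz 1; H_a hz 2; H_a hz 3]`_j.

Lemma Zgen_centre j : centre (Zgen j).
Proof.
rewrite /Zgen H_qE H_rE H_QE H_RE H_euE H_a1E H_a2E H_a3E.
have c al be := central_uv hz al be.
case: j => [|[|[|[|[|[|[|[|j]]]]]]]] /=.
- exact: (c 1 0).1.
- exact: (c 1 0).2.
- exact: (c 0 1).1.
- exact: (c 0 1).2.
- exact: eu_centre.
- exact: (@Ha1_centre K zeta hz).
- exact: (@Ha2_centre K zeta hz).
- exact: (@Ha3_centre K zeta hz).
- by rewrite nth_nil; apply: centre0.
Qed.

Local Notation aT := (aT hz frac).
Local Notation bT := (bT hz frac).
Local Notation a2 := (aT ^+ 2).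
Local Notation b2 := (bT ^+ 2).
Definition hatq : T := dunklQ x0 y0 X0 Y0 a2 b2.
Definition hatr : T := dunklR x0 y0 X0 Y0 a2 b2.
Definition ha1 : T := hata1 x0 y0 X0 Y0 a2 b2.
Definition ha2 : T := hata2 x0 y0 X0 Y0 a2 b2.
Definition ha3 : T := hata3 x0 y0 X0 Y0.

(** [c1] and [c0] stand for the images of 1 and 0 under the coefficient map. The five
    specialisations are those giving q, r, Q, R and, after subtraction, eu. *)
Lemma dunklQ_Z (R : comNzRingType) (x y X Y a b c1 c0 : R) : c1 = 1 -> c0 = 0 ->
  (dunklQ (c1 * x + c0 * Y) (c1 * y + c0 * X) X Y (c1 ^+ 2 * a) (c1 ^+ 2 * b) =
    dunklQ x y X Y a b) *
  (dunklR (c1 * x + c0 * Y) (c1 * y + c0 * X) X Y (c1 ^+ 2 * a) (c1 ^+ 2 * b) =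
    dunklR x y X Y a b) *
  (dunklQ (c0 * x + c1 * Y) (c0 * y + c1 * X) X Y (c0 ^+ 2 * a) (c0 ^+ 2 * b) =
    X * Y) *
  (dunklR (c0 * x + c1 * Y) (c0 * y + c1 * X) X Y (c0 ^+ 2 * a) (c0 ^+ 2 * b) =
    X ^+ 4 + Y ^+ 4) *
  (dunklQ (c1 * x + c1 * Y) (c1 * y + c1 * X) X Y (c1 ^+ 2 * a) (c1 ^+ 2 * b) =
    x * X + y * Y + dunklQ x y X Y a b + X * Y).
Proof. by move=> -> ->; rewrite /dunklQ /dunklR; do ![split]; ring. Qed.
Local Notation dZ := (dunklQ_Z x0 y0 X0 Y0 a2 b2 (rmorph1 cT) (rmorph0 cT)).

Lemma hat_q : hat (H_q hz) = hatq.
Proof. by rewrite H_qE (hat_uv hz frac_inj) dZ. Qed.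
Lemma hat_r : hat (H_r hz) = hatr.
Proof. by rewrite H_rE (hat_u4v4 hz frac_inj) dZ. Qed.
Lemma hat_Q : hat (H_Q hz) = X0 * Y0.
Proof. by rewrite H_QE (hat_uv hz frac_inj) dZ. Qed.
Lemma hat_R : hat (H_R hz) = X0 ^+ 4 + Y0 ^+ 4.
Proof. by rewrite H_RE (hat_u4v4 hz frac_inj) dZ. Qed.
Lemma hat_eu : hat (H_eu hz) = x0 * X0 + y0 * Y0.
Proof.
rewrite H_euE euE.
have h11 := etrans (hat_uv hz frac_inj 1 1) dZ.2.
have h10 := etrans (hat_uv hz frac_inj 1 0) dZ.1.1.1.1.
have h01 := etrans (hat_uv hz frac_inj 0 1) dZ.1.1.2.
apply: etrans (lin_sub2 (hatD frac_inj) (hatZ frac_inj) h11 h10 h01) _.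
by rewrite -[_ + _ + X0 * Y0]addrA addrK.
Qed.

Lemma pencilT_one (R : comNzRingType) (x y X Y a b s c : R) : c = 1 ->
  dunklR (c * x + s * Y) (c * y + s * X) X Y (c ^+ 2 * a) (c ^+ 2 * b) =
  pencilT x y X Y a b s.
Proof. by move=> ->; rewrite expr1n !mul1r. Qed.
Lemma hatE_EH s : hat (EH s) = pencilT x0 y0 X0 Y0 a2 b2 (cT s).
Proof.
apply: etrans (hat_u4v4 hz frac_inj 1 s) _.
exact: (pencilT_one x0 y0 X0 Y0 a2 b2 (cT s) (rmorph1 cT)).
Qed.
Lemma iT_dAB : iT (dAB K) = a2 * (X0 ^+ 2 - Y0 ^+ 2) ^+ 2 - b2 * (X0 ^+ 2 + Y0 ^+ 2) ^+ 2.
Proof.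
apply: etrans (congr2 (fun a b => a - b) (aT_sq hz frac_inj) (bT_sq hz frac_inj)).
by rewrite rmorphB !rmorphXn.
Qed.
Lemma hat_a1 : hat (H_a hz 1) = ha1.
Proof.
rewrite H_a1E; apply: etrans (lin_Ha1 (hatD frac_inj) (hatZ frac_inj) hatE_EH) _.
exact: (fourierT1 (z2 hz iT) (ci16 iT)).
Qed.
Lemma hat_a2 : hat (H_a hz 2) = ha2.
Proof.
rewrite H_a2E; apply: etrans (lin_Ha2 (hatD frac_inj) (hatZ frac_inj) (hat1 hz frac_inj) hatE_EH) _.
exact: (fourierT2 (z2 hz iT) (ci24 iT) (ci23 iT) x0 y0 iT_dAB).
Qed.
Lemma hat_a3 : hat (H_a hz 3) = ha3.
Proof.
rewrite H_a3E; apply: etrans (lin_Ha3 (hatD frac_inj) (hatZ frac_inj) hatE_EH) _.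
exact: (fourierT3 (z2 hz iT) (ci16 iT)).
Qed.

Definition hgen (j : nat) : T :=
  [:: hatq; hatr; X0 * Y0; X0 ^+ 4 + Y0 ^+ 4; x0 * X0 + y0 * Y0; ha1; ha2; ha3]`_j.
Lemma hat_Zgen j : hat (Zgen j) = hgen j.
Proof.
case: j => [|[|[|[|[|[|[|[|j]]]]]]]].
- exact: hat_q.
- exact: hat_r.
- exact: hat_Q.
- exact: hat_R.
- exact: hat_eu.
- exact: hat_a1.
- exact: hat_a2.
- exact: hat_a3.
- by rewrite /Zgen /hgen /= !nth_nil (hat0 hz frac_inj).
Qed.
End GenTrunc.

(** * Invariants and generation *)

Section SymMono.
Variables (R : comNzRingType) (x y X Y : R) (GG : nat -> R -> Prop).
Hypotheses (GD : forall n f g, GG n f -> GG n g -> GG n (f + g))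
  (GN : forall n f, GG n f -> GG n (- f))
  (GM : forall n m f g, GG n f -> GG m g -> GG (n + m) (f * g))
  (G1 : GG 0 1).
Hypotheses (Gq : GG 2 (x * y)) (Gr : GG 4 (x ^+ 4 + y ^+ 4)) (GQ : GG 0 (X * Y))
  (GR : GG 0 (X ^+ 4 + Y ^+ 4)) (Ge : GG 1 (x * X + y * Y))
  (Ga1 : GG 3 (x ^+ 3 * Y + y ^+ 3 * X))
  (Ga2 : GG 2 (x ^+ 2 * Y ^+ 2 + y ^+ 2 * X ^+ 2))
  (Ga3 : GG 1 (x * Y ^+ 3 + y * X ^+ 3)).
(** Sum of a monomial and its image under s_0. It is also invariant under rotations exactly when a +
    d and b + c agree modulo 4. *)
Definition symM a b c d : R :=
  x ^+ a * y ^+ b * X ^+ c * Y ^+ d + y ^+ a * x ^+ b * Y ^+ c * X ^+ d.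
Local Notation M := symM.

Lemma symMC a b c d : M a b c d = M b a d c.
Proof. by rewrite /M; ring. Qed.

Let GB n m m' f g h : n = (m + m')%N -> GG m f -> GG m' g -> GG n h -> GG n (f * g - h).
Proof. by move=> -> hf hg hh; apply: GD; [apply: GM | apply: GN]. Qed.
Let GMe n m m' f g : n = (m + m')%N -> GG m f -> GG m' g -> GG n (f * g).
Proof. by move=> ->; apply: GM. Qed.

(* First fundamental theorem for W on V + V^*: each step lowers the total degree
   by splitting off one of the generators. *)
Lemma symM_gen a b c d : (a + d = b + c %[mod 4])%N -> GG (a + b) (M a b c d).
Proof.
have [n] := ubnP (a + b + c + d); elim: n a b c d => // n IH.
have step2 a b c d : (a.+1 + d = b.+1 + c %[mod 4])%N ->
    (a.+1 + b.+1 + c + d < n.+1)%N -> GG (a.+1 + b.+1) (M a.+1 b.+1 c d).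
  move=> h ln; have -> : M a.+1 b.+1 c d = (x * y) * M a b c d.
    by rewrite /M !exprS; ring.
  by apply: (GMe _ Gq (IH a b c d _ _)); lia.
have step3 a b c d : (a + d.+1 = b + c.+1 %[mod 4])%N ->
    (a + b + c.+1 + d.+1 < n.+1)%N -> GG (a + b) (M a b c.+1 d.+1).
  move=> h ln; have -> : M a b c.+1 d.+1 = (X * Y) * M a b c d.
    by rewrite /M !exprS; ring.
  by apply: (GMe _ GQ (IH a b c d _ _)); lia.
(* Terms with b = d = 0: pure powers obey a Newton recurrence with r or R, and mixed ones lose a
   factor eu. *)
have main0 a c : (a = c %[mod 4])%N -> (a + c < n.+1)%N -> GG a (M a 0 c 0).
  move=> h ln; case: a c h ln => [|a] [|c] h ln.
  - by have -> : M 0 0 0 0 = 1 + 1; [rewrite /M; ring | apply: GD].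
  - case: c h ln => [|[|[|[|c]]]] h ln; try by exfalso; lia.
      by have -> : M 0 0 4 0 = X ^+ 4 + Y ^+ 4 by rewrite /M; ring.
    have -> : M 0 0 c.+1.+4 0 = (X ^+ 4 + Y ^+ 4) * M 0 0 c.+1 0 - X * Y * M 0 0 3 c.
      by rewrite /M !exprS; ring.
    apply: (GB _ GR (IH _ _ _ _ _ _)); try lia.
    by apply: (GMe _ GQ (IH _ _ _ _ _ _)); lia.
  - case: a h ln => [|[|[|[|a]]]] h ln; try by exfalso; lia.
      by have -> : M 4 0 0 0 = x ^+ 4 + y ^+ 4 by rewrite /M; ring.
    have -> : M a.+1.+4 0 0 0 = (x ^+ 4 + y ^+ 4) * M a.+1 0 0 0 - x * y * M a 3 0 0.
      by rewrite /M !exprS; ring.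
    apply: (GB _ Gr (IH _ _ _ _ _ _)); try lia.
    by apply: (GMe _ Gq (IH _ _ _ _ _ _)); lia.
  - case: c h ln => [|c] h ln.
      case: a h ln => [|a] h ln.
        by have -> : M 1 0 1 0 = x * X + y * Y by rewrite /M; ring.
      have -> : M a.+2 0 1 0 = (x * X + y * Y) * M a.+1 0 0 0 - x * y * M a 0 0 1.
        by rewrite /M !exprS; ring.
      apply: (GB _ Ge (IH _ _ _ _ _ _)); try lia.
      by apply: (GMe _ Gq (IH _ _ _ _ _ _)); lia.
    have -> : M a.+1 0 c.+2 0 = (x * X + y * Y) * M a 0 c.+1 0 - X * Y * M 1 a 0 c.
      by rewrite /M !exprS; ring.
    apply: (GB _ Ge (IH _ _ _ _ _ _)); try lia.
    by apply: (GMe _ GQ (IH _ _ _ _ _ _)); lia.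
(* After x y and X Y are split off, and x, y exchanged if needed, one may take b = 0 and c or d
   equal to 0. *)
suff main a c d : (a + d = c %[mod 4])%N -> (a + c + d < n.+1)%N ->
    ~~ ((0 < c) && (0 < d))%N -> GG a (M a 0 c d).
  { move=> a b c d ln h.
  case: c d h ln => [|c] [|d] h ln; last exact: step3.
  all: case: a b h ln => [|a] [|b] h ln; try exact: step2.
  all: rewrite ?addn0; try by apply: main; rewrite ?andbF //; lia.
  all: by rewrite symMC add0n; apply: main; rewrite ?andbF //; lia. }
move=> h ln; case: d h ln => [|d] h ln; first by rewrite !addn0 in h ln; move=> _; apply: main0.
case: c h ln => // h ln _; case: a h ln => [|a] h ln.
  by rewrite symMC; apply: main0; lia.
have [a4|a4] := ltnP a 4; last first.
  case: a a4 h ln => [|[|[|[|a]]]] // _ h ln.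
  have -> : M a.+1.+4 0 0 d.+1 = (x ^+ 4 + y ^+ 4) * M a.+1 0 0 d.+1 -
      x * y * M a 3 0 d.+1 by rewrite /M !exprS; ring.
  apply: (GB _ Gr (IH _ _ _ _ _ _)); try lia.
  by apply: (GMe _ Gq (IH _ _ _ _ _ _)); lia.
have [d4|d4] := ltnP d 4; last first.
  case: d d4 h ln => [|[|[|[|d]]]] // _ h ln.
  have -> : M a.+1 0 0 d.+1.+4 = (X ^+ 4 + Y ^+ 4) * M a.+1 0 0 d.+1 -
      X * Y * M a.+1 0 3 d by rewrite /M !exprS; ring.
  apply: (GB _ GR (IH _ _ _ _ _ _)); try lia.
  by apply: (GMe _ GQ (IH _ _ _ _ _ _)); lia.
(* The two exponents now lie between 1 and 4 and their sum is divisible by 4: the pairs (1,3),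
   (2,2), (3,1) are a_3, a_2, a_1, and (4,4) is left. *)
case: a a4 h ln => [|[|[|[|a]]]] // _; case: d d4 => [|[|[|[|d]]]] // _ h ln;
  try by exfalso; lia.
- by have -> : M 1 0 0 3 = x * Y ^+ 3 + y * X ^+ 3 by rewrite /M; ring.
- by have -> : M 2 0 0 2 = x ^+ 2 * Y ^+ 2 + y ^+ 2 * X ^+ 2 by rewrite /M; ring.
- by have -> : M 3 0 0 1 = x ^+ 3 * Y + y ^+ 3 * X by rewrite /M; ring.
(* x^4 Y^4 + y^4 X^4 is r R minus x^4 X^4 + y^4 Y^4, and the latter is eu times x^3 X^3 + y^3 Y^3 up
   to a multiple of q Q. *)
have -> : M 4 0 0 4 = (x ^+ 4 + y ^+ 4) * (X ^+ 4 + Y ^+ 4) -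
    ((x * X + y * Y) * M 3 0 3 0 - x * y * (X * Y * M 0 2 0 2)).
  by rewrite /M; ring.
apply: (GB (m' := 0) _ Gr GR) => //; apply: (GB (m' := 3) _ Ge (IH 3 0 3 0 _ _)%N) => //; try lia.
by apply: (GMe (m' := 2) _ Gq (GMe (m' := 2) _ GQ (IH 0 2 0 2 _ _)%N)); lia.
Qed.
End SymMono.

(** * Tools for freeness: linear systems over the orbit, leading terms, algebraic independence *)

Section Coinvariant.
Variables (D : comNzRingType) (z x y X Y c0 c1 c2 c3 c4 c5 c6 c7 : D).
Hypothesis domD : forall a b : D, a * b = 0 -> (a == 0) || (b == 0).
Hypotheses (z2 : z * z = -1) (n4 : 4%:R != 0 :> D)
  (xy4 : x ^+ 4 - y ^+ 4 != 0) (XY4 : X ^+ 4 - Y ^+ 4 != 0).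
(** A combination of the eight candidates with (x, y) replaced by (u, v). Coefficients in q, r, Q, R
    are fixed when W moves x, y alone, so a relation at (x, y) holds at all eight images. *)
Definition coinvE (u v : D) : D := let e := u * X + v * Y in
  c0 + c1 * e + c2 * e ^+ 2 + c3 * e ^+ 3 + c4 * e ^+ 4
  + c5 * (u ^+ 3 * Y + v ^+ 3 * X) + c6 * (u ^+ 2 * Y ^+ 2 + v ^+ 2 * X ^+ 2)
  + c7 * (u * Y ^+ 3 + v * X ^+ 3).
Local Notation E := coinvE.

Let cancel0 (a b : D) : a != 0 -> a * b = 0 -> b = 0.
Proof. by move=> a0 /domD; rewrite (negbTE a0) => /eqP. Qed.
Let dom_neq0 (a b : D) : a != 0 -> b != 0 -> a * b != 0.
Proof. by move=> a0; apply: contraNneq => /(cancel0 a0) ->. Qed.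
Let comb4 (a b c d e1 e2 e3 e4 s : D) : e1 = 0 -> e2 = 0 -> e3 = 0 -> e4 = 0 ->
  a * e1 + b * e2 + c * e3 + d * e4 = 4%:R * s -> s = 0.
Proof.
by move=> -> -> -> -> h; apply: (cancel0 n4); rewrite -h !mulr0 !addr0.
Qed.
Let comb2 (a b e1 e2 s t : D) : s != 0 -> e1 = 0 -> e2 = 0 ->
  a * e1 + b * e2 = s * t -> t = 0.
Proof.
by move=> s0 -> -> h; apply: (cancel0 s0); rewrite -h !mulr0 addr0.
Qed.

(* Fourier inversion over the rotations of (u, v), (X, Y) being fixed. *)
Lemma coinv_split u v : E u v = 0 -> E (z * u) (- z * v) = 0 -> E (- u) (- v) = 0 ->
    E (- z * u) (z * v) = 0 ->
  [/\ c0 + 2%:R * u * v * X * Y * c2 +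
        c4 * (u ^+ 4 * X ^+ 4 + v ^+ 4 * Y ^+ 4 + 6%:R * u ^+ 2 * v ^+ 2 * X ^+ 2 * Y ^+ 2) = 0,
      c1 * u * X + c3 * (3%:R * u ^+ 2 * X ^+ 2 * v * Y + v ^+ 3 * Y ^+ 3)
        + c5 * v ^+ 3 * X + c7 * u * Y ^+ 3 = 0,
      c2 * (u ^+ 2 * X ^+ 2 + v ^+ 2 * Y ^+ 2)
        + 4%:R * c4 * u * v * X * Y * (u ^+ 2 * X ^+ 2 + v ^+ 2 * Y ^+ 2)
        + c6 * (u ^+ 2 * Y ^+ 2 + v ^+ 2 * X ^+ 2) = 0 &
      c1 * v * Y + c3 * (u ^+ 3 * X ^+ 3 + 3%:R * u * X * v ^+ 2 * Y ^+ 2)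
        + c5 * u ^+ 3 * Y + c7 * v * X ^+ 3 = 0].
Proof.
move=> e0 e1 e2 e3; split.
- by apply: (comb4 (a := 1) (b := 1) (c := 1) (d := 1) e0 e1 e2 e3); rewrite /E; ring: z2.
- by apply: (comb4 (a := 1) (b := -z) (c := -1) (d := z) e0 e1 e2 e3); rewrite /E; ring: z2.
- by apply: (comb4 (a := 1) (b := -1) (c := 1) (d := -1) e0 e1 e2 e3); rewrite /E; ring: z2.
- by apply: (comb4 (a := 1) (b := z) (c := -1) (d := -z) e0 e1 e2 e3); rewrite /E; ring: z2.
Qed.

(** After [coinv_split], comparing the equations at (x, y) and (y, x) gives small linear systems
    whose determinants are products of x^4 - y^4 and X^4 - Y^4. *)
Lemma coinv_free : E x y = 0 -> E (z * x) (- z * y) = 0 -> E (- x) (- y) = 0 ->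
    E (- z * x) (z * y) = 0 -> E y x = 0 -> E (z * y) (- z * x) = 0 ->
    E (- y) (- x) = 0 -> E (- z * y) (z * x) = 0 ->
  [/\ c0 = 0, c1 = 0, c2 = 0 & c3 = 0] /\ [/\ c4 = 0, c5 = 0, c6 = 0 & c7 = 0].
Proof.
move=> e0 e1 e2 e3 f0 f1 f2 f3.
have [a0 a1 a2 a3] := coinv_split e0 e1 e2 e3.
have [b0 b1 b2 b3] := coinv_split f0 f1 f2 f3 => {e0 e1 e2 e3 f0 f1 f2 f3}.
have h4 : c4 = 0.
  apply: (comb2 (a := 1) (b := -1) (dom_neq0 xy4 XY4) a0 b0); ring.
rewrite h4 in a0 a2 b0 b2.
have sq : (x ^+ 2 * X ^+ 2 + y ^+ 2 * Y ^+ 2) ^+ 2 - (x ^+ 2 * Y ^+ 2 + y ^+ 2 * X ^+ 2) ^+ 2 != 0.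
  rewrite (_ : _ - _ = (x ^+ 4 - y ^+ 4) * (X ^+ 4 - Y ^+ 4)); last by ring.
  exact: dom_neq0.
have h2 : c2 = 0.
  by apply: (comb2 (a := x ^+ 2 * X ^+ 2 + y ^+ 2 * Y ^+ 2)
     (b := - (x ^+ 2 * Y ^+ 2 + y ^+ 2 * X ^+ 2)) sq a2 b2); ring.
have h6 : c6 = 0.
  by apply: (comb2 (b := x ^+ 2 * X ^+ 2 + y ^+ 2 * Y ^+ 2)
     (a := - (x ^+ 2 * Y ^+ 2 + y ^+ 2 * X ^+ 2)) sq a2 b2); ring.
have h0 : c0 = 0 by rewrite -[RHS]a0 h2; ring.
have g1 : c3 * Y ^+ 3 + c5 * X = 0.
  by apply: (comb2 (a := - y) (b := x) xy4 a1 b1); ring.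
have g2 : c3 * X ^+ 3 + c5 * Y = 0.
  by apply: (comb2 (a := x) (b := - y) xy4 a3 b3); ring.
have h3 : c3 = 0 by apply: (comb2 (a := - Y) (b := X) XY4 g1 g2); ring.
have h5 : c5 = 0 by apply: (comb2 (a := X ^+ 3) (b := - Y ^+ 3) XY4 g1 g2); ring.
rewrite h3 h5 in a1 a3 b1 b3.
have g3 : c1 * X + c7 * Y ^+ 3 = 0.
  by apply: (comb2 (a := x ^+ 3) (b := - y ^+ 3) xy4 a1 b1); ring.
have g4 : c1 * Y + c7 * X ^+ 3 = 0.
  by apply: (comb2 (b := x ^+ 3) (a := - y ^+ 3) xy4 a3 b3); ring.
have h1 : c1 = 0 by apply: (comb2 (a := X ^+ 3) (b := - Y ^+ 3) XY4 g3 g4); ring.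
have h7 : c7 = 0 by apply: (comb2 (a := - Y) (b := X) XY4 g3 g4); ring.
by [].
Qed.
End Coinvariant.

Section Graded.
Variables (G : comNzRingType) (J : eqType) (s : seq J) (F : J -> {poly G})
  (d : J -> nat) (L : J -> G) (Z : J -> Prop).
Hypothesis FL : forall j, plead (d j) (F j) (L j).
Hypothesis ZF : forall j, Z j -> F j = 0.
Hypothesis Ltop : forall n, \sum_(j <- s | d j == n) L j = 0 ->
  forall j, j \in s -> d j = n -> Z j.
(** Leading-term argument: read Z j as the vanishing of the j-th coefficient. Going down in degree,
    all terms above degree n are already 0, so the n-th coefficient of the sum is the sum of the
    leading parts of degree n, to which [Ltop] applies. *)
Lemma graded_free : \sum_(j <- s) F j = 0 -> forall j, j \in s -> Z j.
Proof.
move=> F0; suff main n j : j \in s -> (n <= d j)%N -> Z j by move=> j js; apply: main js (leq0n _).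
have [N hN] : exists N, forall j, j \in s -> (d j < N)%N.
  exists (\max_(j <- s) d j).+1 => i is_; rewrite ltnS.
  exact: (@leq_bigmax_seq _ _ xpredT d i is_ isT).
have [nN|Nn] := leqP n N; last first.
  by move=> js hj; have := hN j js; rewrite ltnNge (leq_trans (ltnW Nn) hj).
rewrite -(subKn nN); elim: (N - n)%N (leq_subr n N) j => {n nN} [|m IH] mN j js hj.
  by have := hN j js; rewrite ltnNge -{1}(subn0 N) hj.
have {}IH i : i \in s -> (N - m <= d i)%N -> Z i by apply: IH; apply: ltnW.
move: hj; rewrite leq_eqVlt => /orP [/eqP e|]; last first.
  by move=> hj; apply: IH => //; lia.
apply: (Ltop _ js (esym e)).
have : plead (N - m.+1) (\sum_(i <- s) F i) (\sum_(i <- s | d i == (N - m.+1)%N) L i).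
  rewrite (bigID (fun i => d i == (N - m.+1)%N)) /= -[X in plead _ _ X]addr0.
  apply: pleadD; first by apply: plead_sum => i /eqP <-.
  have -> : 0 = \sum_(i <- s | (i \in s) && (d i != (N - m.+1)%N)) 0 :> G by rewrite big1.
  rewrite big_seq_cond; apply: plead_sum => i /andP [is_ ne]; have [le|lt] := leqP (N - m) (d i).
    by rewrite (ZF (IH i is_ le)); apply: plead0.
  by apply: plead_weak (FL i) _; lia.
by rewrite F0 => -[_]; rewrite coef0.
Qed.
End Graded.

Section AlgIndep.
Variable k : comNzRingType.
Local Notation P := {mpoly k[4]}.
Local Notation Px := ('X_(inord 0) : P).
Local Notation Py := ('X_(inord 1) : P).
Local Notation PX := ('X_(inord 2) : P).
Local Notation PY := ('X_(inord 3) : P).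

Lemma mpolyX_mn4 a b c d : 'X_[mn4 a b c d] = Px ^+ a * Py ^+ b * PX ^+ c * PY ^+ d :> P.
Proof.
rewrite mpolyXE_id !big_ord_recl big_ord0 mulr1 !mulrA.
do ![congr (_ * _)]; rewrite /mn4 ?mnmE /=; congr ('X_ _ ^+ _);
  by apply: val_inj; rewrite /= inordK.
Qed.

Definition invt (i : 'I_4) : P :=
  nth 0 [:: Px * Py; Px ^+ 4 + Py ^+ 4; PX * PY; PX ^+ 4 + PY ^+ 4] i.
(** The source copy of P is reused as the polynomial ring in four names for q, r, Q, R. *)
Definition gam : {rmorphism P -> P} := mmap (@mpolyC 4 k) invt.
Lemma gamX m : gam 'X_[m] = (Px * Py) ^+ m (inord 0) * (Px ^+ 4 + Py ^+ 4) ^+ m (inord 1) *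
  (PX * PY) ^+ m (inord 2) * (PX ^+ 4 + PY ^+ 4) ^+ m (inord 3).
Proof. by rewrite [LHS]mmapX mnm4_mmap1 /invt !inordK. Qed.
Lemma gamC c : gam c%:MP = c%:MP. Proof. exact: mmapC. Qed.

(* x and X get degree 1, y and Y degree 0: the leading parts of q, r, Q, R are
   then monomials. *)
Definition degv (i : 'I_4) : {poly P} :=
  nth 0 [:: Px%:P * 'X; Py%:P; PX%:P * 'X; PY%:P] i.
Definition degm : {rmorphism P -> {poly P}} := mmap (@polyC P \o @mpolyC 4 k)%FUN degv.
Lemma degmC c : degm c%:MP = (c%:MP)%:P. Proof. exact: mmapC. Qed.
Lemma degmU i : degm 'X_i = degv i. Proof. by rewrite [LHS]mmapX mmap1U. Qed.

Lemma plead_CX (R : comNzRingType) (c : R) : plead 1 (c%:P * 'X) c.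
Proof.
split; last by rewrite coefMX coefC.
by apply: leq_trans (size_polyMleq _ _) _; rewrite size_polyX addn2 /= ltnS size_polyC; case: eqP.
Qed.

Definition ltau (m : 'X_{1..4}) : 'X_{1..4} :=
  mn4 (m (inord 0) + 4 * m (inord 1)) (m (inord 0)) (m (inord 2) + 4 * m (inord 3)) (m (inord 2)).
Definition dtau (m : 'X_{1..4}) : nat :=
  (1 * m (inord 0) + 4 * m (inord 1) + 1 * m (inord 2) + 4 * m (inord 3))%N.
Lemma ltau_inj : injective ltau.
Proof.
move=> m m' e; rewrite (mn4_eta m) (mn4_eta m').
have h j : ltau m j = ltau m' j by rewrite e.
have := h (inord 0); have := h (inord 1); have := h (inord 2); have := h (inord 3).
rewrite /ltau !mn4E => h2 h3 h0 h1.
have h1' : m (inord 1) = m' (inord 1) by lia.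
have h3' : m (inord 3) = m' (inord 3) by lia.
by rewrite h0 h2 h1' h3'.
Qed.

Lemma plead_pow4 (R : comNzRingType) (p q : {poly R}) (a : R) :
  plead 1 p a -> plead 0 q 0 \/ (size q <= 1)%N -> plead 4 (p ^+ 4 + q ^+ 4) (a ^+ 4).
Proof.
move=> hp hq; rewrite -[a ^+ 4]addr0; apply: pleadD; first exact: (pleadX 4 hp).
have {}hq : (size q <= 1)%N by case: hq => [[]|].
by apply: (@plead_weak _ 0 4 _ (q`_0 ^+ 4)) => //; apply: (pleadX 4 (conj hq erefl)).
Qed.

Lemma mono_arith (R : comNzRingType) (x y X Y : R) a b c d :
  (x * y) ^+ a * (x ^+ 4) ^+ b * (X * Y) ^+ c * (X ^+ 4) ^+ d =
  x ^+ (a + 4 * b) * y ^+ a * X ^+ (c + 4 * d) * Y ^+ c.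
Proof.
rewrite (exprMn a x y) (exprMn c X Y) -(exprM x) -(exprM X) !exprD.
by move: (x ^+ a) (y ^+ a) (X ^+ c) (Y ^+ c) (x ^+ _) (X ^+ _) => *; ring.
Qed.

Lemma rmorph_gam (R1 R2 : comNzRingType) (f : {rmorphism R1 -> R2}) x y X Y a b c d :
  f ((x * y) ^+ a * (x ^+ 4 + y ^+ 4) ^+ b * (X * Y) ^+ c * (X ^+ 4 + Y ^+ 4) ^+ d) =
  (f x * f y) ^+ a * (f x ^+ 4 + f y ^+ 4) ^+ b * (f X * f Y) ^+ c * (f X ^+ 4 + f Y ^+ 4) ^+ d.
Proof. by rewrite 3!rmorphM 4!rmorphXn 2!rmorphD 4!rmorphXn 2!rmorphM. Qed.

Lemma plead_gam m : plead (dtau m) (degm (gam 'X_[m])) 'X_[ltau m].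
Proof.
rewrite gamX rmorph_gam !degmU /degv !inordK //= /ltau mpolyX_mn4 -mono_arith.
have hx := plead_CX Px; have hX := plead_CX PX.
have hy := pleadC Py; have hY := pleadC PY.
have sC (p : P) : plead 0 p%:P 0 \/ (size p%:P <= 1)%N by right; rewrite size_polyC; case: eqP.
have h0 := pleadX (m (inord 0)) (pleadM hx hy).
have h2 := pleadX (m (inord 2)) (pleadM hX hY).
have h1 := pleadX (m (inord 1)) (plead_pow4 hx (sC Py)).
have h3 := pleadX (m (inord 3)) (plead_pow4 hX (sC PY)).
exact: (pleadM (pleadM (pleadM h0 h1) h2) h3).
Qed.

(** Distinct monomials in q, r, Q, R have distinct leading monomials [ltau], so no cancellation is
    possible in top degree. *)
Lemma gam_inj0 c : gam c = 0 -> c = 0.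
Proof.
move=> c0; apply/mpolyP => m; rewrite mcoeff0.
have [hm|] := boolP (m \in msupp c); last exact: memN_msupp_eq0.
pose F m := degm (gam (c@_m *: 'X_[m])).
have dF m' : F m' = ((c@_m')%:MP)%:P * degm (gam 'X_[m']).
  by rewrite /F -mul_mpolyC !rmorphM /= gamC degmC.
apply: (@graded_free _ _ (msupp c) F dtau (fun m => (c@_m)%:MP * 'X_[ltau m])
  (fun m => c@_m = 0) _ _ _ _ m hm).
- move=> m'; rewrite dF -[dtau m']add0n; apply: pleadM; [exact: pleadC | exact: plead_gam].
- by move=> m' e; rewrite dF e mpolyC0 polyC0 mul0r.
- move=> n e0 m' hm' dm'.
  have := congr1 (mcoeff (ltau m')) e0; rewrite mcoeff0 raddf_sum -big_filter.
  rewrite (bigD1_seq m') ?filter_uniq ?msupp_uniq ?mem_filter ?dm' ?eqxx //=.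
  rewrite mcoeffCM mcoeffX eqxx mulr1 big1 ?addr0 // => i ne.
  by rewrite mcoeffCM mcoeffX (inj_eq ltau_inj) (negbTE ne) mulr0.
- transitivity (degm (gam c)); last by rewrite c0 raddf0.
  apply: esym; apply: etrans (congr1 (fun p => degm (gam p)) (mpolyE c)) _.
  exact: (raddf_sum (degm \o gam)%FUN).
Qed.
End AlgIndep.

(** * Normal forms modulo the relations *)

Section NormalForm.
Variables (B S : comNzRingType) (nu : {rmorphism B -> S}) (I : S -> Prop).
Variables (q r Q R de sg : B) (e a1 a2 a3 : S).
Hypotheses (I0 : I 0) (ID : forall f g, I f -> I g -> I (f + g))
  (IM : forall f g, I g -> I (f * g)).
Local Notation q' := (nu q).
Local Notation r' := (nu r).
Local Notation Q' := (nu Q).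
Local Notation R' := (nu R).
Local Notation d' := (nu de).
Local Notation s' := (nu sg).
Definition rel1 := e * a1 - (q' * a2 + r' * Q' - 2%:R * d' * q').
Definition rel2 := e * a2 - (q' * a3 + Q' * a1 - 2%:R * d' * e).
Definition rel3 := e * a3 - (q' * R' + Q' * a2 - 2%:R * d' * Q').
Definition rel4 := a1 ^+ 2 - (r' * a2 - q' ^+ 2 * e ^+ 2 + 4%:R * q' ^+ 3 * Q'
  + 2%:R * d' * r' + 8%:R * s' * q' ^+ 2).
Definition rel5 := a1 * a2 - (r' * a3 - q' * e ^+ 3 + 4%:R * q' ^+ 2 * Q' * e
  + 2%:R * d' * a1 + 8%:R * s' * q' * e).
Definition rel6 := a1 * a3 - (r' * R' - e ^+ 4 + 5%:R * q' * Q' * e ^+ 2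
  - 4%:R * q' ^+ 2 * Q' ^+ 2 + 4%:R * d' * a2 + 8%:R * s' * e ^+ 2
  - 8%:R * s' * q' * Q' - 8%:R * d' ^+ 2).
Definition rel7 := a2 ^+ 2 - (r' * R' - e ^+ 4 + 4%:R * q' * Q' * e ^+ 2
  + 4%:R * d' * a2 + 8%:R * s' * e ^+ 2 - 4%:R * d' ^+ 2).
Definition rel8 := a2 * a3 - (R' * a1 - Q' * e ^+ 3 + 4%:R * q' * Q' ^+ 2 * e
  + 2%:R * d' * a3 + 8%:R * s' * Q' * e).
Definition rel9 := a3 ^+ 2 - (R' * a2 - Q' ^+ 2 * e ^+ 2 + 4%:R * q' * Q' ^+ 3
  + 2%:R * d' * R' + 8%:R * s' * Q' ^+ 2).
Hypotheses (h1 : I rel1) (h2 : I rel2) (h3 : I rel3) (h4 : I rel4) (h5 : I rel5)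
  (h6 : I rel6) (h7 : I rel7) (h8 : I rel8) (h9 : I rel9).

Definition ncomb (c0 c1 c2 c3 c4 c5 c6 c7 : B) : S :=
  nu c0 + nu c1 * e + nu c2 * e ^+ 2 + nu c3 * e ^+ 3 + nu c4 * e ^+ 4
  + nu c5 * a1 + nu c6 * a2 + nu c7 * a3.
(** The coefficients come from B, the polynomials in q, r, Q, R, and I is the ideal of relations.
    Left multiplication by each generator will be shown to preserve such combinations. *)
Definition NF (p : S) : Prop := exists c0 c1 c2 c3 c4 c5 c6 c7 : B,
  I (p - ncomb c0 c1 c2 c3 c4 c5 c6 c7).

Lemma NF_comb c0 c1 c2 c3 c4 c5 c6 c7 p : p = ncomb c0 c1 c2 c3 c4 c5 c6 c7 -> NF p.
Proof. by move=> ->; exists c0, c1, c2, c3, c4, c5, c6, c7; rewrite subrr. Qed.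
Lemma NF_cong p p' : I (p - p') -> NF p' -> NF p.
Proof.
move=> h [c0 [c1 [c2 [c3 [c4 [c5 [c6 [c7 h']]]]]]]].
exists c0, c1, c2, c3, c4, c5, c6, c7; rewrite -(subrK p' p) -addrA.
exact: ID.
Qed.
Lemma NF_D p p' : NF p -> NF p' -> NF (p + p').
Proof.
move=> [c0 [c1 [c2 [c3 [c4 [c5 [c6 [c7 h]]]]]]]] [b0 [b1 [b2 [b3 [b4 [b5 [b6 [b7 h']]]]]]]].
exists (c0 + b0), (c1 + b1), (c2 + b2), (c3 + b3), (c4 + b4), (c5 + b5), (c6 + b6), (c7 + b7).
by move: (ID h h'); congr I; rewrite /ncomb; ring.
Qed.
Lemma NF_nu c p : NF p -> NF (nu c * p).
Proof.
move=> [c0 [c1 [c2 [c3 [c4 [c5 [c6 [c7 h]]]]]]]].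
exists (c * c0), (c * c1), (c * c2), (c * c3), (c * c4), (c * c5), (c * c6), (c * c7).
by move: (IM (nu c) h); congr I; rewrite /ncomb; ring.
Qed.

Lemma NF_mul g : NF (g * 1) -> NF (g * e) -> NF (g * e ^+ 2) -> NF (g * e ^+ 3) ->
  NF (g * e ^+ 4) -> NF (g * a1) -> NF (g * a2) -> NF (g * a3) ->
  forall p, NF p -> NF (g * p).
Proof.
move=> g0 g1 g2 g3 g4 g5 g6 g7 p [c0 [c1 [c2 [c3 [c4 [c5 [c6 [c7 h]]]]]]]].
apply: (NF_cong (p' := g * ncomb c0 c1 c2 c3 c4 c5 c6 c7)).
  by rewrite -mulrBr; apply: IM.
have -> : g * ncomb c0 c1 c2 c3 c4 c5 c6 c7 =
    nu c0 * (g * 1) + nu c1 * (g * e) + nu c2 * (g * e ^+ 2) + nu c3 * (g * e ^+ 3) +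
    nu c4 * (g * e ^+ 4) + nu c5 * (g * a1) + nu c6 * (g * a2) + nu c7 * (g * a3).
  by rewrite /ncomb; ring.
by do 7![apply: NF_D; last exact: NF_nu]; apply: NF_nu.
Qed.

Lemma NF_1 : NF 1. Proof. by apply: (NF_comb (c0 := 1) (c1 := 0) (c2 := 0) (c3 := 0) (c4 := 0) (c5 := 0) (c6 := 0) (c7 := 0)); rewrite /ncomb; ring. Qed.
Lemma NF_a1 : NF a1. Proof. by apply: (NF_comb (c0 := 0) (c1 := 0) (c2 := 0) (c3 := 0) (c4 := 0) (c5 := 1) (c6 := 0) (c7 := 0)); rewrite /ncomb; ring. Qed.
Lemma NF_a2 : NF a2. Proof. by apply: (NF_comb (c0 := 0) (c1 := 0) (c2 := 0) (c3 := 0) (c4 := 0) (c5 := 0) (c6 := 1) (c7 := 0)); rewrite /ncomb; ring. Qed.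
Lemma NF_a3 : NF a3. Proof. by apply: (NF_comb (c0 := 0) (c1 := 0) (c2 := 0) (c3 := 0) (c4 := 0) (c5 := 0) (c6 := 0) (c7 := 1)); rewrite /ncomb; ring. Qed.

Let NFr p rl c0 c1 c2 c3 c4 c5 c6 c7 : I rl ->
  p = rl + ncomb c0 c1 c2 c3 c4 c5 c6 c7 -> NF p.
Proof.
by move=> h ->; exists c0, c1, c2, c3, c4, c5, c6, c7; rewrite addrK.
Qed.

Lemma NF_e p : NF p -> NF (e * p).
Proof.
apply: NF_mul.
- by apply: (NF_comb (c0 := 0) (c1 := 1) (c2 := 0) (c3 := 0) (c4 := 0) (c5 := 0) (c6 := 0) (c7 := 0)); rewrite /ncomb; ring.
- by apply: (NF_comb (c0 := 0) (c1 := 0) (c2 := 1) (c3 := 0) (c4 := 0) (c5 := 0) (c6 := 0) (c7 := 0)); rewrite /ncomb; ring.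
- by apply: (NF_comb (c0 := 0) (c1 := 0) (c2 := 0) (c3 := 1) (c4 := 0) (c5 := 0) (c6 := 0) (c7 := 0)); rewrite /ncomb; ring.
- by apply: (NF_comb (c0 := 0) (c1 := 0) (c2 := 0) (c3 := 0) (c4 := 1) (c5 := 0) (c6 := 0) (c7 := 0)); rewrite /ncomb; ring.
(* e^5 is reduced by multiplying the relation for [a1 * a3] by e. *)
- have h : I (e * rel6 + (- a3) * rel1 + (- q') * rel8 + (4%:R * d') * rel2).
    by do 3![apply: ID; last exact: IM]; apply: IM.
  apply: (NFr (c0 := 0) (c1 := r * R - 4%:R * q ^+ 2 * Q ^+ 2 - 16%:R * de ^+ 2 - 16%:R * sg * q * Q
       - 4%:R * q ^+ 2 * Q ^+ 2)
    (c2 := 0) (c3 := 6%:R * q * Q + 8%:R * sg) (c4 := 0)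
    (c5 := 4%:R * de * Q - q * R) (c6 := 0) (c7 := 4%:R * de * q - r * Q) h).
  by rewrite /rel6 /rel1 /rel8 /rel2 /ncomb; ring.
- apply: (NFr (c0 := r * Q - 2%:R * de * q) (c1 := 0) (c2 := 0) (c3 := 0) (c4 := 0) (c5 := 0) (c6 := q) (c7 := 0) h1).
  by rewrite /rel1 /ncomb; ring.
- apply: (NFr (c0 := 0) (c1 := - 2%:R * de) (c2 := 0) (c3 := 0) (c4 := 0) (c5 := Q) (c6 := 0) (c7 := q) h2).
  by rewrite /rel2 /ncomb; ring.
- apply: (NFr (c0 := q * R - 2%:R * de * Q) (c1 := 0) (c2 := 0) (c3 := 0) (c4 := 0) (c5 := 0) (c6 := Q) (c7 := 0) h3).
  by rewrite /rel3 /ncomb; ring.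
Qed.

Let NF_ge g : NF g -> [/\ NF (g * 1), NF (g * e), NF (g * e ^+ 2), NF (g * e ^+ 3) & NF (g * e ^+ 4)].
Proof.
move=> h; split; rewrite ![g * _]mulrC ?mul1r // ?exprS ?expr0 -?mulrA ?mul1r;
  by do ?apply: NF_e.
Qed.

Lemma NF_11 : NF (a1 * a1).
Proof.
apply: (NFr (c0 := 4%:R * q ^+ 3 * Q + 2%:R * de * r + 8%:R * sg * q ^+ 2) (c1 := 0) (c2 := - q ^+ 2) (c3 := 0) (c4 := 0) (c5 := 0) (c6 := r) (c7 := 0) h4).
by rewrite /rel4 /ncomb; ring.
Qed.
Lemma NF_12 : NF (a1 * a2).
Proof.
apply: (NFr (c0 := 0) (c1 := 4%:R * q ^+ 2 * Q + 8%:R * sg * q) (c2 := 0) (c3 := - q) (c4 := 0) (c5 := 2%:R * de) (c6 := 0) (c7 := r) h5).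
by rewrite /rel5 /ncomb; ring.
Qed.
Lemma NF_13 : NF (a1 * a3).
Proof.
apply: (NFr (c0 := r * R - 4%:R * q ^+ 2 * Q ^+ 2 - 8%:R * sg * q * Q - 8%:R * de ^+ 2) (c1 := 0) (c2 := 5%:R * q * Q + 8%:R * sg) (c3 := 0) (c4 := -1) (c5 := 0) (c6 := 4%:R * de) (c7 := 0) h6).
by rewrite /rel6 /ncomb; ring.
Qed.
Lemma NF_22 : NF (a2 * a2).
Proof.
apply: (NFr (c0 := r * R - 4%:R * de ^+ 2) (c1 := 0) (c2 := 4%:R * q * Q + 8%:R * sg) (c3 := 0) (c4 := -1) (c5 := 0) (c6 := 4%:R * de) (c7 := 0) h7).
by rewrite /rel7 /ncomb; ring.
Qed.
Lemma NF_23 : NF (a2 * a3).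
Proof.
apply: (NFr (c0 := 0) (c1 := 4%:R * q * Q ^+ 2 + 8%:R * sg * Q) (c2 := 0) (c3 := - Q) (c4 := 0) (c5 := R) (c6 := 0) (c7 := 2%:R * de) h8).
by rewrite /rel8 /ncomb; ring.
Qed.
Lemma NF_33 : NF (a3 * a3).
Proof.
apply: (NFr (c0 := 4%:R * q * Q ^+ 3 + 2%:R * de * R + 8%:R * sg * Q ^+ 2) (c1 := 0) (c2 := - Q ^+ 2) (c3 := 0) (c4 := 0) (c5 := 0) (c6 := R) (c7 := 0) h9).
by rewrite /rel9 /ncomb; ring.
Qed.

Lemma NF_M1 p : NF p -> NF (a1 * p).
Proof.
have [g0 g1 g2 g3 g4] := NF_ge NF_a1.
apply: NF_mul => //; [exact: NF_11 | exact: NF_12 | exact: NF_13].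
Qed.
Lemma NF_M2 p : NF p -> NF (a2 * p).
Proof.
have [g0 g1 g2 g3 g4] := NF_ge NF_a2.
apply: NF_mul => //; [by rewrite mulrC; exact: NF_12 | exact: NF_22 | exact: NF_23].
Qed.
Lemma NF_M3 p : NF p -> NF (a3 * p).
Proof.
have [g0 g1 g2 g3 g4] := NF_ge NF_a3.
by apply: NF_mul => //; [rewrite mulrC; exact: NF_13 | rewrite mulrC; exact: NF_23 | exact: NF_33].
Qed.
End NormalForm.

(** * Invariants as symbols of polynomials in the generators *)

Section Generation.
Variables (k : comNzRingType) (z half : k).
Hypothesis domk : forall a b : k, a * b = 0 -> (a == 0) || (b == 0).
Hypotheses (z2 : z * z = -1) (halfK : half * 2%:R = 1).
Local Notation P := {mpoly k[4]}.
Local Notation S := {mpoly k[8]}.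
Local Notation Px := ('X_(inord 0) : P).
Local Notation Py := ('X_(inord 1) : P).
Local Notation PX := ('X_(inord 2) : P).
Local Notation PY := ('X_(inord 3) : P).

Definition subst4 (a b c d : P) : {rmorphism P -> P} :=
  mmap (@mpolyC 4 k) (fun i : 'I_4 => nth 0 [:: a; b; c; d] i).
Lemma subst4C a b c d t : subst4 a b c d t%:MP = t%:MP.
Proof. exact: mmapC. Qed.
Lemma subst4U a b c d i : subst4 a b c d 'X_i = nth 0 [:: a; b; c; d] i.
Proof. by rewrite [LHS]mmapX mmap1U. Qed.
Lemma subst4X a b c d m : subst4 a b c d 'X_[m] = a ^+ m (inord 0) * b ^+ m (inord 1) *
  c ^+ m (inord 2) * d ^+ m (inord 3).
Proof. by rewrite [LHS]mmapX mnm4_mmap1 !inordK. Qed.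

Variables (G : comNzRingType) (frac : {rmorphism P -> G}) (e : {rmorphism S -> {poly G}}).
Hypothesis frac_inj : injective frac.
(** Degrees in x and y of the symbols [cls]; Q and R get 0 because X and Y are not scaled. *)
Definition wgt (j : nat) : nat := nth 0 [:: 2; 4; 0; 0; 1; 3; 2; 1] j.
Definition cls (j : nat) : P := nth 0 [:: Px * Py; Px ^+ 4 + Py ^+ 4; PX * PY;
  PX ^+ 4 + PY ^+ 4; Px * PX + Py * PY; Px ^+ 3 * PY + Py ^+ 3 * PX;
  Px ^+ 2 * PY ^+ 2 + Py ^+ 2 * PX ^+ 2; Px * PY ^+ 3 + Py * PX ^+ 3] j.
Hypotheses (eC : forall c, e c%:MP = (frac c%:MP)%:P)
  (eL : forall j : 'I_8, plead (wgt j) (e 'X_j) (frac (cls j))).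

Definition Gen n (f : P) := exists p, plead n (e p) (frac f).
Lemma Gen_D n f g : Gen n f -> Gen n g -> Gen n (f + g).
Proof. by move=> [p hp] [q hq]; exists (p + q); rewrite !rmorphD; apply: pleadD. Qed.
Lemma Gen_M n m f g : Gen n f -> Gen m g -> Gen (n + m) (f * g).
Proof. by move=> [p hp] [q hq]; exists (p * q); rewrite !rmorphM; apply: pleadM. Qed.
Lemma Gen_C c : Gen 0 c%:MP.
Proof. by exists c%:MP; rewrite eC; apply: pleadC. Qed.
Lemma Gen_Z n c f : Gen n f -> Gen n (c *: f).
Proof. by move=> h; rewrite -mul_mpolyC; apply: Gen_M (Gen_C c) h. Qed.
Lemma Gen_N n f : Gen n f -> Gen n (- f).
Proof. by move=> h; rewrite -scaleN1r; apply: Gen_Z. Qed.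
Lemma Gen_0 n : Gen n 0.
Proof. by exists 0; rewrite !rmorph0; apply: plead0. Qed.
Lemma Gen_cls j : (j < 8)%N -> Gen (wgt j) (cls j).
Proof. by move=> hj; exists 'X_(inord j); have := eL (inord j); rewrite inordK. Qed.

Local Notation M := (symM Px Py PX PY).
Lemma Gen_symM a b c d : (a + d = b + c %[mod 4])%N -> Gen (a + b) (M a b c d).
Proof.
apply: (symM_gen Gen_D Gen_N Gen_M (Gen_C 1)).
- exact: (@Gen_cls 0).
- exact: (@Gen_cls 1).
- exact: (@Gen_cls 2).
- exact: (@Gen_cls 3).
- exact: (@Gen_cls 4).
- exact: (@Gen_cls 5).
- exact: (@Gen_cls 6).
- exact: (@Gen_cls 7).
Qed.

Local Notation rot4 := (subst4 (z%:MP * Px) ((- z)%:MP * Py) ((- z)%:MP * PX) (z%:MP * PY)).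
Local Notation swap4 := (subst4 Py Px PY PX).
(* [rot4] multiplies the monomial m by [chi4 m]. *)
Definition chi4 (m : 'X_{1..4}) : k :=
  z ^+ (m (inord 0) + m (inord 3)) * (- z) ^+ (m (inord 1) + m (inord 2)).

Lemma rot_arith (R : comNzRingType) (x y X Y u v : R) a b c d :
  (u * x) ^+ a * (v * y) ^+ b * (v * X) ^+ c * (u * Y) ^+ d =
  u ^+ (a + d) * v ^+ (b + c) * (x ^+ a * y ^+ b * X ^+ c * Y ^+ d).
Proof.
rewrite (exprMn a u x) (exprMn b v y) (exprMn c v X) (exprMn d u Y) !exprD.
by move: (x ^+ a) (y ^+ b) (X ^+ c) (Y ^+ d) (u ^+ a) (u ^+ d) (v ^+ b) (v ^+ c) => *; ring.
Qed.
Lemma X4E (m : 'X_{1..4}) : 'X_[m] = Px ^+ m (inord 0) * Py ^+ m (inord 1) *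
  PX ^+ m (inord 2) * PY ^+ m (inord 3).
Proof. by rewrite {1}(mn4_eta m) mpolyX_mn4. Qed.
Lemma rot4X m : rot4 'X_[m] = chi4 m *: 'X_[m].
Proof. by rewrite subst4X rot_arith -(X4E m) -mul_mpolyC /chi4 rmorphM !rmorphXn. Qed.
Lemma swap4X m : 'X_[m] + swap4 'X_[m] =
  M (m (inord 0)) (m (inord 1)) (m (inord 2)) (m (inord 3)).
Proof. by rewrite subst4X (X4E m). Qed.

Lemma n2 : 2%:R != 0 :> k.
Proof. by apply/eqP => h; move: halfK; rewrite h mulr0 => /eqP; rewrite eq_sym oner_eq0. Qed.

(** Since - z = z^3, [chi4 m] is a power of z, and z has order exactly 4 because 2 is invertible and
    so 1 differs from -1. *)
Lemma chi4_lat m : chi4 m = 1 ->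
  (m (inord 0) + m (inord 3) = m (inord 1) + m (inord 2) %[mod 4])%N.
Proof.
rewrite /chi4; move: (m _ + m _)%N (m _ + m _)%N => b a h.
have z4 : z ^+ 4 = 1 by rewrite (exprM z 2 2) (expr2 z) z2 sqrrN expr1n.
have zm n : z ^+ n = z ^+ (n %% 4).
  by rewrite {1}(divn_eq n 4) exprD mulnC exprM z4 expr1n mul1r.
have {h}h : z ^+ (a + 3 * b) = 1.
  have e3 : - z = z ^+ 3 by rewrite exprS (expr2 z) z2 mulrN1.
  by rewrite exprD exprM -e3.
have := n2; have n1 : 1 != -1 :> k.
  by rewrite -subr_eq0 opprK -(natrD _ 1 1) n2.
move=> n20; have : ((a + 3 * b) %% 4 = 0)%N; last by lia.
move: h; rewrite zm; have : ((a + 3 * b) %% 4 < 4)%N by rewrite ltn_mod.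
case: (_ %% 4)%N => [|[|[|[|n]]]] // _.
- rewrite expr1 => h; move: z2; rewrite h mulr1 => /eqP; by rewrite (negbTE n1).
- by rewrite expr2 z2 => /esym/eqP; rewrite (negbTE n1).
- rewrite exprS (expr2 z) z2 mulrN1 => h; move: z2; rewrite -mulrNN h mulr1 => /eqP.
  by rewrite (negbTE n1).
Qed.

Lemma mcoeff_msum (p : P) (g : 'X_{1..4} -> k) m :
  (\sum_(m <- msupp p) (p@_m * g m) *: 'X_[m])@_m = p@_m * g m.
Proof.
rewrite raddf_sum /=; have [hm|hm] := boolP (m \in msupp p).
  rewrite (bigD1_seq m) ?msupp_uniq //= mcoeffZ mcoeffX eqxx mulr1 big1 ?addr0 // => i ne.
  by rewrite mcoeffZ mcoeffX (negbTE ne) mulr0.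
rewrite (memN_msupp_eq0 hm) mul0r big_seq big1 // => i hi.
rewrite mcoeffZ mcoeffX; case: eqP => [ei|_]; last by rewrite mulr0.
by rewrite ei (negbTE hm) in hi.
Qed.

(** Invariance under the rotation restricts the support to the lattice of [chi4_lat], as
    coefficients lie in a domain. Invariance under the swap then writes f as half the sum of its
    symmetrised monomials. *)
Lemma Gen_inv n f : (forall m, m \in msupp f -> wt m = n) ->
  rot4 f = f -> swap4 f = f -> Gen n f.
Proof.
move=> hw hr hs.
have sE a b c d : subst4 a b c d f = \sum_(m <- msupp f) f@_m *: subst4 a b c d 'X_[m].
  rewrite [in LHS](mpolyE f) raddf_sum; apply: eq_bigr => m _.
  rewrite -!mul_mpolyC; apply: etrans (rmorphM (subst4 a b c d) _ _) _.
  by congr (_ * _); apply: subst4C.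
have lat m : m \in msupp f -> (m (inord 0) + m (inord 3) = m (inord 1) + m (inord 2) %[mod 4])%N.
  move=> hm; apply: chi4_lat; have := congr1 (mcoeff m) hr; rewrite sE.
  under eq_bigr => i _ do rewrite rot4X scalerA.
  rewrite mcoeff_msum => /eqP; rewrite -{2}[f@_m]mulr1 -subr_eq0 -mulrBr => /eqP /domk.
  by rewrite mcoeff_eq0 hm /= subr_eq0 => /eqP.
have -> : f = \sum_(m <- msupp f) (half * f@_m) *:
    M (m (inord 0)) (m (inord 1)) (m (inord 2)) (m (inord 3)).
  under eq_bigr => m _ do rewrite -swap4X -scalerA scalerDr scalerDr.
  rewrite big_split /= -!scaler_sumr -mpolyE -sE hs -scalerDr -mulr2n -scaler_nat scalerA.
  by rewrite halfK scale1r.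
rewrite big_seq; elim/big_ind: _ => [|p q hp hq|m hm]; first exact: Gen_0.
  exact: Gen_D.
by apply: Gen_Z; rewrite -(hw m hm); apply: Gen_symM; apply: lat.
Qed.

End Generation.

Lemma coinvE_map (D : comNzRingType) (f : {rmorphism D -> D}) (c : 'I_8 -> D) x y X Y u v :
  let E := coinvE X Y (c (inord 0)) (c (inord 1)) (c (inord 2)) (c (inord 3))
    (c (inord 4)) (c (inord 5)) (c (inord 6)) (c (inord 7)) in
  f X = X -> f Y = Y -> (forall i, f (c i) = c i) -> f x = u -> f y = v ->
  E x y = 0 -> E u v = 0.
Proof.
move=> E eX eY ec <- <- /(congr1 f); rewrite rmorph0 => <-.
by rewrite /E /coinvE !(rmorphD, rmorphM, rmorphXn) /= eX eY !ec.
Qed.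

Definition ibase (R : comNzRingType) (e a1 a2 a3 : R) (i : 'I_8) : R :=
  nth 0 [:: 1; e; e ^+ 2; e ^+ 3; e ^+ 4; a1; a2; a3] i.
Lemma sum_ibase (R : comNzRingType) (e a1 a2 a3 : R) (c : 'I_8 -> R) :
  \sum_i c i * ibase e a1 a2 a3 i =
  c (inord 0) + c (inord 1) * e + c (inord 2) * e ^+ 2 + c (inord 3) * e ^+ 3 +
  c (inord 4) * e ^+ 4 + c (inord 5) * a1 + c (inord 6) * a2 + c (inord 7) * a3.
Proof.
transitivity (\sum_(0 <= i < 8) c (inord i) *
    nth 0 [:: 1; e; e ^+ 2; e ^+ 3; e ^+ 4; a1; a2; a3] i).
  by rewrite big_mkord; apply: eq_bigr => i _; rewrite inord_val.
by rewrite !big_nat_recr //= big_geq // add0r mulr1.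
Qed.

(** * Linear independence of the normal forms *)

Section ClassicalFreeness.
Variables (k : comNzRingType) (z half : k).
Hypotheses (z2 : z * z = -1) (halfK : half * 2%:R = 1).
Local Notation P := {mpoly k[4]}.
Local Notation S := {mpoly k[8]}.
Local Notation Px := ('X_(inord 0) : P).
Local Notation Py := ('X_(inord 1) : P).
Local Notation PX := ('X_(inord 2) : P).
Local Notation PY := ('X_(inord 3) : P).
Local Notation gam := (@gam k).
Hypothesis domP : forall a b : P, a * b = 0 -> (a == 0) || (b == 0).

Lemma subst4_gam u v c : u * v = Px * Py -> u ^+ 4 + v ^+ 4 = Px ^+ 4 + Py ^+ 4 ->
  subst4 u v PX PY (gam c) = gam c.
Proof.
move=> h2 h4; move: c.
apply: (@mpoly_rmorph_eq2 _ _ _ _ gam (subst4 u v PX PY) gam) => [c|i].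
  apply: etrans (congr1 (subst4 u v PX PY) (gamC c)) _.
  exact: etrans (subst4C _ _ _ _ c) (esym (gamC c)).
have gU : gam 'X_i = invt k i by rewrite [LHS]mmapX mmap1U.
rewrite gU; set s := subst4 u v PX PY.
have sx : s Px = u by rewrite [LHS]subst4U inordK.
have sy : s Py = v by rewrite [LHS]subst4U inordK.
have sX : s PX = PX by rewrite [LHS]subst4U inordK.
have sY : s PY = PY by rewrite [LHS]subst4U inordK.
case: (I4E i) => ->; rewrite /invt inordK //=.
- by rewrite rmorphM sx sy.
- by rewrite rmorphD !rmorphXn sx sy.
- by rewrite rmorphM sX sY.
- by rewrite rmorphD !rmorphXn sX sY.
Qed.

Lemma X4_neq (m m' : 'X_{1..4}) : m != m' -> 'X_[m] - 'X_[m'] != 0 :> P.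
Proof.
move=> ne; apply/eqP => /(congr1 (mcoeff m)); rewrite mcoeffB !mcoeffX eqxx mcoeff0.
by rewrite eq_sym (negbTE ne) subr0 => /eqP; rewrite oner_eq0.
Qed.
Lemma xy4 : Px ^+ 4 - Py ^+ 4 != 0.
Proof.
have := @X4_neq (mn4 4 0 0 0) (mn4 0 4 0 0); rewrite !mpolyX_mn4 !expr0 !mulr1 mul1r; apply.
by apply/eqP => /mnmP/(_ (inord 0)); rewrite !mn4E.
Qed.
Lemma XY4 : PX ^+ 4 - PY ^+ 4 != 0.
Proof.
have := @X4_neq (mn4 0 0 4 0) (mn4 0 0 0 4); rewrite !mpolyX_mn4 !expr0 !mulr1 !mul1r; apply.
by apply/eqP => /mnmP/(_ (inord 2)); rewrite !mn4E.
Qed.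

Local Notation cbase := (ibase (Px * PX + Py * PY) (Px ^+ 3 * PY + Py ^+ 3 * PX)
  (Px ^+ 2 * PY ^+ 2 + Py ^+ 2 * PX ^+ 2) (Px * PY ^+ 3 + Py * PX ^+ 3)).

Lemma z_arith (R : comNzRingType) (x y i : R) : i * i = -1 ->
  (i * x) * (- i * y) = x * y /\ (i * x) ^+ 4 + (- i * y) ^+ 4 = x ^+ 4 + y ^+ 4.
Proof. by move=> h; split; ring: h. Qed.
Lemma N_arith (R : comNzRingType) (x y : R) :
  (- x) * (- y) = x * y /\ (- x) ^+ 4 + (- y) ^+ 4 = x ^+ 4 + y ^+ 4.
Proof. by split; ring. Qed.

(** The relation at (x, y) is transported to the eight pairs of the W-orbit by substitutions that
    keep x y and x^4 + y^4, hence all coefficients; [coinv_free] then kills these. *)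
Lemma gam_free (c : 'I_8 -> P) : \sum_i gam (c i) * cbase i = 0 -> forall i, c i = 0.
Proof.
rewrite sum_ibase => e0.
pose E := coinvE PX PY (gam (c (inord 0))) (gam (c (inord 1))) (gam (c (inord 2)))
  (gam (c (inord 3))) (gam (c (inord 4))) (gam (c (inord 5))) (gam (c (inord 6)))
  (gam (c (inord 7))).
have E0 : E Px Py = 0 by exact: e0.
have E1 u v : u * v = Px * Py -> u ^+ 4 + v ^+ 4 = Px ^+ 4 + Py ^+ 4 -> E u v = 0.
  move=> h2 h4; have h i := subst4_gam (c i) h2 h4.
  have hU i : subst4 u v PX PY 'X_i = nth 0 [:: u; v; PX; PY] i by apply: subst4U.
  have hx := hU (inord 0); have hy := hU (inord 1).
  have hX := hU (inord 2); have hY := hU (inord 3).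
  rewrite inordK in hx; last by []. rewrite inordK in hy; last by [].
  rewrite inordK in hX; last by []. rewrite inordK in hY; last by [].
  exact: (coinvE_map (c := fun i => gam (c i)) hX hY h hx hy E0).
have zP : (z%:MP * z%:MP = -1 :> P) by rewrite -rmorphM z2 rmorphN1.
have n4 : 4%:R != 0 :> P.
  apply/eqP => h; have : half%:MP * half%:MP * 4%:R = 1 :> P.
    by rewrite -(rmorph_nat (@mpolyC 4 k)) -!rmorphM (natrM _ 2 2) mulrACA halfK mulr1 rmorph1.
  by rewrite h mulr0 => /esym/eqP; rewrite oner_eq0.
have [a0 a1] := z_arith Px Py zP; have [b0 b1] := N_arith Px Py.
have zP' : (- z%:MP) * (- z%:MP) = -1 :> P by rewrite mulrNN.
have [d0 d1] := z_arith Px Py zP'; rewrite opprK in d0 d1.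
have sw (u v : P) : u * v = Px * Py /\ u ^+ 4 + v ^+ 4 = Px ^+ 4 + Py ^+ 4 ->
  v * u = Px * Py /\ v ^+ 4 + u ^+ 4 = Px ^+ 4 + Py ^+ 4 by rewrite mulrC addrC.
have E' u v : u * v = Px * Py /\ u ^+ 4 + v ^+ 4 = Px ^+ 4 + Py ^+ 4 -> E u v = 0 := fun h => E1 u v h.1 h.2.
have [g1 g2] := coinv_free domP zP n4 xy4 XY4 E0 (E1 _ _ a0 a1) (E1 _ _ b0 b1) (E1 _ _ d0 d1)
  (E' _ _ (sw _ _ (conj erefl erefl))) (E' _ _ (sw _ _ (conj d0 d1)))
  (E' _ _ (sw _ _ (conj b0 b1))) (E' _ _ (sw _ _ (conj a0 a1))).
have {g1 g2}[[/gam_inj0 c0 /gam_inj0 c1 /gam_inj0 c2 /gam_inj0 c3]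
  [/gam_inj0 c4 /gam_inj0 c5 /gam_inj0 c6 /gam_inj0 c7]] := conj g1 g2.
case=> j hj; have -> : Ordinal hj = inord j by apply: val_inj; rewrite /= inordK.
by case: j hj => [|[|[|[|[|[|[|[|]]]]]]]].
Qed.
End ClassicalFreeness.

Section Kernel.
Variables (k : comNzRingType) (z half : k).
Hypotheses (z2 : z * z = -1) (halfK : half * 2%:R = 1).
Local Notation P := {mpoly k[4]}.
Local Notation S := {mpoly k[8]}.
Local Notation Px := ('X_(inord 0) : P).
Local Notation Py := ('X_(inord 1) : P).
Local Notation PX := ('X_(inord 2) : P).
Local Notation PY := ('X_(inord 3) : P).
Local Notation gam := (@gam k).
Hypothesis domP : forall a b : P, a * b = 0 -> (a == 0) || (b == 0).
Variables (G : comNzRingType) (frac : {rmorphism P -> G}) (e : {rmorphism S -> {poly G}}).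
Hypothesis frac_inj : injective frac.
Hypotheses (eC : forall c, e c%:MP = (frac c%:MP)%:P)
  (eL : forall j : 'I_8, plead (wgt j) (e 'X_j) (frac (cls k j))).
Local Notation Sv j := ('X_(inord j) : S).

Definition nu : {rmorphism P -> S} := mmap (@mpolyC 8 k) (fun i : 'I_4 => Sv i).
Lemma nuC c : nu c%:MP = c%:MP. Proof. exact: mmapC. Qed.
Lemma nuU j : (j < 4)%N -> nu 'X_(inord j) = Sv j.
Proof. by move=> hj; rewrite [LHS]mmapX mmap1U inordK. Qed.
Lemma nuX m : nu 'X_[m] = Sv 0 ^+ m (inord 0) * Sv 1 ^+ m (inord 1) *
  Sv 2 ^+ m (inord 2) * Sv 3 ^+ m (inord 3).
Proof. by rewrite [LHS]mmapX mnm4_mmap1 !inordK. Qed.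

Lemma eLj j : (j < 8)%N -> plead (wgt j) (e (Sv j)) (frac (cls k j)).
Proof. by move=> hj; have := eL (inord j); rewrite inordK. Qed.

Definition wnu (m : 'X_{1..4}) : nat := (2 * m (inord 0) + 4 * m (inord 1) +
  0 * m (inord 2) + 0 * m (inord 3))%N.
Lemma plead_nu m : plead (wnu m) (e (nu 'X_[m])) (frac (gam 'X_[m])).
Proof.
rewrite nuX gamX !rmorph_mono4.
have h0 := pleadX (m (inord 0)) (eLj (j := 0) isT).
have h1 := pleadX (m (inord 1)) (eLj (j := 1) isT).
have h2 := pleadX (m (inord 2)) (eLj (j := 2) isT).
have h3 := pleadX (m (inord 3)) (eLj (j := 3) isT).
exact: (pleadM (pleadM (pleadM h0 h1) h2) h3).
Qed.

Definition sbase : 'I_8 -> S := ibase (Sv 4) (Sv 5) (Sv 6) (Sv 7).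
Definition cbase : 'I_8 -> P :=
  ibase (Px * PX + Py * PY) (Px ^+ 3 * PY + Py ^+ 3 * PX)
  (Px ^+ 2 * PY ^+ 2 + Py ^+ 2 * PX ^+ 2) (Px * PY ^+ 3 + Py * PX ^+ 3).
Definition wbase (i : 'I_8) : nat := nth 0 [:: 0; 1; 1 * 2; 1 * 3; 1 * 4; 3; 2; 1]%N i.
Lemma plead_base i : plead (wbase i) (e (sbase i)) (frac (cbase i)).
Proof.
have h4 := eLj (j := 4) isT.
case: i => [] [|[|[|[|[|[|[|[|//]]]]]]]] hi; rewrite /wbase /sbase /cbase /ibase /= ?rmorphXn.
- by rewrite !rmorph1; apply: pleadC.
- exact: h4.
- exact: pleadX 2 h4.
- exact: pleadX 3 h4.
- exact: pleadX 4 h4.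
- exact: (eLj (j := 5) isT).
- exact: (eLj (j := 6) isT).
- exact: (eLj (j := 7) isT).
Qed.

(** [graded_free] over the pairs (basis element, monomial in q, r, Q, R): the leading parts of one
    degree form a relation between the classical symbols, excluded by [gam_free]. *)
Lemma nu_free (c : 'I_8 -> P) : e (\sum_i nu (c i) * sbase i) = 0 -> forall i, c i = 0.
Proof.
move=> e0 i; apply/mpolyP => m; rewrite mcoeff0.
have [hm|] := boolP (m \in msupp (c i)); last exact: memN_msupp_eq0.
pose s := [seq (i, m) | i <- index_enum 'I_8, m <- msupp (c i)].
have his : (i, m) \in s by apply: allpairs_f_dep => //; apply: mem_index_enum.
pose F (j : 'I_8 * 'X_{1..4}) := e (nu ((c j.1)@_j.2 *: 'X_[j.2]) * sbase j.1).
pose L (j : 'I_8 * 'X_{1..4}) := frac (gam ((c j.1)@_j.2 *: 'X_[j.2]) * cbase j.1).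
pose d (j : 'I_8 * 'X_{1..4}) := (0 + wnu j.2 + wbase j.1)%N.
have FE j : F j = (frac ((c j.1)@_j.2)%:MP)%:P * e (nu 'X_[j.2]) * e (sbase j.1).
  rewrite /F -mul_mpolyC rmorphM; congr (_ * _).
  by rewrite rmorphM rmorphM; congr (_ * _); rewrite -eC; congr (e _); apply: nuC.
have LE j : L j = frac ((c j.1)@_j.2)%:MP * frac (gam 'X_[j.2]) * frac (cbase j.1).
  rewrite /L -mul_mpolyC rmorphM; congr (_ * _).
  by rewrite rmorphM rmorphM; congr (_ * _); congr (frac _); apply: gamC.
apply: (@graded_free _ _ s F d L (fun j => (c j.1)@_j.2 = 0) _ _ _ _ (i, m) his).
- move=> j; rewrite FE LE; apply: pleadM (plead_base _).
  by apply: pleadM (plead_nu _); apply: pleadC.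
- by move=> j h; rewrite FE h mpolyC0 rmorph0 polyC0 !mul0r.
- move=> n top0 [i' m'] hj dj /=.
  (* The part of c i whose monomials, together with the i-th basis element, reach degree exactly
     n. *)
  pose D i := \sum_(m <- msupp (c i) | d (i, m) == n) (c i)@_m *: 'X_[m].
  have D0 : \sum_i gam (D i) * cbase i = 0.
    apply: frac_inj; rewrite rmorph0 -[RHS]top0 /s [RHS]big_mkcond [RHS]big_allpairs_dep raddf_sum.
    apply: eq_bigr => l _; rewrite -big_mkcond [gam _]raddf_sum mulr_suml raddf_sum.
    exact: eq_bigr.
  have := congr1 (mcoeff m') (gam_free z2 halfK domP D0 i'); rewrite mcoeff0 /D raddf_sum /=.
  have hm' : m' \in msupp (c i').
    by have /allpairsPdep [a [b [_ hb [-> ->]]]] := hj.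
  rewrite -big_filter (bigD1_seq m') ?filter_uniq ?msupp_uniq ?mem_filter ?dj ?eqxx //=.
  rewrite mcoeffZ mcoeffX eqxx mulr1 big1 ?addr0 // => l ne.
  by rewrite mcoeffZ mcoeffX (negbTE ne) mulr0.
- rewrite /s big_allpairs_dep -[RHS]e0 raddf_sum; apply: eq_bigr => l _.
  rewrite [in RHS](mpolyE (c l)) [in RHS]raddf_sum mulr_suml [RHS]raddf_sum.
  exact: eq_bigr.
Qed.

Variables (I : S -> Prop) (de sg : k).
Hypotheses (I0 : I 0) (ID : forall f g, I f -> I g -> I (f + g))
  (IM : forall f g, I g -> I (f * g)) (eI : forall f, I f -> e f = 0).
Local Notation B0 := ('X_(inord 0) : P).
Local Notation B1 := ('X_(inord 1) : P).
Local Notation B2 := ('X_(inord 2) : P).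
Local Notation B3 := ('X_(inord 3) : P).
Local Notation NF := (NF nu I (Sv 4) (Sv 5) (Sv 6) (Sv 7)).
Hypotheses (h1 : I (rel1 nu B0 B1 B2 de%:MP (Sv 4) (Sv 5) (Sv 6)))
  (h2 : I (rel2 nu B0 B2 de%:MP (Sv 4) (Sv 5) (Sv 6) (Sv 7)))
  (h3 : I (rel3 nu B0 B2 B3 de%:MP (Sv 4) (Sv 6) (Sv 7)))
  (h4 : I (rel4 nu B0 B1 B2 de%:MP sg%:MP (Sv 4) (Sv 5) (Sv 6)))
  (h5 : I (rel5 nu B0 B1 B2 de%:MP sg%:MP (Sv 4) (Sv 5) (Sv 6) (Sv 7)))
  (h6 : I (rel6 nu B0 B1 B2 B3 de%:MP sg%:MP (Sv 4) (Sv 5) (Sv 6) (Sv 7)))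
  (h7 : I (rel7 nu B0 B1 B2 B3 de%:MP sg%:MP (Sv 4) (Sv 6)))
  (h8 : I (rel8 nu B0 B2 B3 de%:MP sg%:MP (Sv 4) (Sv 5) (Sv 6) (Sv 7)))
  (h9 : I (rel9 nu B0 B2 B3 de%:MP sg%:MP (Sv 4) (Sv 6) (Sv 7))).

Lemma NF_var (i : 'I_8) p : NF p -> NF ('X_i * p).
Proof.
have -> : i = inord i by rewrite inord_val.
have b j : (j < 4)%N -> NF p -> NF (Sv j * p).
  by move=> hj; rewrite -(nuU hj); apply: (NF_nu IM).
case: i => [] [|[|[|[|[|[|[|[|//]]]]]]]] hi; try exact: b.
- exact: (NF_e I0 ID IM h1 h2 h3 h6 h8).
- exact: (NF_M1 I0 ID IM h1 h2 h3 h4 h5 h6 h8).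
- exact: (NF_M2 I0 ID IM h1 h2 h3 h5 h6 h7 h8).
- exact: (NF_M3 I0 ID IM h1 h2 h3 h6 h8 h9).
Qed.

Lemma NF_all p : NF p.
Proof.
rewrite [p]mpolyE; apply: (big_ind NF).
- by have := NF_nu IM 0 (NF_1 nu (Sv 4) (Sv 5) (Sv 6) (Sv 7) I0); rewrite rmorph0 mul0r.
- exact: NF_D.
move=> m _; rewrite -mul_mpolyC -(nuC (p@_m)); apply: (NF_nu IM).
pose Q (g : S) := forall r, NF r -> NF (g * r).
suff h : Q 'X_[m] by rewrite -[X in NF X]mulr1; apply/h/NF_1.
rewrite mpolyXE_id; apply: (big_ind Q).
- by move=> r; rewrite mul1r.
- by move=> f g hf hg r hr; rewrite -mulrA; apply/hf/hg.
move=> i _; elim: (m i) => [|n IH] r hr; first by rewrite expr0 mul1r.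
by rewrite exprS -mulrA; apply/NF_var/IH.
Qed.

(** Modulo I, p equals a normal form, which [e] also sends to 0; by [nu_free] its coefficients
    vanish, so p itself lies in I. *)
Lemma kernel_ideal p : e p = 0 -> I p.
Proof.
move=> p0; have [c0 [c1 [c2 [c3 [c4 [c5 [c6 [c7 h]]]]]]]] := NF_all p.
pose c (i : 'I_8) := nth 0 [:: c0; c1; c2; c3; c4; c5; c6; c7] i.
have cE : ncomb nu (Sv 4) (Sv 5) (Sv 6) (Sv 7) c0 c1 c2 c3 c4 c5 c6 c7 =
    \sum_i nu (c i) * sbase i.
  by rewrite sum_ibase /c !inordK.
have e0 : e (\sum_i nu (c i) * sbase i) = 0.
  by have := eI h; rewrite rmorphB p0 sub0r cE => /eqP; rewrite oppr_eq0 => /eqP.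
have c_0 := nu_free e0.
move: h; rewrite cE big1 ?subr0 // => i _; by rewrite c_0 rmorph0 mul0r.
Qed.
End Kernel.

(** * The nine relators and the kernel of the evaluation *)

(** Over an arbitrary commutative ring, so that the same expression serves for the relators and, by
    [map_relator_seq], for their images. *)
Definition relator_seq (R0 : comNzRingType) (A B q r Q R eu a1 a2 a3 : R0) : seq R0 :=
    [:: eu * a1 - (q * a2 + r * Q - 2%:R * (A ^+ 2 - B ^+ 2) * q);
        eu * a2 - (q * a3 + Q * a1 - 2%:R * (A ^+ 2 - B ^+ 2) * eu);
        eu * a3 - (q * R + Q * a2 - 2%:R * (A ^+ 2 - B ^+ 2) * Q);
        a1 ^+ 2 - (r * a2 - q ^+ 2 * eu ^+ 2 + 4%:R * q ^+ 3 * Q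
                   + 2%:R * (A ^+ 2 - B ^+ 2) * r
                   + 8%:R * (A ^+ 2 + B ^+ 2) * q ^+ 2);
        a1 * a2 - (r * a3 - q * eu ^+ 3 + 4%:R * q ^+ 2 * Q * eu
                   + 2%:R * (A ^+ 2 - B ^+ 2) * a1
                   + 8%:R * (A ^+ 2 + B ^+ 2) * q * eu);
        a1 * a3 - (r * R - eu ^+ 4 + 5%:R * q * Q * eu ^+ 2
                   - 4%:R * q ^+ 2 * Q ^+ 2
                   + 4%:R * (A ^+ 2 - B ^+ 2) * a2
                   + 8%:R * (A ^+ 2 + B ^+ 2) * eu ^+ 2
                   - 8%:R * (A ^+ 2 + B ^+ 2) * q * Q
                   - 8%:R * (A ^+ 2 - B ^+ 2) ^+ 2);
        a2 ^+ 2 - (r * R - eu ^+ 4 + 4%:R * q * Q * eu ^+ 2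
                   + 4%:R * (A ^+ 2 - B ^+ 2) * a2
                   + 8%:R * (A ^+ 2 + B ^+ 2) * eu ^+ 2
                   - 4%:R * (A ^+ 2 - B ^+ 2) ^+ 2);
        a2 * a3 - (R * a1 - Q * eu ^+ 3 + 4%:R * q * Q ^+ 2 * eu
                   + 2%:R * (A ^+ 2 - B ^+ 2) * a3
                   + 8%:R * (A ^+ 2 + B ^+ 2) * Q * eu);
        a3 ^+ 2 - (R * a2 - Q ^+ 2 * eu ^+ 2 + 4%:R * q * Q ^+ 3
                   + 2%:R * (A ^+ 2 - B ^+ 2) * R
                   + 8%:R * (A ^+ 2 + B ^+ 2) * Q ^+ 2)].

Lemma map_relator_seq (R1 R2 : comNzRingType) (f : {rmorphism R1 -> R2}) A B q r Q R eu a1 a2 a3 :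
  map f (relator_seq A B q r Q R eu a1 a2 a3) =
  relator_seq (f A) (f B) (f q) (f r) (f Q) (f R) (f eu) (f a1) (f a2) (f a3).
Proof. by rewrite /relator_seq /=; do 9![congr cons; first by ring]. Qed.

Lemma hat_relator_seq (R : comNzRingType) (x y X Y a b A B : R) :
  A ^+ 2 = a * (X ^+ 2 - Y ^+ 2) ^+ 2 -> B ^+ 2 = b * (X ^+ 2 + Y ^+ 2) ^+ 2 ->
  relator_seq A B (dunklQ x y X Y a b) (dunklR x y X Y a b) (X * Y) (X ^+ 4 + Y ^+ 4)
    (x * X + y * Y) (hata1 x y X Y a b) (hata2 x y X Y a b) (hata3 x y X Y) = nseq 9 0.
Proof.
move=> hA hB; have [[r1 r2 r3] [r4 r5 r6] [r7 r8 r9]] := hat_relations x y hA hB.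
rewrite /relator_seq.
do 9![congr cons; first by apply/eqP; rewrite subr_eq0; apply/eqP].
Qed.

Section Presentation.
Variables (k : comNzRingType) (z half : k).
Hypotheses (z2 : z * z = -1) (halfK : half * 2%:R = 1).
Local Notation P := {mpoly k[4]}.
Local Notation S := {mpoly k[8]}.
Local Notation nu := (@nu k).
Hypothesis domP : forall a b : P, a * b = 0 -> (a == 0) || (b == 0).
Variables (G : comNzRingType) (frac : {rmorphism P -> G}) (e : {rmorphism S -> {poly G}}).
Hypothesis frac_inj : injective frac.
Hypotheses (eC : forall c, e c%:MP = (frac c%:MP)%:P)
  (eL : forall j : 'I_8, plead (wgt j) (e 'X_j) (frac (cls k j))).
Local Notation Sv j := ('X_(inord j) : S).
Variables (pA pB : k).
Definition relators : seq S := relator_seq pA%:MP pB%:MP (Sv 0) (Sv 1) (Sv 2) (Sv 3)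
  (Sv 4) (Sv 5) (Sv 6) (Sv 7).
Hypothesis e_rel : forall r, r \in relators -> e r = 0.
Local Notation I := (gen_ideal (fun r => r \in relators)).

Lemma gen_ideal_kernel p : e p = 0 <-> I p.
Proof.
have eI q : I q -> e q = 0.
  elim=> [r /e_rel //||f g _ ef _ eg|f g _ eg|f g _ eg].
  - by rewrite rmorph0.
  - by rewrite rmorphD ef eg addr0.
  - by rewrite rmorphM eg mulr0.
  - by rewrite rmorphM eg mul0r.
split=> [|/eI //].
have I0 : I 0 := GenIdeal_zero _.
have ID f g : I f -> I g -> I (f + g) := @GenIdeal_add _ _ f g.
have IM f g : I g -> I (f * g) := @GenIdeal_mull _ _ f g.
have mem i r : (i < 9)%N -> r = nth 0 relators i -> I r.
  by move=> hi ->; apply: GenIdeal_gen; apply: mem_nth.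
have nuD : nu (pA ^+ 2 - pB ^+ 2)%:MP = pA%:MP ^+ 2 - pB%:MP ^+ 2.
  by rewrite nuC rmorphB !rmorphXn.
have nuS : nu (pA ^+ 2 + pB ^+ 2)%:MP = pA%:MP ^+ 2 + pB%:MP ^+ 2.
  by rewrite nuC rmorphD !rmorphXn.
have nU := @nuU k.
apply: (kernel_ideal z2 halfK domP frac_inj eC eL (de := pA ^+ 2 - pB ^+ 2)
  (sg := pA ^+ 2 + pB ^+ 2) I0 ID IM eI).
- by apply: (mem 0%N) => //; rewrite /rel1 !nU // nuD.
- by apply: (mem 1%N) => //; rewrite /rel2 !nU // nuD.
- by apply: (mem 2%N) => //; rewrite /rel3 !nU // nuD.
- by apply: (mem 3%N) => //; rewrite /rel4 !nU // nuD nuS.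
- by apply: (mem 4%N) => //; rewrite /rel5 !nU // nuD nuS.
- by apply: (mem 5%N) => //; rewrite /rel6 !nU // nuD nuS.
- by apply: (mem 6%N) => //; rewrite /rel7 !nU // nuD nuS.
- by apply: (mem 7%N) => //; rewrite /rel8 !nU // nuD nuS.
- by apply: (mem 8%N) => //; rewrite /rel9 !nU // nuD nuS.
Qed.
End Presentation.

Section HatLead.
Variables (G : comNzRingType) (x y X Y a b : G).
Local Notation xp := (x%:P * 'X).
Local Notation yp := (y%:P * 'X).

Let lead_lt n m (p : {poly G}) c d : plead n p c -> (m < n)%N -> plead n (p + d%:P * 'X^m) c.
Proof.
move=> hp mn; rewrite -[c]addr0; apply: (pleadD hp); apply: plead_small.
apply: leq_trans mn; apply: leq_trans (size_polyMleq _ _) _.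
by rewrite size_polyXn addnS /= size_polyC; case: eqP.
Qed.
Let leadXn n (c : G) : plead n (c%:P * 'X^n) c.
Proof.
split; last by rewrite coefCM coefXn eqxx mulr1.
apply: leq_trans (size_polyMleq _ _) _.
by rewrite size_polyXn addnS /= size_polyC; case: eqP.
Qed.
Lemma plead_q : plead 2 (dunklQ xp yp X%:P Y%:P a%:P b%:P) (x * y).
Proof.
have -> : dunklQ xp yp X%:P Y%:P a%:P b%:P =
    (x * y)%:P * 'X^2 + (4%:R * X * Y * (a - b))%:P * 'X^0.
  by rewrite /dunklQ; ring.
exact: lead_lt.
Qed.
Lemma plead_r : plead 4 (dunklR xp yp X%:P Y%:P a%:P b%:P) (x ^+ 4 + y ^+ 4).
Proof.
have -> : dunklR xp yp X%:P Y%:P a%:P b%:P =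
    (x ^+ 4 + y ^+ 4)%:P * 'X^4
    + (- 16%:R * (a + b) * x * y * X * Y - 8%:R * (a + b) * (x ^+ 2 * X ^+ 2 + y ^+ 2 * Y ^+ 2)
       - 8%:R * (a - b) * (x ^+ 2 * Y ^+ 2 + y ^+ 2 * X ^+ 2))%:P * 'X^2
    + (16%:R * (a - b) ^+ 2 * (X ^+ 4 + Y ^+ 4))%:P * 'X^0.
  by rewrite /dunklR; ring.
by apply: lead_lt => //; apply: lead_lt.
Qed.
Lemma plead_e : plead 1 (xp * X%:P + yp * Y%:P) (x * X + y * Y).
Proof.
have -> : xp * X%:P + yp * Y%:P = (x * X + y * Y)%:P * 'X^1 by ring.
exact: leadXn.
Qed.
Lemma plead_a1 : plead 3 (hata1 xp yp X%:P Y%:P a%:P b%:P) (x ^+ 3 * Y + y ^+ 3 * X).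
Proof.
have -> : hata1 xp yp X%:P Y%:P a%:P b%:P = (x ^+ 3 * Y + y ^+ 3 * X)%:P * 'X^3
    + (- 8%:R * (a + b) * (x * X + y * Y) * X * Y
       - 4%:R * (a - b) * (x * Y ^+ 3 + y * X ^+ 3))%:P * 'X^1.
  by rewrite /hata1; ring.
exact: lead_lt.
Qed.
Lemma plead_a2 : plead 2 (hata2 xp yp X%:P Y%:P a%:P b%:P) (x ^+ 2 * Y ^+ 2 + y ^+ 2 * X ^+ 2).
Proof.
have -> : hata2 xp yp X%:P Y%:P a%:P b%:P = (x ^+ 2 * Y ^+ 2 + y ^+ 2 * X ^+ 2)%:P * 'X^2
    + (- 4%:R * (a + b) * X ^+ 2 * Y ^+ 2 - 2%:R * (a - b) * (X ^+ 4 + Y ^+ 4))%:P * 'X^0.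
  by rewrite /hata2; ring.
exact: lead_lt.
Qed.
Lemma plead_a3 : plead 1 (hata3 xp yp X%:P Y%:P) (x * Y ^+ 3 + y * X ^+ 3).
Proof.
have -> : hata3 xp yp X%:P Y%:P = (x * Y ^+ 3 + y * X ^+ 3)%:P * 'X^1.
  by rewrite /hata3; ring.
exact: leadXn.
Qed.
Lemma plead_hats j : (j < 8)%N -> plead (wgt j)
  (nth 0 [:: dunklQ xp yp X%:P Y%:P a%:P b%:P; dunklR xp yp X%:P Y%:P a%:P b%:P;
    X%:P * Y%:P; X%:P ^+ 4 + Y%:P ^+ 4; xp * X%:P + yp * Y%:P;
    hata1 xp yp X%:P Y%:P a%:P b%:P; hata2 xp yp X%:P Y%:P a%:P b%:P;
    hata3 xp yp X%:P Y%:P] j)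
  (nth 0 [:: x * y; x ^+ 4 + y ^+ 4; X * Y; X ^+ 4 + Y ^+ 4; x * X + y * Y;
    x ^+ 3 * Y + y ^+ 3 * X; x ^+ 2 * Y ^+ 2 + y ^+ 2 * X ^+ 2; x * Y ^+ 3 + y * X ^+ 3] j).
Proof.
case: j => [|[|[|[|[|[|[|[|//]]]]]]]] _; rewrite /wgt /=.
- exact: plead_q.
- exact: plead_r.
- exact: (pleadM (pleadC _) (pleadC _)).
- exact: (pleadD (pleadX 4 (pleadC _)) (pleadX 4 (pleadC _))).
- exact: plead_e.
- exact: plead_a1.
- exact: plead_a2.
- exact: plead_a3.
Qed.
End HatLead.

Lemma rmorph_cls (k : comNzRingType) (G : comNzRingType) (f : {rmorphism {mpoly k[4]} -> G})
    (x := f 'X_(inord 0)) (y := f 'X_(inord 1)) (X := f 'X_(inord 2)) (Y := f 'X_(inord 3)) j :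
  f (cls k j) = nth 0 [:: x * y; x ^+ 4 + y ^+ 4; X * Y; X ^+ 4 + Y ^+ 4; x * X + y * Y;
    x ^+ 3 * Y + y ^+ 3 * X; x ^+ 2 * Y ^+ 2 + y ^+ 2 * X ^+ 2; x * Y ^+ 3 + y * X ^+ 3] j.
Proof.
rewrite /cls.
case: j => [|[|[|[|[|[|[|[|j]]]]]]]] /=.
- by rewrite rmorphM.
- by rewrite rmorphD !rmorphXn.
- by rewrite rmorphM.
- by rewrite rmorphD !rmorphXn.
- by rewrite rmorphD !rmorphM.
- by rewrite rmorphD; congr (_ + _); rewrite rmorphM !rmorphXn.
- by rewrite rmorphD; congr (_ + _); rewrite rmorphM !rmorphXn.
- by rewrite rmorphD; congr (_ + _); rewrite rmorphM !rmorphXn.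
- by rewrite !nth_nil rmorph0.
Qed.

Lemma plead_cls (k : comNzRingType) (G : comNzRingType) (f : {rmorphism {mpoly k[4]} -> G})
    (x y X Y a b : G) (a' b' x' y' X' Y' : {poly G}) :
  f 'X_(inord 0) = x -> f 'X_(inord 1) = y -> f 'X_(inord 2) = X -> f 'X_(inord 3) = Y ->
  a' = a%:P -> b' = b%:P -> x' = x%:P * 'X -> y' = y%:P * 'X -> X' = X%:P -> Y' = Y%:P ->
  forall j : 'I_8, plead (wgt j)
  (nth 0 [:: dunklQ x' y' X' Y' a' b'; dunklR x' y' X' Y' a' b'; X' * Y'; X' ^+ 4 + Y' ^+ 4;
    x' * X' + y' * Y'; hata1 x' y' X' Y' a' b'; hata2 x' y' X' Y' a' b'; hata3 x' y' X' Y'] j)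
  (f (cls k j)).
Proof.
move=> ex ey eX eY -> -> -> -> -> -> j; rewrite rmorph_cls ex ey eX eY.
exact: plead_hats.
Qed.

(** * Evaluation in the centre and proof of the presentation *)

Section Evaluation.
Variables (K : realType) (zeta : K[i]) (hz : 4.-primitive_root zeta).
Local Notation C := K[i].
Local Notation W := (dihedral hz).
Local Notation k := {mpoly C[2]}.
Local Notation H := (cherednik hz).
Local Notation P := {mpoly k[4]}.
Local Notation Px := ('X_(inord 0) : P).
Local Notation Py := ('X_(inord 1) : P).
Local Notation PX := ('X_(inord 2) : P).
Local Notation PY := ('X_(inord 3) : P).
Local Notation "c %:k" := (c%:MP_[2] : k) (at level 2).
Variables (G : fieldType) (frac : {rmorphism P -> G}).
Hypothesis frac_inj : injective frac.
Local Notation T := {poly G}.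
Local Notation rho := (@rho K zeta hz G frac).
Local Notation hat := (@hat K zeta hz G frac).
Local Notation x0 := (tx frac).
Local Notation y0 := (ty frac).
Local Notation X0 := (tX frac).
Local Notation Y0 := (tY frac).
Local Notation iT := (iotaT frac).
Local Notation hgen := (hgen hz frac).
Local Notation Zgen := (Zgen hz).

Definition eT : {rmorphism {mpoly k[8]} -> T} := mmap iT (fun j : 'I_8 => hgen j).
Lemma eTC c : eT c%:MP = (frac c%:MP)%:P. Proof. exact: mmapC. Qed.
Lemma eTU j : eT 'X_j = hgen j. Proof. by rewrite [LHS]mmapX mmap1U. Qed.

Lemma sq_const : exists a b : G, aT hz frac ^+ 2 = a%:P /\ bT hz frac ^+ 2 = b%:P.
Proof.
have h (a b c : G) : (a%:P * (b%:P * c%:P)) ^+ 2 = ((a * (b * c)) ^+ 2)%:P by rewrite expr2 -!polyCM -expr2.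
by eexists; eexists; split; apply: h.
Qed.

Lemma plead_hgen (j : 'I_8) : plead (wgt j) (hgen j) (frac (cls k j)).
Proof.
have [a [b [ea eb]]] := sq_const.
exact: (plead_cls (f := frac) erefl erefl erefl erefl ea eb erefl erefl erefl erefl).
Qed.
Lemma plead_eT (j : 'I_8) : plead (wgt j) (eT 'X_j) (frac (cls k j)).
Proof. rewrite eTU; exact: plead_hgen. Qed.

Definition evH : {mpoly k[8]} -> H := mmap (in_alg H) (fun j : 'I_8 => Zgen j).
(** Centrality travels with the scalar because [hatM] requires a central factor; both claims are
    proved in the same induction. *)
Definition hatted (z : H) (t : T) := centre z /\ hat z = t.
Lemma hatted1 : hatted 1 1.
Proof. by split; [exact: centre1 | exact: hat1]. Qed.
Lemma hatted0 : hatted 0 0.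
Proof. by split; [exact: centre0 | exact: hat0]. Qed.
Lemma hattedD z z' t t' : hatted z t -> hatted z' t' -> hatted (z + z') (t + t').
Proof.
move=> [c e] [c' e']; split; first exact: centreD.
by apply: etrans (hatD frac_inj z z') _; rewrite e e'.
Qed.
Lemma hattedM z z' t t' : hatted z t -> hatted z' t' -> hatted (z * z') (t * t').
Proof.
move=> [c e] [c' e']; split; first exact: centreM.
by apply: etrans (hatM frac_inj z' c) _; rewrite e e'.
Qed.
Lemma hattedZ a z t : hatted z t -> hatted (a *: z) (iT a * t).
Proof.
move=> [c e]; split; first exact: centreZ.
by apply: etrans (hatZ frac_inj a z) _; rewrite e.
Qed.
Lemma hattedX z t n : hatted z t -> hatted (z ^+ n) (t ^+ n).
Proof.
by move=> h; elim: n => [|n IH]; rewrite ?exprS; [exact: hatted1 | exact: hattedM].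
Qed.
Lemma hatted_Zgen j : hatted (Zgen j) (hgen j).
Proof. by split; [exact: (@Zgen_centre K zeta hz G frac frac_inj j) | exact: hat_Zgen]. Qed.

Lemma hatted_ev p : hatted (evH p) (eT p).
Proof.
rewrite /evH /eT /= /mmap; apply: (big_ind2 hatted).
- exact: hatted0.
- by move=> *; apply: hattedD.
move=> m _; rewrite mulr_algl; apply: hattedZ.
rewrite /mmap1; apply: (big_ind2 hatted) => [|*|i _].
- exact: hatted1.
- exact: hattedM.
- by apply: hattedX; apply: hatted_Zgen.
Qed.

Lemma evH_kernel p : evH p = 0 <-> eT p = 0.
Proof.
have [c e] := hatted_ev p; split=> [h|h]; first by rewrite -e h; exact: hat0.
apply: (hat_inj frac_inj c (@centre0 _ _ hz)); rewrite e h; exact: esym (hat0 hz frac_inj).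
Qed.

Lemma zP2 : (zeta%:k * zeta%:k = -1 :> k).
Proof. by rewrite -rmorphM zeta2 // rmorphN1. Qed.
Lemma halfK : (2%:R^-1 : C)%:k * 2%:R = 1 :> k.
Proof.
rewrite -(rmorph_nat (@mpolyC 2 C)) -rmorphM mulVf ?rmorph1 //.
by rewrite Num.Theory.pnatr_eq0.
Qed.

End Evaluation.

Section CentrePresentation.
Variables (K : realType) (zeta : K[i]) (hz : 4.-primitive_root zeta).
Local Notation C := K[i].
Local Notation W := (dihedral hz).
Local Notation k := {mpoly C[2]}.
Local Notation H := (cherednik hz).
Local Notation P := {mpoly k[4]}.
Local Notation Px := ('X_(inord 0) : P).
Local Notation Py := ('X_(inord 1) : P).
Local Notation PX := ('X_(inord 2) : P).
Local Notation PY := ('X_(inord 3) : P).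
Local Notation "c %:k" := (c%:MP_[2] : k) (at level 2).
Local Notation iP := (iotaP K).
Local Notation zP := (cst iP zeta).

Lemma mv_rot (T : comNzRingType) (i : {rmorphism k -> T}) (a b : T) (g := rot hz 1) :
  [/\ mvx i a b g = cst i zeta * a, mvy i a b g = - cst i zeta * b,
      mvX i a b g = - cst i zeta * a & mvY i a b g = cst i zeta * b].
Proof.
have z3 : zeta ^+ 3 = - zeta by rewrite exprS expr2 zeta2 // mulrN1.
rewrite /mvx /mvy /mvX /mvY /g /rot !W_mxME !s_00 !s_01 !s_10 !s_11 muln0 muln1.
rewrite !expr0 expr1 z3 !(mulr0, mul0r, addr0, add0r, mulr1).
by rewrite !rmorphN !rmorph0 !(mul0r, addr0, add0r).
Qed.
Lemma mv_s0 (T : comNzRingType) (i : {rmorphism k -> T}) (a b : T) (g := s_ hz 0) :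
  [/\ mvx i a b g = b, mvy i a b g = a, mvX i a b g = b & mvY i a b g = a].
Proof.
rewrite /mvx /mvy /mvX /mvY /g !s_00 !s_01 !s_10 !s_11 muln0 !expr0.
by rewrite !rmorph1 !rmorph0 !(mul0r, mul1r, addr0, add0r).
Qed.

Lemma ev_subst4 (g h : W) a b c d :
  mvx iP Px Py h = a -> mvy iP Px Py h = b -> mvX iP PX PY g = c -> mvY iP PX PY g = d ->
  forall p, ev g h p = subst4 a b c d p.
Proof.
move=> ea eb ec ed.
apply: (@mpoly_rmorph_eq _ _ _ (ev g h) (subst4 a b c d)) => [t|i].
  exact: etrans (evC g h t) (esym (subst4C a b c d t)).
apply: etrans (evU g h i) _; apply: esym; apply: etrans (subst4U a b c d i) _.
case: (I4E i) => ->; rewrite inordK //=; apply: esym.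
- exact: etrans (evals0 g h) ea.
- exact: etrans (evals1 g h) eb.
- exact: etrans (evals2 g h) ec.
- exact: etrans (evals3 g h) ed.
Qed.

Variables (G : fieldType) (frac : {rmorphism P -> G}).
Hypothesis frac_inj : injective frac.
Hypothesis domk : forall a b : k, a * b = 0 -> (a == 0) || (b == 0).
Hypothesis domP : forall a b : P, a * b = 0 -> (a == 0) || (b == 0).
Local Notation T := {poly G}.
Local Notation rho := (@rho K zeta hz G frac).
Local Notation hat := (@hat K zeta hz G frac).
Local Notation evH := (@evH K zeta hz).
Local Notation eT := (@eT K zeta hz G frac).
Local Notation Gen := (Gen frac eT).

Lemma Gen_invariant n f : (forall m, m \in msupp f -> wt m = n) ->
  (forall g : W, ev g g f = f) -> Gen n f.
Proof.
move=> hw hf.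
apply: (Gen_inv domk (zP2 hz) (halfK K) (eTC hz frac) (plead_eT hz frac) hw).
  apply: etrans (hf (rot hz 1)); apply: esym.
  have [ex ey _ _] := mv_rot iP Px Py; have [_ _ eX eY] := mv_rot iP PX PY.
  have zN : - zP = (- zeta%:k)%:MP by rewrite [RHS]rmorphN.
  rewrite zN in ey eX; exact: (ev_subst4 ex ey eX eY).
apply: etrans (hf (s_ hz 0)); apply: esym.
have [ex ey _ _] := mv_s0 iP Px Py; have [_ _ eX eY] := mv_s0 iP PX PY.
exact: (ev_subst4 ex ey eX eY).
Qed.

(** All diagonal entries equal [hat z], while [mlead_apbw] gives the entry at g the top coefficient
    [ev g g f]. Hence f is W-invariant, so some polynomial in the generators has the same leading
    term. *)
Lemma centre_lead z N : centre z -> (size (hat z) <= N.+1)%N ->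
  exists p, (size (hat z - eT p)%R <= N)%N.
Proof.
move=> cz sz; have eF := pbw_invK z; move: (pbw_inv z) eF => F eF.
have rE g h : went (rho z) g h = (g == h)%:R * hat z.
  by rewrite [in LHS](rho_scalar frac_inj cz) went_scalar.
have hN : degb N.+1 F.
  apply: (degb_size frac_inj) => w; rewrite eF rE.
  by case: eqP => _; rewrite ?mul1r // mul0r size_poly0.
have lead (g : W) : plead N (hat z) (frac (ev g g (top N (F 1%g)))).
  have := mlead_apbw frac_inj hN g g; rewrite eF mulVg.
  by rewrite rE eqxx mul1r.
pose f := top N (F 1%g).
have lead1 : plead N (hat z) (frac f).
  by have := lead 1%g; rewrite (ev_id hz).
have [p hp] : Gen N f.
  apply: Gen_invariant => [m|g].
    by rewrite mcoeff_msupp mcoeff_top; case: ifP => [/eqP|_] //; rewrite eqxx.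
  by apply: frac_inj; rewrite -(lead g).2 -lead1.2.
exists p; apply: plead_leq; rewrite -(subrr (frac f)); apply: pleadD => //.
by split; [rewrite size_polyN hp.1 | rewrite coefN hp.2].
Qed.

Lemma evH_surj z : centre z -> exists p, evH p = z.
Proof.
move=> cz; have [N hN] : exists N, (size (hat z) <= N)%N by exists (size (hat z)).
elim: N z cz hN => [|N IH] z cz hN.
  exists 0; rewrite /evH raddf0; apply: (hat_inj frac_inj (@centre0 _ _ hz) cz).
  apply: etrans (hat0 hz frac_inj) _; apply: esym.
  by apply/eqP; rewrite -size_poly_leq0.
have [p hp] := centre_lead cz hN.
have [cp ep] := hatted_ev hz frac_inj p.
have [|q hq] := IH _ (centreD cz (centreN cp)).
  have -> : hat (z - evH p) = hat z - eT p; last exact: hp.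
  have hN1 : hat (- evH p) = - eT p.
    rewrite -scaleN1r; apply: etrans (hatZ frac_inj _ _) _.
    by rewrite ep (rmorphN1 (iotaT frac)) mulN1r.
  by apply: etrans (hatD frac_inj _ _) _; rewrite hN1.
have evD : evH (q + p) = evH q + evH p by exact: raddfD.
by exists (q + p); rewrite evD hq; exact: subrK.
Qed.

Lemma congr_fun10 (A B : Type) (f : A -> A -> A -> A -> A -> A -> A -> A -> A -> A -> B)
    a b c d e g h i j l a' b' c' d' e' g' h' i' j' l' :
  a = a' -> b = b' -> c = c' -> d = d' -> e = e' -> g = g' -> h = h' -> i = i' ->
  j = j' -> l = l' -> f a b c d e g h i j l = f a' b' c' d' e' g' h' i' j' l'.
Proof. by move=> -> -> -> -> -> -> -> -> -> ->. Qed.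

Lemma relators_eT : map eT (relators (parA K) (parB K)) = nseq 9 0.
Proof.
have eU j : (j < 8)%N -> eT 'X_(inord j) = hgen hz frac j.
  by move=> hj; apply: etrans (eTU hz frac _) _; rewrite inordK.
apply: etrans (map_relator_seq eT _ _ _ _ _ _ _ _ _ _) _.
apply: etrans (hat_relator_seq (tx frac) (ty frac) (aT_sq hz frac_inj) (bT_sq hz frac_inj)).
apply: (congr_fun10 (@relator_seq T)).
- exact: eTC.
- exact: eTC.
- exact: (eU 0%N isT).
- exact: (eU 1%N isT).
- exact: (eU 2%N isT).
- exact: (eU 3%N isT).
- exact: (eU 4%N isT).
- exact: (eU 5%N isT).
- exact: (eU 6%N isT).
- exact: (eU 7%N isT).
Qed.

Theorem centre_presentation : presented_by (@centre K zeta hz) (fun j : 'I_8 => Zgen hz j)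
  (relators (parA K) (parB K)).
Proof.
split=> [j|z cz|p].
- exact: (@Zgen_centre K zeta hz G frac frac_inj j).
- exact: evH_surj.
apply: (iff_trans (evH_kernel hz frac_inj p)).
apply: (gen_ideal_kernel (zP2 hz) (halfK K) domP frac_inj (eTC hz frac) (plead_eT hz frac)).
move=> r hr; have := map_f eT hr; rewrite relators_eT.
by rewrite mem_nseq => /eqP.
Qed.
End CentrePresentation.

Lemma fraction_embedding (D : idomainType) :
  exists (G : fieldType) (f : {rmorphism D -> G}), injective f.
Proof.
exists {fraction D}, (@FracField.tofrac D) => a b /eqP.
by rewrite tofrac_eq => /eqP.
Qed.
Lemma idomain_mul0 (D : idomainType) (a b : D) : a * b = 0 -> (a == 0) || (b == 0).
Proof. by move/eqP; rewrite mulf_eq0. Qed.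

Section IteratedMpoly.
Variable F : idomainType.
Local Notation k := (mpoly 2 F).
Local Notation P := (mpoly 4 k).
Lemma mpoly2_mul0 (a b : k) : a * b = 0 -> (a == 0) || (b == 0).
Proof. exact: idomain_mul0. Qed.
Lemma mpoly24_mul0 (a b : P) : a * b = 0 -> (a == 0) || (b == 0).
Proof. exact: idomain_mul0. Qed.
Lemma mpoly24_frac : exists (G : fieldType) (f : {rmorphism P -> G}), injective f.
Proof. exact: (fraction_embedding P). Qed.
End IteratedMpoly.
Section CoefficientRing.
Variable K : realType.
Local Notation k := (mpoly 2 K[i]).
Local Notation P := (mpoly 4 k).
Lemma domk (a b : k) : a * b = 0 -> (a == 0) || (b == 0).
Proof. exact: (@mpoly2_mul0 K[i]). Qed.
Lemma domP (a b : P) : a * b = 0 -> (a == 0) || (b == 0).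
Proof. exact: (@mpoly24_mul0 K[i]). Qed.
Lemma coeff_frac : exists (G : fieldType) (f : {rmorphism P -> G}), injective f.
Proof. exact: (@mpoly24_frac K[i]). Qed.
End CoefficientRing.
Theorem proposition8p4 (K : realType) (zeta : K[i])
    (hz : 4.-primitive_root zeta) :
  let k := {mpoly K[i][2]} in
  let A : {mpoly k[8]} := (parA K)%:MP in
  let B : {mpoly k[8]} := (parB K)%:MP in
  let q : {mpoly k[8]} := 'X_(inord 0) in
  let r : {mpoly k[8]} := 'X_(inord 1) in
  let Q : {mpoly k[8]} := 'X_(inord 2) in
  let R : {mpoly k[8]} := 'X_(inord 3) in
  let eu : {mpoly k[8]} := 'X_(inord 4) in
  let a1 : {mpoly k[8]} := 'X_(inord 5) in
  let a2 : {mpoly k[8]} := 'X_(inord 6) in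
  let a3 : {mpoly k[8]} := 'X_(inord 7) in
  presented_by (@centre K zeta hz)
    (fun j : 'I_8 =>
       [:: H_q hz; H_r hz; H_Q hz; H_R hz; H_eu hz;
           H_a hz 1; H_a hz 2; H_a hz 3]`_j)
    [:: eu * a1 - (q * a2 + r * Q - 2%:R * (A ^+ 2 - B ^+ 2) * q);
        eu * a2 - (q * a3 + Q * a1 - 2%:R * (A ^+ 2 - B ^+ 2) * eu);
        eu * a3 - (q * R + Q * a2 - 2%:R * (A ^+ 2 - B ^+ 2) * Q);
        a1 ^+ 2 - (r * a2 - q ^+ 2 * eu ^+ 2 + 4%:R * q ^+ 3 * Q
                   + 2%:R * (A ^+ 2 - B ^+ 2) * r
                   + 8%:R * (A ^+ 2 + B ^+ 2) * q ^+ 2);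
        a1 * a2 - (r * a3 - q * eu ^+ 3 + 4%:R * q ^+ 2 * Q * eu
                   + 2%:R * (A ^+ 2 - B ^+ 2) * a1
                   + 8%:R * (A ^+ 2 + B ^+ 2) * q * eu);
        a1 * a3 - (r * R - eu ^+ 4 + 5%:R * q * Q * eu ^+ 2
                   - 4%:R * q ^+ 2 * Q ^+ 2
                   + 4%:R * (A ^+ 2 - B ^+ 2) * a2
                   + 8%:R * (A ^+ 2 + B ^+ 2) * eu ^+ 2
                   - 8%:R * (A ^+ 2 + B ^+ 2) * q * Q
                   - 8%:R * (A ^+ 2 - B ^+ 2) ^+ 2);
        a2 ^+ 2 - (r * R - eu ^+ 4 + 4%:R * q * Q * eu ^+ 2
                   + 4%:R * (A ^+ 2 - B ^+ 2) * a2
                   + 8%:R * (A ^+ 2 + B ^+ 2) * eu ^+ 2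
                   - 4%:R * (A ^+ 2 - B ^+ 2) ^+ 2);
        a2 * a3 - (R * a1 - Q * eu ^+ 3 + 4%:R * q * Q ^+ 2 * eu
                   + 2%:R * (A ^+ 2 - B ^+ 2) * a3
                   + 8%:R * (A ^+ 2 + B ^+ 2) * Q * eu);
        a3 ^+ 2 - (R * a2 - Q ^+ 2 * eu ^+ 2 + 4%:R * q * Q ^+ 3
                   + 2%:R * (A ^+ 2 - B ^+ 2) * R
                   + 8%:R * (A ^+ 2 + B ^+ 2) * Q ^+ 2)].
Proof.
have [G [frac frac_inj]] := coeff_frac K.
exact: (centre_presentation hz frac_inj (@domk K) (@domP K)).
Qed.
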